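(* Let $n \ge 10$ and let $C$ be a cubic form in $n$ variables as described in the context which satisfies Davenport's Geometric Condition. Then the singular series of $C$ is absolutely convergent, i.e. \[ \sum_{q=1}^{\infty} \sum_{\substack{a \bmod q\\ \gcd(a,q)=1}} \frac{|S(q,a)|}{q^n} < \infty . \] In particular, $\mathfrak{S} = \prod_p \chi_p$ and $\mathfrak{S} > 0$.
   Context: Let $C(\mathbf{x}) = \sum_{i,j,k=1}^n c_{ijk} x_i x_j x_k$ be a cubic form with integer coefficients $c_{ijk}$ that are symmetric in $i,j,k$. Let $M(\mathbf{x})$ be the $n\times n$ matrix with entries $M(\mathbf{x})_{jk} = \sum_{i=1}^n c_{ijk} x_i$, and $r(\mathbf{x})$ its rank over $\mathbb{Q}$. $C$ satisfies Davenport's Geometric Condition if for every integer $0 \le r \le n$ and every $\varepsilon>0$, $\#\{\mathbf{x} \in \mathbb{Z}^n : \|\mathbf{x}\|_\infty \le P,\ r(\mathbf{x}) = r\} \ll_{\varepsilon} P^{r+\varepsilon}$ for all $P\ge 1$. Write $e(x)=e^{2\pi i x}$ and define the Gauss sums $S(q,a) = \sum_{\mathbf{x} \bmod q} e(aC(\mathbf{x})/q)$, the singular series $\mathfrak{S} = \sum_{q\ge1}\sum_{\gcd(a,q)=1} S(q,a)/q^n$, and the $p$-adic densities $\chi_p = \sum_{k\ge 0}\sum_{a \bmod p^k,\ \gcd(a,p^k)=1} S(p^k,a)/p^{kn}$. *)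

(* Defs.v *)
From HB Require Import structures.
From mathcomp Require Import all_boot all_order all_algebra.
From mathcomp Require Import all_classical all_reals all_analysis.
From mathcomp Require Import complex.
Set Implicit Arguments. Unset Strict Implicit. Unset Printing Implicit Defensive.
Import Order.TTheory GRing.Theory Num.Theory.
Import numFieldNormedType.Exports.
Local Open Scope classical_set_scope.
Local Open Scope ring_scope.

Definition cubic_form (n : nat) (c : 'I_n -> 'I_n -> 'I_n -> int)
  (x : 'I_n -> int) : int :=
  \sum_(i < n) \sum_(j < n) \sum_(k < n) c i j k * x i * x j * x k.

(* symmetry of c_ijk in i,j,k (transpositions (12) and (23) generate S_3) *)
Definition symmetric_coeffs (n : nat) (c : 'I_n -> 'I_n -> 'I_n -> int) :=
  forall i j k, c i j k = c j i k /\ c i j k = c i k j.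

Definition Mx (n : nat) (c : 'I_n -> 'I_n -> 'I_n -> int) (x : 'I_n -> int)
  : 'M[rat]_n :=
  \matrix_(j < n, k < n) ((\sum_(i < n) c i j k * x i)%:~R : rat).

Definition rk (n : nat) (c : 'I_n -> 'I_n -> 'I_n -> int) (x : 'I_n -> int)
  : nat := \rank (Mx c x).

(* The integer vectors x with ||x||_oo <= N are encoded as y : 'I_n -> 'I_(2N+1)
   via x_i = y_i - N. *)
Definition box_vec (n N : nat) (y : {ffun 'I_n -> 'I_(2 * N + 1)})
  : 'I_n -> int := fun i => (y i : nat)%:Z - N%:Z.

(* #{x in Z^n : ||x||_oo <= P, r(x) = r}; for real P >= 0 this is the box of
   half-width floor(P). *)
Definition count_rank (R : realType) (n : nat)
  (c : 'I_n -> 'I_n -> 'I_n -> int) (P : R) (r : nat) : nat :=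
  #|[set y : {ffun 'I_n -> 'I_(2 * Num.truncn P + 1)} |
      rk c (box_vec y) == r]|.

Definition davenport_geometric (R : realType) (n : nat)
  (c : 'I_n -> 'I_n -> 'I_n -> int) : Prop :=
  forall (r : nat), (r <= n)%N ->
  forall eps : R, 0 < eps ->
  exists K : R, forall P : R, 1 <= P ->
    (count_rank c P r)%:R <= K * P `^ (r%:R + eps).

Definition ee (R : realType) (x : R) : R[i] :=
  (cos (2 * pi * x) +i* sin (2 * pi * x))%C.

Definition gauss_sum (R : realType) (n : nat)
  (c : 'I_n -> 'I_n -> 'I_n -> int) (q : nat) (a : int) : R[i] :=
  \sum_(x : {ffun 'I_n -> 'I_q})
     ee ((a * cubic_form c (fun i => (x i : nat)%:Z))%:~R / q%:R : R).

Definition ss_term (R : realType) (n : nat)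
  (c : 'I_n -> 'I_n -> 'I_n -> int) (q : nat) : R[i] :=
  \sum_(a < q | coprime a q) gauss_sum R c q a%:Z / (q%:R ^+ n).

Definition ss_abs_term (R : realType) (n : nat)
  (c : 'I_n -> 'I_n -> 'I_n -> int) (q : nat) : R :=
  \sum_(a < q | coprime a q) Normc.normc (gauss_sum R c q a%:Z) / (q%:R ^+ n).

(* convergence of a sequence of complex numbers: C carries the product
   topology of R x R, i.e. real and imaginary parts converge. *)
Definition ccvg_to (R : realType) (u : nat -> R[i]) (l : R[i]) : Prop :=
  (fun N => Re (u N)) @ \oo --> Re l /\ (fun N => Im (u N)) @ \oo --> Im l.

(* Main.v *)
(** Put u(q) = sum over a coprime to q of |S(q,a)| / q^n.  By the Chinese remainder theorem u is
    multiplicative, so everything follows from the boundedness of the sum of u(p^k) over all primes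
    p and all k >= 1, together with the positivity of every chi_p.

    Weyl differencing bounds |S(q,a)|^2 by an average over |h| <= H of sqrt (q^n N_q(h)), where
    N_q(h) is the number of y mod q with 6 M(h) y = 0.  The Smith normal form of M(h) bounds N_q(h)
    in terms of the rank r of M(h) over Q, and the Geometric Condition says how often each rank
    occurs.  The choice H = q^(1/3) gives u(q) << q^(-3/5), which is enough for all k >= 2.  For
    k = 1 one averages over the primes p in [Q, 2Q) with H^n = Q^(41/10).  This loses only for
    n = 10, through the pairs (h, p) for which M(h) is nonsingular but drops rank by at least 4
    modulo p.  Such pairs are rare: on a line h' + t h0 the parameter t is a fourfold root mod p of
    the polynomial f(t) = det M(h' + t h0), of degree n < 12.  If G and E are the products of the
    irreducible factors of f, respectively of those of multiplicity at least 4, then deg E <= 2,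
    so E(t) is a nonzero integer smaller than p, hence G has a double root mod p and p divides the
    resultant of G and G'.

    The partial sums of chi_p count the zeros of C modulo p^N.  If C has a nonsingular p-adic zero,
    Hensel's lemma shows that there are >> p^(N(n-1)) of them.  Otherwise T_i = {x : p^i | C(x)} is
    stable under addition for every i, and Chevalley's theorem for cubic polynomials in 4 variables
    bounds the index of T_(i+1) in T_i by p^3.  On the other hand T_(3K) lies in p^(K-O(1)) Z^n, by
    nondegeneracy of C (the Geometric Condition for r = 0), and for n > 9 this is absurd. *)
Require Import Defs.
From HB Require Import structures.
From mathcomp Require Import all_boot all_order all_fingroup all_algebra all_field.
From mathcomp Require Import zify ring lra.
From mathcomp Require Import all_classical all_reals all_analysis.
From mathcomp Require Import complex.
Set Implicit Arguments. Unset Strict Implicit. Unset Printing Implicit Defensive.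
Import Order.TTheory GRing.Theory Num.Theory.
Import numFieldNormedType.Exports.
Local Open Scope ring_scope.

(** * Hensel lifting *)

(** Up to eps, rank r contributes q^(n/2) (H^3/q)^(r/2) to the sum of sqrt N_q(h); the factor
    H^(r/2) is the cost of the elementary divisors of M(h). H = q^(1/3) makes all ranks equal, but
    for n = 10 it yields only u(q) << q^(-2/3+eps), which is not summable over primes. Averaging
    over p helps because the product of the nonzero elementary divisors of M(h) is at most a power
    of Q, so only O(1) primes near Q divide it; all other primes p > 3 have N_p(h) <= p^(n-r). Good
    primes then give a sum of u(p)^2 of order Q^3 / H^n, and passing from u^2 to u asks for H^n
    beyond Q^4. The few bad primes at full rank contribute Q^(3-n/2) H^(n/2) to the square of the
    sum of u(p), which for n = 10 exceeds 1 by an arbitrarily small power. The multiplicity 4 is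
    forced from both sides. Corank at most 3 means N_p(h) <= p^3 and gains Q^(-1/2), while corank 4
    would only break even. Multiplicity at least 4 means deg E <= 2 and |E(t)| << H^2 = Q^(41/50) <
    p, while multiplicity 3 would allow deg E = 3, and H^3 > Q. *)

Section Trilinear.
Variables (n : nat) (c : 'I_n -> 'I_n -> 'I_n -> int).
Implicit Types x y z w : 'I_n -> int.

Definition vadd x y : 'I_n -> int := fun i => x i + y i.
Definition vscale (k : int) x : 'I_n -> int := fun i => k * x i.

Definition tri x y z : int :=
  \sum_(i < n) \sum_(j < n) \sum_(k < n) c i j k * x i * y j * z k.

Lemma eq_tri x x' y y' z z' :
  x =1 x' -> y =1 y' -> z =1 z' -> tri x y z = tri x' y' z'.
Proof.
move=> ex ey ez; do 3!(apply: eq_bigr => ? _).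
by rewrite ex ey ez.
Qed.

Lemma triDl x y z w : tri (vadd x y) z w = tri x z w + tri y z w.
Proof.
rewrite -big_split; apply: eq_bigr => i _; rewrite -big_split; apply: eq_bigr => j _.
by rewrite -big_split; apply: eq_bigr => k _; rewrite /vadd /=; ring.
Qed.

Lemma triZl (a : int) x z w : tri (vscale a x) z w = a * tri x z w.
Proof.
rewrite mulr_sumr; apply: eq_bigr => i _; rewrite mulr_sumr; apply: eq_bigr => j _.
by rewrite mulr_sumr; apply: eq_bigr => k _; rewrite /vscale; ring.
Qed.

Hypothesis symc : forall i j k, c i j k = c j i k /\ c i j k = c i k j.

Lemma triC12 x y z : tri x y z = tri y x z.
Proof.
rewrite /tri exchange_big; apply: eq_bigr => i _; apply: eq_bigr => j _.
by apply: eq_bigr => k _; rewrite (symc j i k).1; ring.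
Qed.

Lemma triC23 x y z : tri x y z = tri x z y.
Proof.
apply: eq_bigr => i _; rewrite exchange_big; apply: eq_bigr => j _.
by apply: eq_bigr => k _; rewrite (symc i k j).2; ring.
Qed.

Lemma triDm x y z w : tri z (vadd x y) w = tri z x w + tri z y w.
Proof. by rewrite triC12 triDl triC12 (triC12 y). Qed.

Lemma triDr x y z w : tri z w (vadd x y) = tri z w x + tri z w y.
Proof. by rewrite triC23 triDm triC23 (triC23 z y). Qed.

Lemma triZm (a : int) x z w : tri z (vscale a x) w = a * tri z x w.
Proof. by rewrite triC12 triZl triC12. Qed.

Lemma triZr (a : int) x z w : tri z w (vscale a x) = a * tri z w x.
Proof. by rewrite triC23 triZm triC23. Qed.

Definition triE := (triDl, triDm, triDr, triZl, triZm, triZr).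

Lemma tri_cubeD x y :
  tri (vadd x y) (vadd x y) (vadd x y) =
  tri x x x + 3 * tri x x y + 3 * tri y y x + tri y y y.
Proof.
rewrite !triE (triC12 y x x) (triC23 x y x) (triC12 x y y) (triC23 y x y).
by ring.
Qed.

Lemma tri_sqD x y v :
  tri (vadd x y) (vadd x y) v = tri x x v + 2 * tri x y v + tri y y v.
Proof. by rewrite !triE (triC12 y x v); ring. Qed.

End Trilinear.

Lemma prime_invz (p : nat) (u : int) : prime p -> ~~ (p%:Z %| u)%Z ->
  exists u' k : int, u * u' = 1 + k * p%:Z.
Proof.
move=> pp pu; have : coprimez p u by rewrite coprimezE /= prime_coprime // -dvdzE.
case/coprimezP=> -[a b] /= E; exists b, (- a); rewrite mulrC -E; ring.
Qed.

(** The nonlinear terms carry a factor p, so the derivative in s is u modulo p at every s. Every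
    approximate root can therefore be corrected, and s = 0 starts the induction. *)
Lemma hensel (p : nat) (a u b e : int) : prime p -> ~~ (p%:Z %| u)%Z ->
  forall N : nat, exists s : int,
    ((p ^ N)%N%:Z %| a + u * s + p%:Z * (b * s ^+ 2 + e * s ^+ 3))%Z.
Proof.
move=> pp pu; elim=> [|N [s /dvdzP[m Em]]]; first by exists 0; rewrite expn0 dvd1z.
have [u' [k Eu]] := prime_invz pp pu.
set P := (p ^ N)%N%:Z in Em.
(* Newton correction: [u'] inverts u modulo p, so this cancels the error m P modulo p P. *)
exists (s - P * (m * u')); apply/dvdzP.
set t := m * u' in Em *.
exists (- k * m - (b * (- 2 * s * t + P * t ^+ 2) +
  e * (- 3 * s ^+ 2 * t + 3 * s * P * t ^+ 2 - P ^+ 2 * t ^+ 3)) * - 1).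
rewrite expnS PoszM -/P.
transitivity (m * P - u * u' * m * P + p%:Z * P * ((b * (- 2 * s * t + P * t ^+ 2) +
  e * (- 3 * s ^+ 2 * t + 3 * s * P * t ^+ 2 - P ^+ 2 * t ^+ 3)))).
  by rewrite -Em /t; ring.
by rewrite Eu; ring.
Qed.

Lemma dvdz_sub_small (q a b : nat) : (a < q)%N -> (b < q)%N ->
  (q%:Z %| a%:Z - b%:Z)%Z -> a = b.
Proof.
move=> aq bq; rewrite -eqz_mod_dvd => /eqP.
by rewrite !modz_nat !modn_small // => -[].
Qed.

Section Count.
Variables (n : nat) (c : 'I_n -> 'I_n -> 'I_n -> int).
Hypothesis symc : forall i j k, c i j k = c j i k /\ c i j k = c i k j.
Let C x := tri c x x x.

Definition vres (q : nat) (y : {ffun 'I_n -> 'I_q}) : 'I_n -> int :=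
  fun i => (y i : nat)%:Z.

(** Hensel's condition at level l: the derivative of C at x along v, which is [3 * tri c x x v], has
    valuation exactly l, and C(x) vanishes to more than twice that order. *)
Definition nonsing_zero (p : nat) (x v : 'I_n -> int) (l : nat) :=
  [/\ ((p ^ (2 * l + 1))%N%:Z %| C x)%Z, ((p ^ l)%N%:Z %| 3 * tri c x x v)%Z
    & ~~ ((p ^ l.+1)%N%:Z %| 3 * tri c x x v)%Z].

Definition nzeros (q : nat) : nat := #|[set y : {ffun 'I_n -> 'I_q} | (q%:Z %| C (vres y))%Z]|.

Lemma dvd_tri_congr (q : int) x y : (forall i, (q %| x i - y i)%Z) -> (q %| C x - C y)%Z.
Proof.
move=> h; pose z i := (((x i - y i) %/ q)%Z : int).
have -> : C x = C (vadd y (vscale q z)).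
  by apply: eq_tri => i; rewrite /vadd /vscale /z mulrC divzK //; ring.
rewrite /C tri_cubeD // !triE //.
by apply/dvdzP; exists (3 * tri c y y z + 3 * (q * tri c z z y) + q ^+ 2 * tri c z z z); ring.
Qed.

Lemma dvd_exp_le (p a b : nat) (m : int) : (a <= b)%N ->
  ((p ^ b)%N%:Z %| m)%Z -> ((p ^ a)%N%:Z %| m)%Z.
Proof. by move=> ab; apply: dvdz_trans; rewrite dvdzE /= dvdn_exp2l. Qed.

Lemma exact_quot (p l : nat) (m : int) : (0 < p)%N -> ((p ^ l)%N%:Z %| m)%Z ->
  ~~ ((p ^ l.+1)%N%:Z %| m)%Z -> exists2 u, m = u * (p ^ l)%N%:Z & ~~ (p%:Z %| u)%Z.
Proof.
move=> p0 /dvdzP[u ->]; rewrite expnS PoszM dvdz_mul2r ?expf_neq0 //; last first.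
  by rewrite eqz_nat expn_eq0; lia.
by exists u.
Qed.

(** Along x + p^(2l+1) w + s p^(l+1) v the value of C is p^(2l+1) times a cubic in s of the shape
    solved by [hensel]. The shift by p^(2l+1) w changes neither C(x) modulo p^(2l+1) nor the
    valuation l of the derivative. *)
Lemma hensel_lift p x v l : prime p -> nonsing_zero p x v l ->
  forall (w : 'I_n -> int) (N : nat), exists s : int,
  ((p ^ N)%N%:Z %| C (vadd (vadd x (vscale (p ^ (2 * l + 1))%N w))
                    (vscale s (vscale (p ^ l.+1)%N v))))%Z.
Proof.
move=> pp [/dvdzP[m Em] d1 d2] w N.
have [u Eu pu] := exact_quot (prime_gt0 pp) d1 d2.
set P := (p ^ l)%N%:Z in Eu.
have E1 : (p ^ (2 * l + 1))%N%:Z = P ^+ 2 * p%:Z.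
  by rewrite addn1 expnSr [(2 * l)%N]mulnC expnM PoszM -mulnn PoszM -expr2.
have E2 : (p ^ l.+1)%N%:Z = P * p%:Z by rewrite expnSr PoszM.
rewrite E1 E2 in Em *.
pose y := vadd x (vscale (P ^+ 2 * p%:Z) w).
pose a := m + 3 * tri c x x w + 3 * (P ^+ 2 * p%:Z) * tri c w w x + (P ^+ 2 * p%:Z) ^+ 2 * tri c w w w.
have Ca : C y = a * (P ^+ 2 * p%:Z).
  by rewrite /C /y tri_cubeD // !triE // -[tri c x x x]/(C x) Em /a; ring.
pose u1 := u + p%:Z * P * (6 * tri c x w v + 3 * (P ^+ 2 * p%:Z) * tri c w w v).
have Du : 3 * tri c y y v = u1 * P.
  by rewrite /y tri_sqD // !triE // !mulrDr Eu /u1; ring.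
have pu1 : ~~ (p%:Z %| u1)%Z.
  apply: contra pu => h.
  have -> : u = u1 - p%:Z * (P * (6 * tri c x w v + 3 * (P ^+ 2 * p%:Z) * tri c w w v)).
    by rewrite /u1; ring.
  by rewrite rpredB // dvdz_mulr.
have [s hs] := hensel a (3 * tri c v v y) (P * p%:Z * tri c v v v) pp pu1 N.
exists s; rewrite -/y; clearbody y.
have -> : C (vadd y (vscale s (vscale (P * p) v))) =
   (P ^+ 2 * p%:Z) * (a + u1 * s + p%:Z * (3 * tri c v v y * s ^+ 2 + P * p%:Z * tri c v v v * s ^+ 3)).
  rewrite /C tri_cubeD // -[tri c y y y]/(C y) Ca !triE // .
  transitivity (a * (P ^+ 2 * p%:Z) + s * (P * p%:Z) * (3 * tri c y y v) +
   3 * (s * (P * p%:Z) * (s * (P * p%:Z) * tri c v v y)) +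
   s * (P * p%:Z) * (s * (P * p%:Z) * (s * (P * p%:Z) * tri c v v v))).
    by ring.
  by rewrite Du; ring.
by rewrite dvdz_mull.
Qed.

Definition vmod (q : nat) (q0 : (0 < q)%N) (x : 'I_n -> int) : {ffun 'I_n -> 'I_q} :=
  [ffun i => Ordinal (ltn_pmod (absz (x i %% q%:Z)%Z) q0)].

Lemma vresK (q : nat) (q0 : (0 < q)%N) x i : (q%:Z %| vres (vmod q0 x) i - x i)%Z.
Proof.
rewrite /vres ffunE /=.
have h0 : (0 <= x i %% q)%Z by rewrite modz_ge0 //; lia.
have h1 : (x i %% q < q)%Z by apply: ltz_pmod; lia.
rewrite modn_small; last by lia.
rewrite gez0_abs //; apply/dvdzP; exists (- (x i %/ q)%Z).
by rewrite {2}(divz_eq (x i) q); ring.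
Qed.

(** Each w modulo p^(N-k) yields a zero y. If s is recorded modulo p^N, removing the shift along v
    from y recovers p^k w, hence w. So s costs one factor p^N, which is the codimension of the
    hypersurface. *)
Lemma nzeros_lower p x v l : prime p -> nonsing_zero p x v l ->
  forall N, (p ^ (N * n) <= nzeros (p ^ N) * p ^ N * p ^ ((2 * l + 1) * n))%N.
Proof.
move=> pp ns N; set k := (2 * l + 1)%N.
have p0 : (0 < p ^ N)%N by rewrite expn_gt0 prime_gt0.
case: (leqP N k) => [Nk|/ltnW kN].
  (* For N <= k the zero vector alone is enough. *)
  apply: (@leq_trans (p ^ (k * n))); first by rewrite leq_exp2l ?prime_gt1 // leq_mul2r Nk orbT.
  rewrite -{1}[(p ^ _)%N]mul1n leq_mul2r muln_gt0 p0 andbT; apply/orP; right.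
  rewrite card_gt0; apply/set0Pn; exists [ffun=> Ordinal p0].
  have E0 : C (fun=> 0) = 0 by do 3!(apply: big1 => ? _); ring.
  rewrite inE -[C _]subr0 -E0.
  by apply: dvd_tri_congr => i; rewrite /vres ffunE subrr dvdz0.
have /fin_all_exists [s hs] : forall w : {ffun 'I_n -> 'I_(p ^ (N - k))}, exists s : int,
  ((p ^ N)%N%:Z %| C (vadd (vadd x (vscale (p ^ k)%N (vres w)))
                    (vscale s (vscale (p ^ l.+1)%N v))))%Z.
  by move=> w; apply: hensel_lift.
pose y w := vmod p0 (vadd (vadd x (vscale (p ^ k)%N (vres w))) (vscale (s w) (vscale (p ^ l.+1)%N v))).
pose sm (w : {ffun 'I_n -> 'I_(p ^ (N - k))}) : 'I_(p ^ N) :=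
   Ordinal (ltn_pmod (absz (s w %% (p ^ N)%N)%Z) p0).
have Esm w : ((p ^ N)%N%:Z %| (sm w : nat)%:Z - s w)%Z.
  have h0 : (0 <= s w %% (p ^ N)%N)%Z by rewrite modz_ge0 //; lia.
  have h1 : (s w %% (p ^ N)%N < (p ^ N)%N)%Z by apply: ltz_pmod; lia.
  rewrite /= modn_small; last by lia.
  rewrite gez0_abs //; apply/dvdzP; exists (- (s w %/ (p ^ N)%N)%Z).
  by rewrite {2}(divz_eq (s w) (p ^ N)%N); ring.
have inj : injective (fun w => (y w, sm w)).
  move=> w w' [Ey /(congr1 Posz) Es]; apply/ffunP => i.
  have Es' : ((p ^ N)%N%:Z %| s w - s w')%Z.
    have -> : s w - s w' = ((sm w' : nat)%:Z - s w') - ((sm w : nat)%:Z - s w).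
      by rewrite (_ : (sm w : nat)%:Z = (sm w' : nat)%:Z) //; ring.
    by rewrite rpredB.
  have h1 := vresK p0 (vadd (vadd x (vscale (p ^ k)%N (vres w))) (vscale (s w) (vscale (p ^ l.+1)%N v))) i.
  have h2 := vresK p0 (vadd (vadd x (vscale (p ^ k)%N (vres w'))) (vscale (s w') (vscale (p ^ l.+1)%N v))) i.
  rewrite -/(y _) in h1; rewrite -/(y _) in h2; rewrite Ey in h1.
  have : ((p ^ N)%N%:Z %| (p ^ k)%N%:Z * (vres w i - vres w' i))%Z.
    have -> : (p ^ k)%N%:Z * (vres w i - vres w' i) =
      (vres (y w') i - vadd (vadd x (vscale (p ^ k)%N (vres w'))) (vscale (s w') (vscale (p ^ l.+1)%N v)) i)
      - (vres (y w') i - vadd (vadd x (vscale (p ^ k)%N (vres w))) (vscale (s w) (vscale (p ^ l.+1)%N v)) i)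
      - (s w - s w') * ((p ^ l.+1)%N%:Z * v i).
      by rewrite /vadd /vscale; ring.
    by apply: rpredB; [exact: rpredB | exact: dvdz_mulr].
  have -> : (p ^ N)%N%:Z = (p ^ k)%N%:Z * (p ^ (N - k))%N%:Z.
    by rewrite -PoszM -expnD subnKC.
  rewrite dvdz_mul2l; last first.
    by rewrite eqz_nat -lt0n expn_gt0 prime_gt0.
  rewrite /vres => h; apply: val_inj => /=.
  exact: dvdz_sub_small h.
have : (#|{ffun 'I_n -> 'I_(p ^ (N - k))}| <=
  #|finset.setX [set y : {ffun 'I_n -> 'I_(p ^ N)} | ((p ^ N)%N%:Z %| C (vres y))%Z] [set: 'I_(p ^ N)]|)%N.
  rewrite -cardsT -(card_imset _ inj); apply: subset_leq_card.
  apply/fintype.subsetP => _ /imsetP[w _ ->]; rewrite finset.in_setX finset.inE finset.in_setT andbT /=.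
  have -> : C (vres (y w)) = (C (vres (y w)) - C (vadd (vadd x (vscale (p ^ k)%N (vres w))) (vscale (s w) (vscale (p ^ l.+1)%N v)))) + C (vadd (vadd x (vscale (p ^ k)%N (vres w))) (vscale (s w) (vscale (p ^ l.+1)%N v))) by ring.
  by rewrite rpredD //; apply: dvd_tri_congr => i; apply: vresK.
rewrite cardsX cardsT card_ord card_ffun !card_ord -/(nzeros _) => h.
have -> : (p ^ (N * n))%N = (p ^ ((N - k) * n) * p ^ (k * n))%N.
  by rewrite -expnD -mulnDl subnK.
by rewrite expnM leq_mul2r h orbT.
Qed.

End Count.

(** * Chevalley's theorem *)

Section Chevalley.
Variables (F : finFieldType) (m : nat).

Lemma natr_card_finField : #|F|%:R = 0 :> F.
Proof.
have : \sum_(x : F) (x + 1) = \sum_(x : F) x.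
  rewrite [RHS](reindex_onto (fun x => x + 1) (fun x => x - 1)) /=; last first.
    by move=> x _; rewrite subrK.
  by apply: eq_bigl => x; rewrite addrK eqxx.
rewrite big_split /= sumr_const => /eqP.
by rewrite -subr_eq0 addrAC subrr add0r => /eqP.
Qed.

(** Scaling by g permutes F and multiplies the sum by a power of g that is not 1; such a g exists
    because X^e - 1 has at most e roots. For e = 0 all summands are 1, also the one at x = 0, and
    the sum is |F| = 0. *)
Lemma sum_expr_finField e : (e < #|F|.-1)%N -> \sum_(x : F) x ^+ e = 0.
Proof.
case: e => [|e] he.
  under eq_bigr do rewrite expr0.
  by rewrite sumr_const natr_card_finField.
have [g g0 ge] : exists2 g : F, g != 0 & g ^+ e.+1 != 1.
  apply/exists_inP; apply: contraLR he => /exists_inPn h.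
  pose q : {poly F} := 'X^(e.+1) - 1.
  have : (size (enum (predC1 (0%R : F))) < size q)%N.
    apply: max_poly_roots; last exact: enum_uniq.
      by rewrite -size_poly_eq0 size_XnsubC.
    apply/allP => x; rewrite mem_enum inE => x0.
    by rewrite rootE !hornerE subr_eq0; have := h x x0; rewrite negbK.
  by rewrite -cardE cardC1 size_XnsubC // -leqNgt ltnS.
have : g ^+ e.+1 * \sum_x x ^+ e.+1 = \sum_(x : F) x ^+ e.+1.
  rewrite mulr_sumr [RHS](reindex_onto (fun x => g * x) (fun x => g^-1 * x)) /=; last first.
    by move=> x _; rewrite mulVKf.
  by apply: eq_big => [x|x _]; rewrite ?mulKf ?eqxx // exprMn.
move/eqP; rewrite -subr_eq0 -{2}[\sum_x _]mul1r -mulrBl mulf_eq0 subr_eq0 (negPf ge) /=.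
by move/eqP.
Qed.

Definition polyfun (d : nat) (f : {ffun 'I_m -> F} -> F) :=
  exists s : seq (F * {ffun 'I_m -> nat}),
    all (fun t : F * {ffun 'I_m -> nat} => \sum_i t.2 i <= d)%N s /\
    forall a, f a = \sum_(t <- s) t.1 * \prod_i a i ^+ t.2 i.

Lemma polyfun_const d k : polyfun d (fun=> k).
Proof.
exists [:: (k, [ffun=> 0%N])]; split=> [|a].
  by rewrite /= big1 // => i _; rewrite ffunE.
by rewrite big_seq1 /= big1 ?mulr1 // => i _; rewrite ffunE.
Qed.

Lemma polyfun_var i : polyfun 1 (fun a => a i).
Proof.
exists [:: (1, [ffun j => (j == i) : nat])]; split=> [|a].
  rewrite /= andbT (bigD1 i) //= ffunE eqxx big1 // => j /negPf.
  by rewrite ffunE => ->.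
rewrite big_seq1 /= mul1r (bigD1 i) //= ffunE eqxx big1 ?mulr1 //.
by move=> j /negPf; rewrite ffunE => ->.
Qed.

Lemma polyfunD d f g : polyfun d f -> polyfun d g -> polyfun d (fun a => f a + g a).
Proof.
move=> [s [hs Es]] [t [ht Et]]; exists (s ++ t); split=> [|a]; first by rewrite all_cat hs.
by rewrite big_cat /= Es Et.
Qed.

Lemma polyfunM d e f g : polyfun d f -> polyfun e g -> polyfun (d + e) (fun a => f a * g a).
Proof.
move=> [s [/allP hs Es]] [t [/allP ht Et]].
pose mulm (x y : F * {ffun 'I_m -> nat}) := (x.1 * y.1, [ffun i => (x.2 i + y.2 i)%N]).
exists [seq mulm x y | x <- s, y <- t]; split=> [|a].
  apply/allP => _ /allpairsP[[x y] [/= xs yt ->]] /=.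
  under eq_bigr do rewrite ffunE.
  by rewrite big_split leq_add ?hs ?ht.
rewrite Es Et mulr_suml big_allpairs_dep; apply: eq_bigr => x _.
rewrite mulr_sumr; apply: eq_bigr => y _ /=.
under [X in _ = _ * X]eq_bigr do rewrite ffunE exprD.
by rewrite big_split /=; ring.
Qed.

Lemma polyfunX d f k : polyfun d f -> polyfun (k * d) (fun a => f a ^+ k).
Proof.
move=> hf; elim: k => [|k IH].
  rewrite (_ : (fun _ => _) = fun=> 1) //; exact: polyfun_const.
by have := polyfunM hf IH; rewrite -mulSn; case=> s [h1 h2]; exists s; split=> // a; rewrite exprS.
Qed.

(** A monomial of total degree below m (|F| - 1) has some exponent below |F| - 1, and the sum over
    that coordinate vanishes. *)
Lemma sum_polyfun d f : (d < m * #|F|.-1)%N -> polyfun d f -> \sum_a f a = 0.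
Proof.
move=> dm [s [/allP hs Es]]; under eq_bigr do rewrite Es.
rewrite exchange_big /= big_seq big1 // => t ts; rewrite -mulr_sumr.
rewrite -(bigA_distr_bigA (fun i x => x ^+ t.2 i)) /=.
have [i hi] : exists i, (t.2 i < #|F|.-1)%N.
  apply/existsP; apply: contraLR (dm) => /existsPn h; rewrite -leqNgt.
  apply: leq_trans (hs _ ts); rewrite -{1}(card_ord m) -sum_nat_const.
  by apply: leq_sum => i _; rewrite leqNgt.
by rewrite (bigD1 i) //= sum_expr_finField // mul0r mulr0.
Qed.

(** If 0 were the only zero, f^(|F|-1) would be the indicator of the nonzero points, with sum |F|^m
    - 1 = -1 in F, whereas [sum_polyfun] gives 0. *)
Lemma chevalley d f : (d < m)%N -> polyfun d f -> f 0 = 0 ->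
  exists2 a, a != 0 & f a = 0.
Proof.
move=> dm hf f0; case: (boolP [exists (a : {ffun 'I_m -> F} | a != 0), f a == 0]) => [/exists_inP[a a0 /eqP]|/exists_inPn h].
  by exists a.
have F1 : (1 < #|F|)%N by rewrite finNzRing_gt1.
have : \sum_a f a ^+ #|F|.-1 = 0 by apply: sum_polyfun (polyfunX _ hf); nia.
rewrite (bigD1 (0 : {ffun 'I_m -> F})) //= f0 expr0n -subn1 (gtn_eqF (_ : 0 < _)%N) ?subn_gt0 ?F1 // add0r.
under eq_bigr => a a0.
  have -> : f a ^+ (#|F| - 1) = 1.
    have fa := h a a0; apply: (mulfI fa).
    by rewrite -exprS subn1 prednK ?(ltnW F1) // expf_card mulr1.
  over.
rewrite sumr_const => E.
have : (#|{ffun 'I_m -> F}|)%:R = 0 :> F.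
  rewrite card_ffun natrX natr_card_finField card_ord expr0n.
  by case: m dm => //.
rewrite (cardD1 (0 : {ffun 'I_m -> F})) inE add1n -natr1.
rewrite (@eq_card _ _ (fun a : {ffun 'I_m -> F} => a != 0)) ?E ?add0r.
  by move/eqP; rewrite oner_eq0.
by move=> x; rewrite !inE andbT.
Qed.

End Chevalley.

(** * Cubic forms without nonsingular p-adic zeros *)

Section Descent.
Variables (n : nat) (c : 'I_n -> 'I_n -> 'I_n -> int) (p : nat).
Hypothesis symc : forall i j k, c i j k = c j i k /\ c i j k = c i k j.
Hypothesis pp : prime p.
Hypothesis no_nonsing : forall x v l, ~ nonsing_zero c p x v l.
Local Notation C x := (tri c x x x).
Local Notation vec := ('I_n -> int).

Definition powdvd (i : nat) (x : vec) : bool := ((p ^ i)%N%:Z %| C x)%Z.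

(** The cross terms of C(x + y) are 3 tri x x y and 3 tri y y x, so this property makes T_i closed
    under addition. *)
Definition polar_dvd (i : nat) :=
  forall x y, powdvd i x -> powdvd i y -> ((p ^ i)%N%:Z %| 3 * tri c x x y)%Z.

Lemma eq_powdvd i x y : x =1 y -> powdvd i x -> powdvd i y.
Proof. by move=> e; rewrite /powdvd (eq_tri c e e e). Qed.

Lemma powdvdS i x : powdvd i.+1 x -> powdvd i x.
Proof. exact: dvd_exp_le. Qed.

Lemma powdvdZ i a x : powdvd i x -> powdvd i (vscale a x).
Proof. by move=> h; rewrite /powdvd !triE // !dvdz_mull. Qed.

Lemma powdvdZp i a x : (p%:Z %| a)%Z -> powdvd i x -> powdvd i.+1 (vscale a x).
Proof.
move=> pa h; rewrite /powdvd !triE // expnS PoszM.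
by apply: dvdz_mul => //; rewrite !dvdz_mull.
Qed.

Lemma expn_neq0 i : (p ^ i)%N%:Z != 0.
Proof. by rewrite eqz_nat -lt0n expn_gt0 prime_gt0. Qed.

Lemma powdvdD i x y : polar_dvd i -> powdvd i x -> powdvd i y -> powdvd i (vadd x y).
Proof.
move=> P hx hy; rewrite /powdvd tri_cubeD //.
by rewrite rpredD // rpredD // ?P // rpredD // ?P.
Qed.

Lemma exact_prime_quot i m : ((p ^ i)%N%:Z %| m)%Z -> ~~ ((p ^ i.+1)%N%:Z %| m)%Z ->
  exists2 u, m = u * (p ^ i)%N%:Z & ~~ (p%:Z %| u)%Z.
Proof. by apply: exact_quot; apply: prime_gt0. Qed.

(* Otherwise [x + p s y] is a nonsingular zero, for some [s] given by Hensel's lemma. *)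
Lemma polar_step i x y : polar_dvd i -> powdvd i.+1 x -> powdvd i y ->
  ((p ^ i.+1)%N%:Z %| 3 * tri c x x y)%Z.
Proof.
move=> P hx hy; apply/negPn/negP => nd.
have [u Eu pu] := exact_prime_quot (P x y (powdvdS hx) hy) nd.
move: (hx) => /dvdzP[a Ea].
have /dvdzP[b Eb] := P y x hy (powdvdS hx).
move: (hy) => /dvdzP[e Ee].
have Ep : (p ^ i.+1)%N%:Z = (p ^ i)%N%:Z * p%:Z by rewrite expnSr PoszM.
rewrite Ep in Ea.
(* C(x + p s y) is p^(i+1) times this cubic in s, so solving it modulo p^i reaches p^(2i+1), which
   is Hensel's condition at level i. *)
have [s hs] := hensel a b (p%:Z * e) pp pu i.
apply: (no_nonsing (x := vadd x (vscale (p%:Z * s) y)) (v := y) (l := i)).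
have E3 : 3 * tri c (vadd x (vscale (p%:Z * s) y)) (vadd x (vscale (p%:Z * s) y)) y =
  (u + p%:Z * (s * 2 * b + p%:Z * s ^+ 2 * 3 * e)) * (p ^ i)%N%:Z.
  rewrite tri_sqD // !triE //.
  transitivity (3 * tri c x x y + p%:Z * (s * 2) * (3 * tri c y y x) + p%:Z * s * (p%:Z * s) * 3 * C y).
    by rewrite (triC12 symc x y y) (triC23 symc y x y); ring.
  by rewrite Eu Eb Ee; ring.
split.
- have -> : C (vadd x (vscale (p%:Z * s) y)) = (p ^ i.+1)%N%:Z *
    (a + u * s + p%:Z * (b * s ^+ 2 + p%:Z * e * s ^+ 3)).
    rewrite tri_cubeD // !triE // Ea Ee Ep.
    transitivity (a * ((p ^ i)%N%:Z * p%:Z) + p%:Z * s * (3 * tri c x x y) +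
      p%:Z * s * (p%:Z * s) * (3 * tri c y y x) +
      (p%:Z * s) ^+ 3 * (e * (p ^ i)%N%:Z)); first by ring.
    by rewrite Eu Eb; ring.
  have -> : (p ^ (2 * i + 1))%N%:Z = (p ^ i.+1)%N%:Z * (p ^ i)%N%:Z.
    by rewrite -PoszM -expnD; congr (Posz (p ^ _)%N); lia.
  by rewrite dvdz_mul2l ?expn_neq0.
- by rewrite E3 dvdz_mull.
- rewrite E3 expnS PoszM dvdz_mul2r ?expn_neq0 //.
  move: (s * 2 * b + _) => t; apply: contra pu => h.
  have -> : u = u + p%:Z * t - p%:Z * t by ring.
  by rewrite rpredB // dvdz_mulr.
Qed.

Lemma polarP i : polar_dvd i.
Proof.
elim: i => [|i IH]; first by move=> x y _ _; rewrite expn0 dvd1z.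
by move=> x y hx hy; apply: polar_step => //; apply: powdvdS.
Qed.

Lemma polar3P i x y z : powdvd i x -> powdvd i y -> powdvd i z ->
  ((p ^ i)%N%:Z %| 6 * tri c x y z)%Z.
Proof.
move=> hx hy hz.
have -> : 6 * tri c x y z = 3 * tri c (vadd x y) (vadd x y) z - 3 * tri c x x z - 3 * tri c y y z.
  by rewrite tri_sqD //; ring.
by rewrite rpredB // ?rpredB // polarP // powdvdD //; apply: polarP.
Qed.

(** * The quotient of T_i by T_(i+1) as a vector space over F_p *)

Section Level.
Variable i : nat.

Definition dquot (m : int) : 'F_p := ((m %/ (p ^ i)%N%:Z)%Z)%:~R.

Lemma dquotD m m' : ((p ^ i)%N%:Z %| m)%Z -> dquot (m + m') = dquot m + dquot m'.
Proof. by move=> h; rewrite /dquot divzDl // rmorphD. Qed.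

Lemma dquotM a m : ((p ^ i)%N%:Z %| m)%Z -> dquot (a * m) = a%:~R * dquot m.
Proof.
by move=> /dvdzP[k ->]; rewrite /dquot mulrA !mulzK ?expn_neq0 // rmorphM.
Qed.

Lemma intr_Fp_eq0 (m : int) : ((m%:~R : 'F_p) == 0) = (p%:Z %| m)%Z.
Proof.
have pF := pchar_Fp pp.
case: m => m; last rewrite NegzE; rewrite ?rmorphN ?oppr_eq0 ?dvdzE ?abszN /=;
  by rewrite -(dvdn_pcharf pF).
Qed.

Lemma dquot_eq0 m : ((p ^ i)%N%:Z %| m)%Z -> dquot m = 0 -> ((p ^ i.+1)%N%:Z %| m)%Z.
Proof.
move=> /dvdzP[k ->]; rewrite /dquot mulzK ?expn_neq0 // => /eqP.
by rewrite intr_Fp_eq0 expnS PoszM dvdz_mul2r ?expn_neq0.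
Qed.

Lemma intr_Fp_val (a : 'F_p) : ((a : nat)%:Z)%:~R = a :> 'F_p.
Proof. exact: natr_Zp. Qed.

(** An induction invariant for w(a), a linear combination of elements of T_i. Adding a_j y to w(a)
    produces mixed terms in C, so the polar forms of w(a) against fixed vectors must be controlled
    along with C itself. *)
Definition cubic_vec (w : {ffun 'I_4 -> 'F_p} -> vec) :=
  [/\ forall a, powdvd i (w a),
      polyfun 3 (fun a => dquot (C (w a))),
      forall z, powdvd i z -> polyfun 2 (fun a => dquot (3 * tri c (w a) (w a) z))
    & forall z, powdvd i z -> polyfun 1 (fun a => dquot (3 * tri c z z (w a)))].

Lemma eq_polyfun (F : finFieldType) m d (f g : {ffun 'I_m -> F} -> F) :
  f =1 g -> polyfun d f -> polyfun d g.
Proof. by move=> e [s [h1 h2]]; exists s; split=> // a; rewrite -e. Qed.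

Lemma cubic_vec0 : cubic_vec (fun=> fun=> 0).
Proof.
have E0 x y : tri c (fun=> 0) x y = 0 by do 3!(apply: big1 => ? _); ring.
have E0' x y : tri c x y (fun=> 0) = 0 by do 3!(apply: big1 => ? _); ring.
split=> [a||z hz|z hz].
- by rewrite /powdvd /= E0 dvdz0.
- by apply: eq_polyfun (polyfun_const _ _ 0) => a; rewrite E0 /dquot div0z.
- by apply: eq_polyfun (polyfun_const _ _ 0) => a; rewrite E0 mulr0 /dquot div0z.
- by apply: eq_polyfun (polyfun_const _ _ 0) => a; rewrite E0' mulr0 /dquot div0z.
Qed.

Lemma cubic_vecD w j y : cubic_vec w -> powdvd i y ->
  cubic_vec (fun a => vadd (w a) (vscale (a j : nat)%:Z y)).
Proof.
move=> [h0 h1 h2 h3] hy.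
have PX := @polyfun_var 'F_p 4 j.
(* The mixed form is obtained by polarizing the fourth clause at z + z'. *)
have P2 z z' : powdvd i z -> powdvd i z' -> polyfun 1 (fun a => dquot (6 * tri c (w a) z z')).
  move=> hz hz'.
  have hzz := powdvdD (@polarP i) hz hz'.
  have := polyfunD (h3 _ hzz) (polyfunM (polyfun_const 4 0 (-1)) (polyfunD (h3 _ hz) (h3 _ hz'))).
  apply: eq_polyfun => a; cbv beta.
  have -> : 6 * tri c (w a) z z' = 3 * tri c (vadd z z') (vadd z z') (w a) +
     (-1) * (3 * tri c z z (w a) + 3 * tri c z' z' (w a)).
    by rewrite tri_sqD // (triC12 symc (w a)) (triC23 symc z (w a)); ring.
  have h12 : ((p ^ i)%N%:Z %| 3 * tri c z z (w a) + 3 * tri c z' z' (w a))%Z.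
    by rewrite rpredD ?polarP.
  by rewrite dquotD ?polarP // (dquotM (-1)) // [in RHS]dquotD ?polarP // rmorphN1.
have PXX := polyfunM PX PX; have PXXX := polyfunM PX PXX.
split=> [a||z hz|z hz].
- exact: powdvdD (@polarP i) (h0 a) (powdvdZ _ hy).
- have := polyfunD h1 (polyfunD (polyfunM PX (h2 _ hy)) (polyfunD
    (polyfunM PXX (h3 _ hy)) (polyfunM PXXX (polyfun_const _ 0 (dquot (C y)))))).
  apply: eq_polyfun => a; cbv beta; rewrite tri_cubeD // !triE //.
  set X := ((a j : nat)%:Z).
  have -> : C (w a) + 3 * (X * tri c (w a) (w a) y) + 3 * (X * (X * tri c y y (w a))) +
     X * (X * (X * C y)) = C (w a) + (X * (3 * tri c (w a) (w a) y) +
     ((X * X) * (3 * tri c y y (w a)) + (X * (X * X)) * C y)) by ring.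
  have E := intr_Fp_val (a j).
  have hwy : ((p ^ i)%N%:Z %| 3 * tri c (w a) (w a) y)%Z by rewrite polarP.
  have hyw : ((p ^ i)%N%:Z %| 3 * tri c y y (w a))%Z by rewrite polarP.
  have hB : ((p ^ i)%N%:Z %| C y)%Z by exact: hy.
  have ha : ((p ^ i)%N%:Z %| C (w a))%Z by exact: h0.
  move: (C y) (C (w a)) (3 * tri c (w a) (w a) y) (3 * tri c y y (w a)) hB ha hwy hyw => B A1 A2 A3 *.
  rewrite dquotD // dquotD; last by rewrite dvdz_mull.
  rewrite dquotD; last by rewrite dvdz_mull.
  by rewrite !dquotM // !intrM !E.
- have := polyfunD (h2 _ hz) (polyfunD (polyfunM PX (P2 _ _ hy hz))
    (polyfunM PXX (polyfun_const _ 0 (dquot (3 * tri c y y z))))).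
  apply: eq_polyfun => a; cbv beta; rewrite tri_sqD // !triE //.
  set X := ((a j : nat)%:Z).
  have -> : 3 * (tri c (w a) (w a) z + 2 * (X * tri c (w a) y z) + X * (X * tri c y y z)) =
    3 * tri c (w a) (w a) z + (X * (6 * tri c (w a) y z) + (X * X) * (3 * tri c y y z)) by ring.
  have E := intr_Fp_val (a j).
  have hw : ((p ^ i)%N%:Z %| 3 * tri c (w a) (w a) z)%Z by rewrite polarP.
  have h6 : ((p ^ i)%N%:Z %| 6 * tri c (w a) y z)%Z by rewrite polar3P.
  have h3' : ((p ^ i)%N%:Z %| 3 * tri c y y z)%Z by rewrite polarP.
  move: (3 * tri c (w a) (w a) z) (6 * tri c (w a) y z) (3 * tri c y y z) hw h6 h3' => A1 A2 A3 *.
  rewrite dquotD // dquotD; last by rewrite dvdz_mull.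
  by rewrite !dquotM // !intrM !E.
- have := polyfunD (h3 _ hz) (polyfunM PX (polyfun_const _ 0 (dquot (3 * tri c z z y)))).
  apply: eq_polyfun => a; cbv beta; rewrite !triE //.
  set X := ((a j : nat)%:Z).
  have -> : 3 * (tri c z z (w a) + X * tri c z z y) =
    3 * tri c z z (w a) + X * (3 * tri c z z y) by ring.
  have E := intr_Fp_val (a j).
  have hw : ((p ^ i)%N%:Z %| 3 * tri c z z (w a))%Z by rewrite polarP.
  have h3' : ((p ^ i)%N%:Z %| 3 * tri c z z y)%Z by rewrite polarP.
  move: (3 * tri c z z (w a)) (3 * tri c z z y) hw h3' => A1 A2 *.
  by rewrite dquotD // dquotM // !E.
Qed.

Definition lin3 (a1 a2 a3 : int) (y1 y2 y3 : vec) :=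
  vadd (vscale a1 y1) (vadd (vscale a2 y2) (vscale a3 y3)).

(** Chevalley's theorem for the function C(a1 y1 + ... + a4 y4) / p^i modulo p of a in F_p^4, which
    has degree 3 < 4. *)
Lemma chevalley_relation y1 y2 y3 y4 :
  powdvd i y1 -> powdvd i y2 -> powdvd i y3 -> powdvd i y4 ->
  exists a1 a2 a3 a4 : int,
    ~~ [&& (p%:Z %| a1), (p%:Z %| a2), (p%:Z %| a3) & (p%:Z %| a4)]%Z /\
    powdvd i.+1 (vadd (lin3 a1 a2 a3 y1 y2 y3) (vscale a4 y4)).
Proof.
move=> h1 h2 h3 h4.
pose j1 : 'I_4 := inord 0; pose j2 : 'I_4 := inord 1; pose j3 : 'I_4 := inord 2; pose j4 : 'I_4 := inord 3.
have [g0 g1 _ _] := cubic_vecD j4 (cubic_vecD j3 (cubic_vecD j2 (cubic_vecD j1 cubic_vec0 h1) h2) h3) h4.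
have [|a a0 fa] := chevalley (isT : (3 < 4)%N) g1.
  rewrite /dquot (_ : tri c _ _ _ = 0) ?div0z //.
  by do 3!(apply: big1 => ? _); rewrite /vadd /vscale !ffunE /=; ring.
exists (a j1 : nat)%:Z, (a j2 : nat)%:Z, (a j3 : nat)%:Z, (a j4 : nat)%:Z; split.
  rewrite -!intr_Fp_eq0 !intr_Fp_val; apply: contra a0 => /and4P[/eqP e1 /eqP e2 /eqP e3 /eqP e4].
  apply/eqP/ffunP => j; rewrite ffunE -[j]inord_val.
  by case: j => -[|[|[|[|//]]]].
have := dquot_eq0 (g0 a) fa.
by apply: eq_powdvd => k; rewrite /lin3 /vadd /vscale; ring.
Qed.

Definition spans (y1 y2 y3 : vec) x :=
  exists a1 a2 a3 : int, powdvd i.+1 (vadd x (lin3 a1 a2 a3 y1 y2 y3)).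

Lemma spans_of_relation a y z : powdvd i y -> ~~ (p%:Z %| a)%Z ->
  powdvd i.+1 (vadd z (vscale a y)) ->
  exists u : int, powdvd i.+1 (vadd y (vscale u z)).
Proof.
move=> hy pa h; have [u [k Ek]] := prime_invz pp pa.
exists u.
have := powdvdD (@polarP i.+1) (powdvdZ u h) (powdvdZp (dvdz_mulr (- k) (dvdzz p%:Z)) hy).
apply: eq_powdvd => j; rewrite /vadd /vscale.
transitivity (u * z j + (a * u) * y j - p%:Z * k * y j); first by ring.
by rewrite Ek; ring.
Qed.

Lemma powdvd_drop a y z : powdvd i y -> (p%:Z %| a)%Z ->
  powdvd i.+1 (vadd z (vscale a y)) -> powdvd i.+1 z.
Proof.
move=> hy pa h; have pa' : (p%:Z %| - a)%Z by rewrite rpredN.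
have := powdvdD (@polarP i.+1) h (powdvdZp pa' hy).
by apply: eq_powdvd => j; rewrite /vadd /vscale; ring.
Qed.

(** T_(i+1) contains p T_i, so the quotient is an F_p-space; its dimension is at most 3. Otherwise
    y1, ..., y4 can be chosen in turn, each outside the span of its predecessors, and in their
    relation the last coefficient prime to p expresses its vector through the earlier ones. *)
Lemma exists_spanning : exists y1 y2 y3,
  [/\ powdvd i y1, powdvd i y2, powdvd i y3 & forall x, powdvd i x -> spans y1 y2 y3 x].
Proof.
apply: contrapT => nex.
have H y1 y2 y3 : powdvd i y1 -> powdvd i y2 -> powdvd i y3 ->
    exists2 x, powdvd i x & ~ spans y1 y2 y3 x.
  move=> h1 h2 h3; apply: contrapT => hn; apply: nex; exists y1, y2, y3; split=> // x hx.
  by apply: contrapT => hs; apply: hn; exists x.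
pose o : vec := fun=> 0.
have ho : powdvd i o.
  by rewrite /powdvd (_ : tri c _ _ _ = 0) ?dvdz0 //; do 3!(apply: big1 => ? _); rewrite /o; ring.
have [y1 h1 s1] := H _ _ _ ho ho ho.
have [y2 h2 s2] := H _ _ _ h1 ho ho.
have [y3 h3 s3] := H _ _ _ h1 h2 ho.
have [y4 h4 s4] := H _ _ _ h1 h2 h3.
have [a1 [a2 [a3 [a4 [nd R]]]]] := chevalley_relation h1 h2 h3 h4.
have [p4|p4] := boolP (p%:Z %| a4)%Z; last first.
  have [u hu] := spans_of_relation h4 p4 R.
  apply: s4; exists (u * a1), (u * a2), (u * a3); apply: eq_powdvd hu => j.
  by rewrite /lin3 /vadd /vscale; ring.
have R3 : powdvd i.+1 (vadd (vadd (vscale a1 y1) (vscale a2 y2)) (vscale a3 y3)).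
  by apply: eq_powdvd (powdvd_drop h4 p4 R) => j; rewrite /lin3 /vadd /vscale; ring.
have [p3|p3] := boolP (p%:Z %| a3)%Z; last first.
  have [u hu] := spans_of_relation h3 p3 R3.
  apply: s3; exists (u * a1), (u * a2), 0; apply: eq_powdvd hu => j.
  by rewrite /lin3 /vadd /vscale; ring.
have R2 := powdvd_drop h3 p3 R3.
have [p2|p2] := boolP (p%:Z %| a2)%Z; last first.
  have [u hu] := spans_of_relation h2 p2 R2.
  apply: s2; exists (u * a1), 0, 0; apply: eq_powdvd hu => j.
  by rewrite /lin3 /vadd /vscale; ring.
have R1 : powdvd i.+1 (vadd o (vscale a1 y1)).
  by apply: eq_powdvd (powdvd_drop h2 p2 R2) => j; rewrite /o /vadd /vscale; ring.
have [p1|p1] := boolP (p%:Z %| a1)%Z; last first.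
  have [u hu] := spans_of_relation h1 p1 R1.
  apply: s1; exists 0, 0, 0; apply: eq_powdvd hu => j.
  by rewrite /lin3 /o /vadd /vscale; ring.
by rewrite p1 p2 p3 p4 in nd.
Qed.

Lemma reduce_coef (a : int) : exists2 b : 'I_p, True & (p%:Z %| a - (b : nat)%:Z)%Z.
Proof.
have p0 := prime_gt0 pp.
exists (Ordinal (ltn_pmod (absz (a %% p%:Z)%Z) p0)) => //=.
have h0 : (0 <= a %% p)%Z by rewrite modz_ge0 //; lia.
have h1 : (a %% p < p)%Z by apply: ltz_pmod; lia.
rewrite modn_small; last by lia.
by rewrite gez0_abs //; apply/dvdzP; exists (a %/ p)%Z; rewrite {1}(divz_eq a p); ring.
Qed.

Definition npowdvd N j := #|[set y : {ffun 'I_n -> 'I_(p ^ N)} | powdvd j (vres y)]|.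

Lemma dvd_powdvd N j x y : (j <= N)%N -> (forall k, ((p ^ N)%N%:Z %| x k - y k)%Z) ->
  powdvd j x -> powdvd j y.
Proof.
move=> jN h hx; rewrite /powdvd -[C y](subrK (C x)) rpredD //.
apply: (dvd_exp_le jN); apply: dvd_tri_congr => // k.
by rewrite -opprB rpredN.
Qed.

(** A residue y in T_i is recovered from its translate in T_(i+1) and the three coefficients of the
    translation, each reduced to [0, p). *)
Lemma npowdvd_step N : (i < N)%N -> (npowdvd N i <= p ^ 3 * npowdvd N i.+1)%N.
Proof.
move=> iN; have [y1 [y2 [y3 [h1 h2 h3 hs]]]] := exists_spanning.
have p0 : (0 < p ^ N)%N by rewrite expn_gt0 prime_gt0.
pose w (t : 'I_p * 'I_p * 'I_p) := lin3 (t.1.1 : nat)%:Z (t.1.2 : nat)%:Z (t.2 : nat)%:Z y1 y2 y3.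
have key (y : {ffun 'I_n -> 'I_(p ^ N)}) : exists t : 'I_p * 'I_p * 'I_p,
    powdvd i (vres y) -> powdvd i.+1 (vadd (vres y) (w t)).
  have [hy|_] := boolP (powdvd i (vres y)); last first.
    have p1 := prime_gt0 pp; by exists (Ordinal p1, Ordinal p1, Ordinal p1).
  have [a1 [a2 [a3 ha]]] := hs _ hy.
  have [b1 _ /dvdzP[k1 e1]] := reduce_coef a1; have [b2 _ /dvdzP[k2 e2]] := reduce_coef a2.
  have [b3 _ /dvdzP[k3 e3]] := reduce_coef a3.
  exists (b1, b2, b3) => _.
  have q k : (p%:Z %| - k * p%:Z)%Z by rewrite dvdz_mull.
  have P := @polarP i.+1.
  have := powdvdD P ha (powdvdD P (powdvdZp (q k1) h1) (powdvdD P (powdvdZp (q k2) h2) (powdvdZp (q k3) h3))).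
  apply: eq_powdvd => j; rewrite /w /lin3 /vadd /vscale /=.
  rewrite (_ : a1 = k1 * p%:Z + (b1 : nat)%:Z); last by rewrite -e1; ring.
  rewrite (_ : a2 = k2 * p%:Z + (b2 : nat)%:Z); last by rewrite -e2; ring.
  rewrite (_ : a3 = k3 * p%:Z + (b3 : nat)%:Z); last by rewrite -e3; ring.
  by ring.
have [t ht] := fin_all_exists key.
pose f y := (t y, vmod p0 (vadd (vres y) (w (t y)))).
have inj : injective f.
  move=> y y' [Et Ey]; apply/ffunP => k.
  have e1 := vresK p0 (vadd (vres y) (w (t y))) k.
  have e2 := vresK p0 (vadd (vres y') (w (t y'))) k.
  rewrite Ey Et in e1; apply: val_inj => /=; apply: (dvdz_sub_small (ltn_ord (y k)) (ltn_ord (y' k))).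
  have := rpredB e2 e1; rewrite /vadd {2 4}/vres.
  by congr (_ %| _)%Z; rewrite /vres; ring.
have : (npowdvd N i <= #|finset.setX [set: 'I_p * 'I_p * 'I_p] [set y : {ffun 'I_n -> 'I_(p ^ N)} | powdvd i.+1 (vres y)]|)%N.
  rewrite /npowdvd -(card_imset _ inj); apply: subset_leq_card.
  apply/fintype.subsetP => _ /imsetP[y + ->]; rewrite !inE /= => hy.
  apply: (dvd_powdvd (N := N)) (ht y hy) => // k.
  by rewrite -opprB rpredN; apply: vresK.
by rewrite cardsX cardsT !card_prod !card_ord -/(npowdvd N i.+1) !expnS expn0 muln1 mulnA.
Qed.

End Level.

Lemma npowdvd_lower N j : (j <= N)%N -> (p ^ (N * n) <= p ^ (3 * j) * npowdvd N j)%N.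
Proof.
elim: j => [|j IH] jN.
  rewrite muln0 expn0 mul1n /npowdvd (_ : [set _ | _] = finset.setT) ?cardsT ?card_ffun ?card_ord ?expnM //.
  by apply/setP => y; rewrite !inE /powdvd expn0 dvd1z.
apply: leq_trans (IH (ltnW jN)) _.
by rewrite mulnS [(3 + _)%N]addnC expnD -mulnA leq_mul2l npowdvd_step ?orbT.
Qed.

(** For x in T_(3K) and arbitrary y, z, the vectors p^K y and p^K z lie in T_(3K) too, so
    polarization gives p^K | 6 tri x y z, and nondegeneracy gives p^(K-c0) | x. Hence T_(3K) has at
    most p^((2K+c0)n) residues modulo p^(3K), while the index bound leaves at least p^(3Kn-9K). *)
Lemma descent_absurd c0 : (9 < n)%N ->
  (forall K x, (forall y z, ((p ^ K)%N%:Z %| 6 * tri c x y z)%Z) ->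
     forall k, ((p ^ (K - c0))%N%:Z %| x k)%Z) -> False.
Proof.
(* The two counts give K (n - 9) <= c0 n, which fails for this K when n > 9. *)
move=> n9 nondeg; set K := (c0 * n + 1)%N.
have c0K : (c0 <= K)%N by rewrite /K; nia.
have P0 := prime_gt0 pp; have P1 := prime_gt1 pp.
have sub x : powdvd (3 * K) x -> forall k, ((p ^ (K - c0))%N%:Z %| x k)%Z.
  move=> hx; apply: nondeg => y z.
  have hv (v : vec) : powdvd (3 * K) (vscale (p ^ K)%N v).
    rewrite /powdvd !triE // mulnC expnM 2!expnS expn1 !PoszM.
    by do 2!apply: dvdz_mul => //; apply: dvdz_mulr.
  have := polar3P hx (hv y) (hv z); rewrite !triE //.
  have -> : (p ^ (3 * K))%N%:Z = (p ^ K)%N%:Z ^+ 2 * (p ^ K)%N%:Z.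
    by rewrite mulnC expnM 2!expnS expn1 !PoszM; ring.
  have -> : 6 * ((p ^ K)%N%:Z * ((p ^ K)%N%:Z * tri c x y z)) = (p ^ K)%N%:Z ^+ 2 * (6 * tri c x y z) by ring.
  by rewrite dvdz_mul2l // expf_neq0 // expn_neq0.
have up : (npowdvd (3 * K) (3 * K) <= p ^ ((2 * K + c0) * n))%N.
  set N := (3 * K)%N; rewrite [leqRHS]expnM -[X in (_ <= (_ ^ X) ^ _)%N]/(2 * K + c0)%N.
  have -> : ((p ^ (2 * K + c0)) ^ n)%N = #|{ffun 'I_n -> 'I_(p ^ (2 * K + c0))}|.
    by rewrite card_ffun !card_ord.
  have q0 : (0 < p ^ (2 * K + c0))%N by rewrite expn_gt0 P0.
  pose f (y : {ffun 'I_n -> 'I_(p ^ N)}) : {ffun 'I_n -> 'I_(p ^ (2 * K + c0))} :=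
    [ffun k => Ordinal (ltn_pmod ((y k : nat) %/ p ^ (K - c0)) q0)].
  rewrite /npowdvd -[leqRHS]cardsT -(card_in_imset (f := f)).
    by apply: subset_leq_card; apply/fintype.subsetP => y _; rewrite inE.
  move=> y y'; rewrite !inE => hy hy' /ffunP E; apply/ffunP => k.
  have dv z : powdvd N (vres z) -> (p ^ (K - c0) %| (z k : 'I_(p ^ N)))%N.
    by move=> hz; have := sub _ hz k; rewrite dvdzE.
  have sm (z : {ffun 'I_n -> 'I_(p ^ N)}) : ((z k : nat) %/ p ^ (K - c0) < p ^ (2 * K + c0))%N.
    rewrite ltn_divLR ?expn_gt0 ?P0 // -expnD; apply: leq_trans (ltn_ord _) _.
    by rewrite leq_exp2l // /N; lia.
  have := congr1 val (E k); rewrite !ffunE /= !modn_small // => e.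
  by apply: val_inj; rewrite /= -(divnK (dv _ hy)) -(divnK (dv _ hy')) e.
have lo := npowdvd_lower (leqnn (3 * K)%N).
have := leq_trans lo (leq_mul (leqnn _) up).
by rewrite -expnD leq_exp2l // /K; nia.
Qed.

End Descent.

(** * Nondegeneracy over the rationals and its p-adic form *)

Lemma clear_denom (I : finType) (f : I -> rat) : exists (d : int) (g : I -> int),
  d != 0 /\ forall i, d%:~R * f i = (g i)%:~R.
Proof.
exists (\prod_i denq (f i)), (fun i => numq (f i) * \prod_(j | j != i) denq (f j)).
split; first by apply/prodf_neq0 => i _; apply: denq_neq0.
move=> i; rewrite (bigD1 i) //= -{2}[f i]divq_num_den !rmorphM /=.
have : (denq (f i))%:~R != 0 :> rat by rewrite intr_eq0 denq_neq0.
by move: (\prod_(j | _) _)%:~R => P h; field.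
Qed.

Section Nondegenerate.
Variables (n : nat) (c : 'I_n -> 'I_n -> 'I_n -> int).

(** The flattened coefficient tensor: a row vector x is sent to the list of entries of M(x), so free
    rows mean that M(x) = 0 only for x = 0. *)
Definition coeff_mx : 'M[rat]_(n, n * n) :=
  \matrix_(i < n) mxvec (\matrix_(j, k) (c i j k)%:~R).

Lemma coeff_mxE i j k : coeff_mx i (mxvec_index j k) = (c i j k)%:~R.
Proof. by rewrite mxE mxvecE mxE. Qed.

Hypothesis nondeg : forall x : 'I_n -> int,
  (forall j k, \sum_i c i j k * x i = 0) -> forall i, x i = 0.

Lemma coeff_mx_free : row_free coeff_mx.
Proof.
rewrite -kermx_eq0; apply/eqP/row_matrixP => i0; rewrite row0.
set v := row _ _.
have vT : v *m coeff_mx = 0 by apply/sub_kermxP; apply: row_sub.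
have [d [g [d0 hg]]] := clear_denom (fun i => v 0 i).
have g0 : forall i, g i = 0.
  apply: nondeg => j k; apply: (@intr_inj rat); rewrite rmorph_sum /=.
  have /matrixP/(_ 0 (mxvec_index j k)) := vT; rewrite !mxE => E.
  rewrite -[RHS](mulr0 (d%:~R)) -[X in _ = _ * X]E mulr_sumr; apply: eq_bigr => i _.
  by rewrite rmorphM /= -hg -coeff_mxE; ring.
apply/rowP => i; rewrite [RHS]mxE; have := hg i; rewrite g0 => /eqP.
by rewrite mulf_eq0 intr_eq0 (negPf d0) => /eqP.
Qed.

(** A right inverse of [coeff_mx] with common denominator d writes 6 d x_k as an integral
    combination of the entries of 6 M(x), which are the values 6 tri x y z at unit vectors y, z. So
    c0 is the valuation of 6 d, the same for every K. *)
Lemma dvd_of_polar (p : nat) : prime p ->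
  exists c0 : nat, forall K x, (forall y z, ((p ^ K)%N%:Z %| 6 * tri c x y z)%Z) ->
     forall k, ((p ^ (K - c0))%N%:Z %| x k)%Z.
Proof.
move=> pp; have /row_freeP[B TB] := coeff_mx_free.
have [d [g [d0 hg]]] := clear_denom (fun t : 'I_(n * n) * 'I_n => B t.1 t.2).
exists (logn p (absz (6 * d))) => K x h k.
have hjk j k' : ((p ^ K)%N%:Z %| 6 * \sum_i c i j k' * x i)%Z.
  have := h (fun i => (i == j)%:R) (fun i => (i == k')%:R).
  congr (_ %| 6 * _)%Z; apply: eq_bigr => i _.
  rewrite (bigD1 j) //= (bigD1 k') //= !eqxx !big1 ?addr0 ?mulr1 // => [j' /negPf ->|k'' /negPf ->].
    by rewrite big1 // => ? _; rewrite mulr0 mul0r.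
  by rewrite mulr0.
have E : 6 * d * x k = \sum_(t : 'I_n * 'I_n)
     (6 * \sum_i c i t.1 t.2 * x i) * g (mxvec_index t.1 t.2, k).
  apply: (@intr_inj rat); rewrite rmorphM rmorphM rmorph_sum /=.
  transitivity (6 * \sum_i (x i)%:~R * (d%:~R * (coeff_mx *m B) i k)).
    have -> : \sum_i (x i)%:~R * (d%:~R * (coeff_mx *m B) i k) = (x k)%:~R * d%:~R :> rat.
      rewrite TB (bigD1 k isT) big1 => [|i /negPf ik].
        by rewrite /= addr0 mxE eqxx mulr1.
      by rewrite mxE ik !mulr0.
    by rewrite [6%:~R]mulrz_nat -mulrA [d%:~R * _]mulrC.
  rewrite mulr_sumr.
  transitivity (\sum_i \sum_(t : 'I_n * 'I_n) 6 * (x i)%:~R * ((c i t.1 t.2)%:~R * (g (mxvec_index t.1 t.2, k))%:~R) : rat).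
    apply: eq_bigr => i _; rewrite !mxE.
    rewrite (reindex (uncurry (@mxvec_index n n))) /=; last exact: (curry_mxvec_bij).
    rewrite !mulr_sumr; apply: eq_bigr => -[j k'] _ /=.
    by rewrite coeff_mxE -hg /=; ring.
  rewrite exchange_big; apply: eq_bigr => t _ /=.
  rewrite !rmorphM /= rmorph_sum /= [6%:~R]mulrz_nat mulr_sumr mulr_suml; apply: eq_bigr => i _.
  by rewrite rmorphM; ring.
have : ((p ^ K)%N%:Z %| 6 * d * x k)%Z.
  by rewrite E rpred_sum // => t _; rewrite dvdz_mulr.
rewrite !dvdzE abszM /=.
have [->|xk0] := eqVneq (absz (x k)) 0%N; first by rewrite dvdn0.
have d6 : (0 < absz (6 * d)%R)%N by rewrite absz_gt0 mulf_neq0.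
have xk1 : (0 < absz (x k))%N by rewrite lt0n.
by rewrite !pfactor_dvdn ?muln_gt0 ?d6 // lognM //; lia.
Qed.

End Nondegenerate.

Theorem nzeros_pos_density (n : nat) (c : 'I_n -> 'I_n -> 'I_n -> int) (p : nat) :
  (forall i j k, c i j k = c j i k /\ c i j k = c i k j) ->
  (forall x : 'I_n -> int,
     (forall j k, \sum_i c i j k * x i = 0) -> forall i, x i = 0) ->
  (9 < n)%N -> prime p ->
  exists2 K : nat, (0 < K)%N & forall N, (p ^ (N * n) <= nzeros c (p ^ N) * p ^ N * K)%N.
Proof.
move=> symc nondeg n9 pp.
have [[x [v [l ns]]]|no] := EM (exists x v l, nonsing_zero c p x v l).
  exists (p ^ ((2 * l + 1) * n))%N; first by rewrite expn_gt0 prime_gt0.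
  by move=> N; apply: nzeros_lower ns _.
exfalso; have [c0 hc0] := dvd_of_polar nondeg pp.
apply: (descent_absurd symc pp _ n9 hc0) => x v l ns.
by apply: no; exists x, v, l.
Qed.

(** * Kernels of integer matrices modulo q *)

Lemma ler_norm_det (F : numDomainType) n (A : 'M[F]_n) (B : F) :
  (forall i j, `|A i j| <= B) -> `|\det A| <= (n`!)%:R * B ^+ n.
Proof.
move=> AB; apply: le_trans (ler_norm_sum _ _ _) _.
rewrite mulr_natl -(card_Sn n) -sumr_const; apply: ler_sum => s _.
rewrite normrM normrX normrN1 expr1n mul1r normr_prod.
rewrite -[X in B ^+ X]card_ord -prodr_const; apply: ler_prod => i _.
by rewrite normr_ge0 AB.
Qed.

Lemma exists_rank_minor (F : fieldType) n (A : 'M[F]_n) :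
  exists f g : 'I_(\rank A) -> 'I_n, \det (mxsub f g A) != 0.
Proof.
pose f := maxrankfun A.
have free : row_free (rowsub f A) by apply: maxrowsub_free.
have full : row_full (rowsub f A)^T.
  by rewrite /row_full mxrank_tr; exact: free.
exists f, (fullrankfun full).
have := fullrowsub_unit full; rewrite unitmxE unitfE.
rewrite -det_tr; congr (\det _ != 0).
by apply/matrixP => i j; rewrite !mxE.
Qed.

Section Smith.
Variables (n : nat) (A : 'M[int]_n).
Local Notation toQ := (map_mx (intr : int -> rat)).

Lemma smith_diag : exists (L U : 'M[int]_n) (d : 'I_n -> int),
  [/\ L \in unitmx, U \in unitmx & A = L *m diag_mx (\row_i d i) *m U].
Proof.
have [L uL [U uU [d _ ->]]] := int_Smith_normal_form A.
exists L, U, (fun i => d`_i); split=> //; congr (_ *m _ *m _).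
by apply/matrixP => i j; rewrite !mxE -val_eqE.
Qed.

Variables (L U : 'M[int]_n) (d : 'I_n -> int).
Hypotheses (uL : L \in unitmx) (uU : U \in unitmx).
Hypothesis AE : A = L *m diag_mx (\row_i d i) *m U.

Local Notation I := [set i | d i != 0].

(** E selects the coordinates with a nonzero diagonal entry; A = L E^T D1 E U then factors through
    its rank. *)
Let E : 'M[int]_(#|I|, n) := \matrix_(a, i) (i == enum_val a)%:R.
Let D1 : 'M[int]_#|I| := diag_mx (\row_a d (enum_val a)).

Lemma diagE : diag_mx (\row_i d i) = E^T *m D1 *m E.
Proof.
apply/matrixP => i j; rewrite !mxE.
transitivity (\sum_(k in I) ((i == k)%:R * d k * (j == k)%:R) : int).
  have [iI|iI] := boolP (i \in I).
    rewrite (bigD1 i) //= eqxx mul1r big1 ?addr0.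
      by rewrite eq_sym; case: eqP; rewrite ?mulr1 ?mulr0.
    by move=> k /andP[_ /negPf ki]; rewrite eq_sym ki !mul0r.
  rewrite big1.
    by move: iI; rewrite inE negbK => /eqP ->; rewrite mul0rn.
  move=> k kI; rewrite (_ : (i == k) = false) ?mul0r //.
  by apply/eqP => ik; rewrite ik kI in iI.
rewrite big_enum_val; apply: eq_bigr => a _.
by rewrite mul_mx_diag !mxE.
Qed.

Lemma smith_rank : \rank (toQ A) = #|I|.
Proof.
have EEt : E *m E^T = 1%:M.
  apply/matrixP => a b; rewrite !mxE (bigD1 (enum_val a)) //= !mxE eqxx mul1r big1.
    by rewrite addr0 (inj_eq enum_val_inj).
  by move=> i /negPf h; rewrite !mxE h mul0r.
have freeE : row_free (toQ E).
  by apply/row_freeP; exists (toQ E^T); rewrite -map_mxM EEt map_mx1.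
have unitQ (M : 'M[int]_n) : M \in unitmx -> toQ M \in unitmx.
  rewrite !unitmxE det_map_mx => /unitrP[y [_ hy]]; apply/unitrP; exists y%:~R.
  by rewrite -!rmorphM /= mulrC hy.
have freeEU : row_free (toQ E *m toQ U).
  by rewrite -[row_free _]/(_ == _) mxrankMfree // row_free_unit unitQ.
rewrite AE diagE !map_mxM !mulmxA.
rewrite -[_ *m toQ U]mulmxA mxrankMfree // -mxrank_tr !trmx_mul -!map_trmx trmxK.
rewrite mxrankMfree; last first.
  by rewrite -[row_free _]/(_ == _) mxrankMfree // row_free_unit unitmx_tr unitQ.
rewrite mxrank_tr mxrank_unit // unitmxE det_map_mx det_diag unitfE intr_eq0.
apply/prodf_neq0 => a _; rewrite mxE.
by have := enum_valP a; rewrite inE.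
Qed.

(** Through the factorization by [D1], the product of the nonzero d_i divides every minor of order
    r; some such minor is nonzero, and its expansion bounds it. *)
Lemma smith_prod_le (B : int) : (forall i j, `|A i j| <= B) ->
  `|\prod_(i in I) d i| <= (\rank (toQ A))`!%:R * B ^+ \rank (toQ A).
Proof.
move=> AB; have [f [g]] := exists_rank_minor (toQ A).
move: (f) (g); rewrite smith_rank => {}f {}g.
have -> : mxsub f g (toQ A) = toQ (mxsub f g A) by apply/matrixP => i j; rewrite !mxE.
rewrite det_map_mx intr_eq0.
have le : `|\det (mxsub f g A)| <= (#|I|)`!%:R * B ^+ #|I|.
  by apply: ler_norm_det => i j; rewrite mxE AB.
have Esub : mxsub f g A = rowsub f (L *m E^T) *m D1 *m colsub g (E *m U).
  apply/matrixP => i j; rewrite AE diagE !mulmxA -mulmxA !mxE.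
  apply: eq_bigr => k _; congr (_ * _); last by rewrite !mxE.
  by rewrite !mxE; apply: eq_bigr => l _; rewrite !mxE.
rewrite Esub !det_mulmx det_diag in le *.
set l := \det (rowsub _ _) in le *; set u := \det (colsub _ _) in le * => nz.
apply: le_trans le; rewrite big_enum_val.
under [X in `|_ * X * _|]eq_bigr do rewrite mxE.
move: nz; under eq_bigr do rewrite mxE.
rewrite !normrM !mulf_eq0 !negb_or => /andP[/andP[l0 p0] u0].
set P := `|\prod_(_ < _) _|.
have l1 : 1 <= `|l| by rewrite -gtz0_ge1 normr_gt0.
have u1 : 1 <= `|u| by rewrite -gtz0_ge1 normr_gt0.
by rewrite -[leLHS]mul1r -[leLHS]mulr1; do !apply: ler_pM => //; rewrite mul1r /P normr_ge0.
Qed.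

Definition nker (q : nat) (s : int) :=
  #|[set y : {ffun 'I_n -> 'I_q} | [forall j, (q%:Z %| s * \sum_k A j k * (y k : nat)%:Z)%Z]]|.

Definition ann (q : nat) (e : int) : {set 'I_q} :=
  [set z : 'I_q | (q%:Z %| e * (z : nat)%:Z)%Z].

Lemma card_ann (q : nat) (e : int) : (0 < q)%N ->
  (#|ann q e| <= gcdn q (absz e))%N.
Proof.
move=> q0; set g := gcdn q (absz e).
have g0 : (0 < g)%N by rewrite gcdn_gt0 q0.
have qg0 : (0 < q %/ g)%N by rewrite divn_gt0 // dvdn_leq // dvdn_gcdl.
pose f (z : 'I_q) : 'I_g := Ordinal (ltn_pmod ((z : nat) %/ (q %/ g)) g0).
rewrite -[leqRHS]card_ord -(card_in_imset (f := f)); first exact: max_card.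
have dv (z : 'I_q) : (q%:Z %| e * (z : nat)%:Z)%Z -> (q %/ g %| z)%N.
  rewrite dvdzE abszM /= -{1}(divnK (dvdn_gcdl q (absz e))) -/g.
  rewrite -{1}(divnK (dvdn_gcdr q (absz e))) -/g mulnAC dvdn_pmul2r //.
  rewrite Gauss_dvdr // /coprime -(eqn_pmul2r g0) mul1n muln_gcdl.
  by rewrite !divnK ?dvdn_gcdl ?dvdn_gcdr.
have sm (z : 'I_q) : ((z : nat) %/ (q %/ g) < g)%N.
  by rewrite ltn_divLR // mulnC divnK ?dvdn_gcdl.
move=> z z'; rewrite !inE => hz hz' /(congr1 val) /=.
rewrite !modn_small ?sm // => E1; apply: val_inj => /=.
by rewrite -(divnK (dv _ hz)) -(divnK (dv _ hz')) E1.
Qed.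

(** U permutes the residue vectors modulo q and L is invertible, so the system decouples into the
    conditions q | s d_i z_i. *)
Lemma nker_le (q : nat) (s : int) : (0 < q)%N ->
  (nker q s <= \prod_i gcdn q (absz (s * d i)%R))%N.
Proof.
move=> q0.
pose u (y : {ffun 'I_n -> 'I_q}) i : int := \sum_k U i k * (y k : nat)%:Z.
pose red (m : int) : 'I_q := Ordinal (ltn_pmod (absz (m %% q%:Z)%Z) q0).
have redP m : (q%:Z %| m - (red m : nat)%:Z)%Z.
  have h0 : (0 <= m %% q)%Z by rewrite modz_ge0 //; lia.
  have h1 : (m %% q < q)%Z by apply: ltz_pmod; lia.
  rewrite /= modn_small; last by lia.
  by rewrite gez0_abs //; apply/dvdzP; exists (m %/ q)%Z; rewrite {1}(divz_eq m q); ring.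
pose f (y : {ffun 'I_n -> 'I_q}) : {ffun 'I_n -> 'I_q} := [ffun i => red (u y i)].
have dvmul (M : 'M[int]_n) (v : 'cV[int]_n) (m : int) :
    (forall i, (m %| v i ord0)%Z) -> forall i, (m %| (M *m v) i ord0)%Z.
  by move=> h i; rewrite mxE rpred_sum // => k _; rewrite dvdz_mull.
pose cv (y : {ffun 'I_n -> 'I_q}) : 'cV[int]_n := \col_k (y k : nat)%:Z.
have uE y i : u y i = (U *m cv y) i ord0 by rewrite mxE; apply: eq_bigr => k _; rewrite mxE.
have inj : injective f.
  move=> y y' /ffunP e; apply/ffunP => k; apply: val_inj.
  have h : forall i, (q%:Z %| (U *m (cv y - cv y')) i ord0)%Z.
    move=> i; rewrite mulmxBr mxE [X in _ + X]mxE -!uE.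
    have := e i; rewrite !ffunE => e'.
    have := rpredB (redP (u y i)) (redP (u y' i)); rewrite e'.
    by congr (_ %| _)%Z; ring.
  have := dvmul (invmx U) _ _ h k; rewrite mulmxA mulVmx // mul1mx !mxE => hk.
  have := ltn_ord (y k); have := ltn_ord (y' k); move: hk.
  rewrite -eqz_mod_dvd => /eqP; rewrite !modz_nat => -[h1] a b.
  by rewrite !modn_small // in h1.
have sub : (nker q s <= #|family (fun i => ann q (s * d i)%R)|)%N.
  rewrite /nker -(card_imset _ inj); apply: subset_leq_card.
  apply/fintype.subsetP => _ /imsetP[y hy ->]; apply/familyP => i; rewrite ffunE inE.
  have h : forall j, (q%:Z %| (s *: (A *m cv y)) j ord0)%Z.
    move=> j; move: hy; rewrite inE => /forallP/(_ j).
    rewrite !mxE; congr (_ %| _ * _)%Z; apply: eq_bigr => k _; by rewrite !mxE.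
  have := dvmul (invmx L) _ _ h i; rewrite -scalemxAr AE -!mulmxA mulKmx //.
  rewrite mxE mul_diag_mx !mxE => h'.
  have -> : s * d i * (red (u y i) : nat)%:Z =
     s * (d i * \sum_j U i j * cv y j ord0) - s * d i * (u y i - (red (u y i) : nat)%:Z).
    by rewrite {2}uE mxE; ring.
  by rewrite rpredB // dvdz_mull.
apply: leq_trans sub _; rewrite card_family foldrE big_map big_enum /=.
by apply: leq_prod => i _; apply: card_ann.
Qed.

End Smith.

(** * Primes where a matrix pencil drops rank *)

Section Radical.
Implicit Types f g q G E : {poly rat}.

Lemma sizeM_rat f g : f != 0 -> g != 0 -> size (f * g) = (size f + size g).-1.
Proof. exact: size_mul. Qed.

Lemma exists_irreducible_factor f : (1 < size f)%N ->
  exists2 q, irreducible_poly q & q %| f.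
Proof.
have [m] := ubnP (size f); elim: m f => // m IH f fm f1.
have [irr|nirr] := EM (irreducible_poly f); first by exists f.
have f0 : f != 0 by rewrite -size_poly_eq0; lia.
have [r [r1 rf nrf]] : exists r : {poly rat}, [/\ size r != 1%N, r %| f & ~~ (r %= f)].
  apply: contrapT => no; apply: nirr; split=> // r r1 rf.
  by apply/negPn/negP => nrf; apply: no; exists r.
have r0 : r != 0 by apply: contraNneq f0 => r0; rewrite r0 dvd0p in rf.
have rs : (size r < size f)%N.
  by rewrite ltn_neqAle dvdp_leq // andbT; apply: contra nrf; rewrite dvdp_size_eqp.
have [||q iq qr] := IH r.
- by lia.
- by have := size_poly_eq0 r; rewrite (negPf r0); lia.
by exists q => //; apply: dvdp_trans qr rf.
Qed.

Lemma deriv_rat_neq0 q : (1 < size q)%N -> q^`() != 0.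
Proof.
move=> q1; apply/eqP => /polyP/(_ (size q).-2); rewrite coef_deriv coef0.
have -> : (size q).-2.+1 = (size q).-1 by lia.
move/eqP; rewrite mulrn_eq0 -lead_coefE lead_coef_eq0 -size_poly_eq0.
by case: (size q) q1 => [|[]].
Qed.

Lemma irreducible_separable q : irreducible_poly q -> separable_poly q.
Proof.
case=> q1 irr; rewrite separable_poly.unlock /coprimep.
have q0 : q != 0 by rewrite -size_poly_gt0; apply: ltn_trans q1.
apply/negPn/negP => h; have := irr _ h (dvdp_gcdl _ _) => /andP[_ qd].
have := dvdp_trans qd (dvdp_gcdr _ _) => /(dvdp_leq (deriv_rat_neq0 q1)).
by rewrite leqNgt lt_size_deriv.
Qed.

Lemma irreducible_coprime q f : irreducible_poly q -> ~~ (q %| f) -> coprimep q f.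
Proof.
case=> q1 irr nd; rewrite /coprimep; apply/negPn/negP => h.
have := irr _ h (dvdp_gcdl _ _) => /andP[_ qd].
by rewrite (dvdp_trans qd (dvdp_gcdr _ _)) in nd.
Qed.

Lemma irreducible_valuation q f : irreducible_poly q -> f != 0 ->
  exists e f1, f = q ^+ e * f1 /\ ~~ (q %| f1).
Proof.
move=> iq; have q1 : (1 < size q)%N by case: iq.
have [m] := ubnP (size f); elim: m f => // m IH f fm f0.
have [/dvdpP[g Eg]|nd] := boolP (q %| f); last by exists 0%N, f; rewrite mul1r.
have g0 : g != 0 by apply: contraNneq f0 => g0; rewrite Eg g0 mul0r.
have q0 : q != 0 by rewrite -size_poly_gt0; apply: ltn_trans q1.
have [|e [f1 [E nd]]] := IH g _ g0.
  have sg : (0 < size g)%N by rewrite size_poly_gt0.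
  by move: fm; rewrite Eg sizeM_rat //; lia.
by exists e.+1, f1; split=> //; rewrite Eg {1}E exprS; ring.
Qed.

(* [G] is the radical of [f], and [E] is the product of the irreducible factors of multiplicity
   at least 4. *)
Lemma radical_split N f : f != 0 -> (size f <= N.+1)%N -> exists G E,
  [/\ separable_poly G, G %| f, E ^+ 4 %| f & f %| G ^+ 3 * E ^+ N].
Proof.
have [m] := ubnP (size f); elim: m f => // m IH f fm f0 fN.
have [f1|f1] := leqP (size f) 1.
  exists 1, 1; rewrite !expr1n mulr1 !dvd1p; split=> //.
    by rewrite separable_poly.unlock derivC coprimep0 eqpxx.
  by rewrite dvdp1 eqn_leq f1 size_poly_gt0.
have [q iq qf] := exists_irreducible_factor f1.
have q1 : (1 < size q)%N by case: iq.
have q0 : q != 0 by rewrite -size_poly_gt0; apply: ltn_trans q1.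
have [e [g [Ef nd]]] := irreducible_valuation iq f0.
have g0 : g != 0 by apply: contraNneq f0 => g0; rewrite Ef g0 mulr0.
have e0 : (0 < e)%N.
  by rewrite lt0n; apply: contraTneq qf => e0; rewrite Ef e0 mul1r.
have sg : (0 < size g)%N by rewrite size_poly_gt0.
have szf : (size g + e <= size f)%N.
  have -> : size f = (size (q ^+ e) + size g).-1 by rewrite Ef sizeM_rat ?expf_neq0.
  have : (e < size (q ^+ e))%N.
    have qe0 : (0 < size (q ^+ e))%N by rewrite size_poly_gt0 expf_neq0.
    by rewrite -(prednK qe0) ltnS size_exp leq_pmull // -ltnS prednK // ltnW.
  by lia.
have [|||G [E [sG Gg Eg gGE]]] := IH g; [lia|exact: g0|lia|].
(* A multiplicity e <= 3 is covered by G^3 alone, a larger one by E^N, because e <= deg f <= N. *)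
exists (q * G), (if (e <= 3)%N then E else q * E); split.
- rewrite separable_mul irreducible_separable //= sG /=.
  by apply: (coprimep_dvdl Gg); apply: irreducible_coprime.
- by rewrite Ef dvdp_mul // -[X in X %| _]expr1 dvdp_exp2l.
- rewrite Ef; case: ifP => [_|e3]; first by rewrite dvdp_mull.
  by rewrite exprMn dvdp_mul // dvdp_exp2l //; lia.
- rewrite Ef; case: ifP => [e3|e3].
    by rewrite exprMn -mulrA dvdp_mul // dvdp_exp2l.
  rewrite !exprMn mulrACA dvdp_mul // -exprD dvdp_exp2l //.
  by lia.
Qed.

End Radical.

Local Notation pZtoQ := (map_poly (intr : int -> rat)).

(** Gauss's lemma brings [radical_split] down to integer polynomials, ready for reduction modulo p.
    Divisibility over Q says nothing about the content, whence the primitive part of f; separability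
    of G becomes a nonzero resultant. *)
Lemma int_radical_split N (f : {poly int}) : f != 0 -> (size f <= N.+1)%N ->
  exists G E : {poly int},
  [/\ resultant G G^`() != 0, exists r, f = G * r, exists r, f = E * r,
      (4 * (size E).-1 <= (size f).-1)%N
    & exists r, G ^+ 3 * E ^+ N = zprimitive f * r].
Proof.
move=> f0 fN; have [||G0 [E0 [sG Gf Ef fGE]]] := @radical_split N (pZtoQ f).
- by rewrite map_poly_eq0_id0 ?intr_eq0 ?lead_coef_eq0.
- by rewrite size_rat_int_poly.
have prim (g : {poly rat}) : g %| pZtoQ f -> exists h : {poly int}, pZtoQ h %= g /\ exists r, f = h * r.
  case/dvdpP_rat_int => h [a a0 ->] [r Er]; exists h; split; last by exists r.
  by rewrite eqp_sym eqp_scale.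
have [G [eqG [r1 Er1]]] := prim _ Gf.
have [E [eqE [r2 Er2]]] := prim E0 (dvdp_trans (dvdp_exp2l E0 (isT : (1 <= 4)%N)) Ef).
exists G, E; split; [|by exists r1|by exists r2| |].
- rewrite resultant_eq0 -leqNgt.
  have := eqp_separable eqG; rewrite sG separable_poly.unlock => /idP.
  rewrite /coprimep deriv_map => /eqP cop.
  have d1 : pZtoQ (gcdp G G^`()) %| gcdp (pZtoQ G) (pZtoQ G^`()).
    by rewrite dvdp_gcd !dvdp_rat_int dvdp_gcdl dvdp_gcdr.
  have := dvdp_leq _ d1; rewrite size_rat_int_poly cop; apply.
  by rewrite -size_poly_gt0 cop.
- have := dvdp_leq _ Ef; rewrite size_rat_int_poly map_poly_eq0_id0 ?intr_eq0 ?lead_coef_eq0 // => /(_ f0).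
  rewrite -(size_rat_int_poly E) (eqp_size eqE) mulnC -size_exp => h.
  by rewrite -ltnS; case: (size (E0 ^+ 4)) h => [|k] /=; case: (size f) => [|l] //=.
- have : f %| G ^+ 3 * E ^+ N.
    rewrite -dvdp_rat_int rmorphM !rmorphXn /=.
    by rewrite (eqp_dvdr _ (eqp_trans (eqp_mulr _ (eqp_exp 3 eqG)) (eqp_mull _ (eqp_exp N eqE)))).
  by case/dvdpP_int => r ->; exists r.
Qed.

(** * Determinants of matrix pencils *)

Section DetPoly.
Variables (R : comNzRingType) (n : nat).
Implicit Types A B : 'M[R]_n.

Definition detp A B : {poly R} :=
  \det (map_mx polyC A + 'X *: map_mx polyC B).

Lemma horner_detp A B t : (detp A B).[t] = \det (A + t *: B).
Proof.
rewrite -[_.[t]]/(horner_eval t _) -det_map_mx; congr (\det _).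
by apply/matrixP => i j; rewrite !mxE /= /horner_eval !hornerE.
Qed.

Lemma detp_comp A B t : detp A B \Po ('X + t%:P) = detp (A + t *: B) B.
Proof.
rewrite -[_ \Po _]/(comp_poly _ _) -det_map_mx; congr (\det _).
apply/matrixP => i j; rewrite !mxE /= comp_polyD comp_polyM !comp_polyC comp_polyX.
by rewrite polyCD polyCM; ring.
Qed.

End DetPoly.

Lemma map_detp (R S : comNzRingType) (phi : {rmorphism R -> S}) n (A B : 'M[R]_n) :
  map_poly phi (detp A B) = detp (map_mx phi A) (map_mx phi B).
Proof.
rewrite -det_map_mx; congr (\det _).
by apply/matrixP => i j; rewrite !mxE /= rmorphD rmorphM /= !map_polyC map_polyX.
Qed.

(** From A + X B = (X + A B^(-1)) B. *)
Lemma detp_char (F : fieldType) n (A B : 'M[F]_n) : B \in unitmx ->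
  detp A B = \det B *: char_poly (- (A *m invmx B)).
Proof.
move=> uB; rewrite -mul_polyC mulrC /char_poly -det_map_mx /= -det_mulmx; congr (\det _).
rewrite /char_poly_mx map_mxN opprK mulmxDl -map_mxM -mulmxA mulVmx // mulmx1.
by rewrite mul_scalar_mx addrC.
Qed.

Lemma size_detp (F : fieldType) n (A B : 'M[F]_n) : B \in unitmx ->
  size (detp A B) = n.+1.
Proof.
move=> uB; rewrite detp_char // size_scale ?size_char_poly //.
by rewrite -unitfE -unitmxE.
Qed.

Lemma lead_coef_detp (F : fieldType) n (A B : 'M[F]_n) : B \in unitmx ->
  lead_coef (detp A B) = \det B.
Proof.
by move=> uB; rewrite detp_char // lead_coefZ (monicP (char_poly_monic _)) mulr1.
Qed.

Lemma intr_unitmx (F : numFieldType) n (B : 'M[int]_n) : \det B != 0 ->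
  map_mx (intr : int -> F) B \in unitmx.
Proof. by move=> B0; rewrite unitmxE det_map_mx unitfE intr_eq0. Qed.

Section IntDetPoly.
Variables (n : nat) (A B : 'M[int]_n).
Hypothesis B0 : \det B != 0.

Lemma size_detp_int : size (detp A B) = n.+1.
Proof. by rewrite -size_rat_int_poly map_detp size_detp // intr_unitmx. Qed.

Lemma lead_coef_detp_int : lead_coef (detp A B) = \det B.
Proof.
apply: (@intr_inj rat); rewrite -lead_coef_map_inj //; last exact: intr_inj.
by rewrite map_detp lead_coef_detp ?intr_unitmx // det_map_mx.
Qed.

Lemma detp_int_neq0 : detp A B != 0.
Proof. by rewrite -lead_coef_eq0 lead_coef_detp_int. Qed.

End IntDetPoly.

(** * Bounds for roots, coefficients and values of integer factors *)

Lemma eigenvalue_le n (M : 'M[algC]_n) (b : algC) z :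
  (forall i j, `|M i j| <= b) -> root (char_poly M) z -> `|z| <= n%:R * b.
Proof.
move=> Mb; rewrite -eigenvalue_root_char => /eigenvalueP[v vM v0].
have S0 : 0 < \sum_j `|v 0 j|.
  rewrite lt_def sumr_ge0 // andbT; apply: contra v0 => /eqP.
  move=> /psumr_eq0P h; apply/eqP/rowP => j; rewrite mxE.
  by apply/eqP; rewrite -normr_eq0; apply/eqP; apply: h.
rewrite -(ler_pM2r S0) mulr_sumr.
have -> : \sum_j `|z| * `|v 0 j| = \sum_j `|(v *m M) 0 j|.
  by apply: eq_bigr => j _; rewrite vM mxE normrM.
apply: (@le_trans _ _ (\sum_(j < n) \sum_i `|v 0 i| * b)).
  apply: ler_sum => j _; rewrite mxE; apply: le_trans (ler_norm_sum _ _ _) _.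
  by apply: ler_sum => i _; rewrite normrM ler_wpM2l.
by rewrite sumr_const card_ord -mulr_suml mulrC -mulrA mulr_natl mulrC.
Qed.

(** The roots are eigenvalues of -A B^(-1), whose entries are O(H) with a constant depending on B
    alone. *)
Lemma detp_root_le n (B : 'M[int]_n) : \det B != 0 -> exists K : nat,
  forall (A : 'M[int]_n) (H : nat), (forall i j, `|A i j| <= H%:Z) ->
  forall z : algC, root (map_poly intr (detp A B)) z -> `|z| <= (K * H)%:R.
Proof.
move=> B0; have uB := intr_unitmx algC B0.
pose C := invmx (map_mx (intr : int -> algC) B).
pose b := \sum_i \sum_j `|C i j|.
have b0 : 0 <= b by do 2!(apply: sumr_ge0 => ? _).
have Cb k j : `|C k j| <= b.
  rewrite /b (bigD1 k) //= (bigD1 j) //= -addrA lerDl addr_ge0 ?sumr_ge0 // => i _.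
  exact: sumr_ge0.
have bK := archi_boundP b0; set K := Num.Def.archi_bound b in bK.
exists (n * (n * K))%N => A H AH z.
rewrite map_detp detp_char // rootZ; last by rewrite -unitfE -unitmxE.
move=> /(eigenvalue_le (b := n%:R * (H%:R * b))) hz; apply: le_trans (hz _) _.
  move=> i j; rewrite mxE normrN mxE; apply: le_trans (ler_norm_sum _ _ _) _.
  rewrite [leRHS]mulr_natl -[X in _ *+ X]card_ord -sumr_const; apply: ler_sum => k _.
  rewrite mxE normrM ler_pM // -intr_norm -[H%:R]/((H%:Z)%:~R) ler_int AH //.
rewrite -!mulnA !natrM ler_wpM2l // ler_wpM2l // mulrC ler_wpM2r // ltW //.
Qed.

Lemma coef_prod_XsubC_le (s : seq algC) (rho : algC) : 0 <= rho ->
  {in s, forall z, `|z| <= rho} ->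
  forall i, `|(\prod_(z <- s) ('X - z%:P))`_i| <= (1 + rho) ^+ size s.
Proof.
move=> r0; elim: s => [|z s IH] h i.
  by rewrite big_nil coefC; case: eqP; rewrite ?normr1 ?normr0 ?ler01.
rewrite big_cons /= exprS mulrBl coefB mulrDl mul1r coefXM coefCM.
have IH' j := IH (fun y ys => h y (mem_behead (s := z :: s) ys)) j.
apply: le_trans (ler_normB _ _) _; apply: lerD.
  by case: eqP => _ //; rewrite normr0 exprn_ge0 // addr_ge0.
by rewrite normrM ler_pM // h // mem_head.
Qed.

Section IntFactor.
Variables (f G r : {poly int}) (rho : algC).
Hypotheses (f0 : f != 0) (rho0 : 0 <= rho) (fGr : f = G * r).
Hypothesis roots : forall z : algC, root (map_poly intr f) z -> `|z| <= rho.

Lemma lead_factor_le : (`|lead_coef G|%:~R : algC) <= `|lead_coef f|%:~R.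
Proof.
rewrite ler_int fGr lead_coefM normrM ler_peMr //.
rewrite -gtz0_ge1 normr_gt0 lead_coef_eq0.
by apply: contraNneq f0 => r0; rewrite fGr r0 mulr0.
Qed.

(** The roots of an integer factor G are roots of f, and its leading coefficient divides that of f.
    So G is bounded through the roots of f, and its values grow with exponent deg G, not deg f; this
    is crucial for E. *)
Lemma factor_split : exists s : seq algC,
  [/\ map_poly intr G = (lead_coef G)%:~R *: \prod_(z <- s) ('X - z%:P),
      size s = (size G).-1 & {in s, forall z, `|z| <= rho}].
Proof.
have [s Es] := closed_field_poly_normal (map_poly intr G : {poly algC}).
have G0 : G != 0 by apply: contraNneq f0 => G0; rewrite fGr G0 mul0r.
have lG : lead_coef (map_poly intr G : {poly algC}) = (lead_coef G)%:~R.
  by rewrite lead_coef_map_inj //; exact: intr_inj.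
have l0 : lead_coef (map_poly intr G : {poly algC}) != 0 by rewrite lG intr_eq0 lead_coef_eq0.
exists s; split; first by rewrite -lG.
  have : size (map_poly intr G : {poly algC}) = size G.
    by apply: size_map_inj_poly => //; exact: intr_inj.
  by rewrite {1}Es size_scale // size_prod_XsubC => <-.
move=> z zs; apply: roots; rewrite fGr rmorphM rootM /= Es rootZ //.
by rewrite root_prod_XsubC zs.
Qed.

Lemma factor_coef_le i :
  (`|G`_i|%:~R : algC) <= `|lead_coef f|%:~R * (1 + rho) ^+ (size G).-1.
Proof.
have [s [Es sz hs]] := factor_split.
rewrite intr_norm -coef_map Es coefZ normrM -intr_norm -sz.
by apply: ler_pM => //; rewrite ?lead_factor_le ?coef_prod_XsubC_le ?ler0z.
Qed.

Lemma factor_horner_le (t : int) :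
  (`|G.[t]|%:~R : algC) <= `|lead_coef f|%:~R * (`|t|%:~R + rho) ^+ (size G).-1.
Proof.
have [s [Es sz hs]] := factor_split.
rewrite intr_norm -horner_map /= Es hornerZ normrM -intr_norm -sz.
apply: ler_pM => //; rewrite ?lead_factor_le ?ler0z //.
rewrite horner_prod; elim: s hs {Es sz} => [|z s IH] hs; first by rewrite big_nil normr1.
rewrite big_cons normrM exprS; apply: ler_pM => //; last first.
  by apply: IH => y ys; apply: hs; rewrite inE ys orbT.
rewrite !hornerE; apply: le_trans (ler_normB _ _) _.
by rewrite intr_norm lerD2l hs // mem_head.
Qed.

End IntFactor.

Section FourfoldRoot.
Variables (p : nat) (pp : prime p).
Local Notation phi := (map_poly (intr : int -> 'F_p)).

(** A row with D_i = 0 is X times a row of B, so every term of the Leibniz expansion has a factor X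
    for each such row. *)
Lemma det_corank (F : fieldType) n (D : 'I_n -> F) (B : 'M[F]_n) :
  'X^(#|[set i | D i == 0]|) %| detp (diag_mx (\row_i D i)) B.
Proof.
apply: (big_ind (fun u : {poly F} => _ %| u)) => [|u v|s _]; [exact: dvdp0|exact: dvdp_add|].
apply: dvdp_mull.
rewrite (bigID (mem [set i | D i == 0])) /=; apply: dvdp_mulr.
rewrite -prodr_const; apply: (big_ind2 (fun u v : {poly F} => u %| v)) => //.
  by move=> *; apply: dvdp_mul.
move=> i; rewrite inE => /eqP Di; rewrite !mxE Di mul0rn polyC0 add0r.
exact: dvdp_mulr.
Qed.

(** Corank at least 4 modulo p, witnessed by an integral diagonal form because the kernel bound
    produces it in this shape. *)
Definition corank4 n (M : 'M[int]_n) := exists (L U : 'M[int]_n) (d : 'I_n -> int),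
  [/\ L \in unitmx, U \in unitmx, M = L *m diag_mx (\row_i d i) *m U
    & (3 < #|[set i | (p%:Z %| d i)%Z]|)%N].

(** Up to units, det (A + t B + X B) modulo p is the determinant of a pencil whose constant matrix
    is diagonal with at least four zeros, so X^4 divides it; then X is translated to X - t. *)
Lemma corank4_root n (A B : 'M[int]_n) (t : int) : corank4 (A + t *: B) ->
  ('X - (t%:~R)%:P) ^+ 4 %| phi (detp A B).
Proof.
move=> [L [U [d [uL uU E d4]]]].
have uF (M : 'M[int]_n) : M \in unitmx -> map_mx (intr : int -> 'F_p) M \in unitmx.
  rewrite !unitmxE det_map_mx => /unitrP[y [_ hy]]; apply/unitrP; exists y%:~R.
  by rewrite -!rmorphM /= mulrC hy.
have X4 : 'X^4 %| detp (map_mx (intr : int -> 'F_p) (A + t *: B)) (map_mx intr B).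
  set L' := map_mx (intr : int -> 'F_p) L; set U' := map_mx (intr : int -> 'F_p) U.
  pose B' := invmx L' *m map_mx intr B *m invmx U'.
  have -> : detp (map_mx (intr : int -> 'F_p) (A + t *: B)) (map_mx intr B) =
     (\det L')%:P * detp (diag_mx (\row_i (d i)%:~R)) B' * (\det U')%:P.
    rewrite -!det_map_mx -!det_mulmx; congr (\det _).
    rewrite mulmxDr mulmxDl -!map_mxM -scalemxAr -scalemxAl -!map_mxM.
    have <- : map_mx (intr : int -> 'F_p) (A + t *: B) = L' *m diag_mx (\row_i (d i)%:~R) *m U'.
      rewrite E !map_mxM; congr (_ *m _ *m _).
      by apply/matrixP => i j; rewrite !mxE rmorphMn.
    have <- // : map_mx (intr : int -> 'F_p) B = L' *m B' *m U'.
    by rewrite /B' !mulmxA mulmxV ?uF // mul1mx -mulmxA mulVmx ?uF // mulmx1.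
  apply: dvdp_mulr; apply: dvdp_mull; apply: dvdp_trans (det_corank _ _).
  apply: dvdp_exp2l; apply: leq_trans d4 _; apply: subset_leq_card.
  by apply/fintype.subsetP => i; rewrite !inE (intr_Fp_eq0 pp).
have -> : phi (detp A B) = detp (map_mx (intr : int -> 'F_p) (A + t *: B)) (map_mx intr B) \Po ('X - (t%:~R)%:P).
  rewrite map_detp map_mxD map_mxZ -detp_comp -comp_polyA.
  by rewrite comp_polyD comp_polyX comp_polyC subrK comp_polyXr.
by have := dvdp_comp_poly ('X - (t%:~R)%:P) X4; rewrite rmorphXn /= comp_polyX.
Qed.

(** E(t) is a unit modulo p, so (X - t)^4 divides G^3 modulo p. A simple root of G would account for
    (X - t)^3 only; hence t is a double root of G, and the resultant, lying in the ideal (G, G'),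
    vanishes modulo p. *)
Lemma fourfold_resultant (f G E r1 r : {poly int}) N (t : int) :
  ~~ (p%:Z %| lead_coef f)%Z -> f = G * r1 -> G ^+ 3 * E ^+ N = zprimitive f * r ->
  ('X - (t%:~R)%:P) ^+ 4 %| phi f -> ~~ (p%:Z %| E.[t])%Z ->
  (p%:Z %| resultant G G^`())%Z.
Proof.
move=> pf Ef EGE X4 pE; set x := 'X - _ in X4.
have f0 : f != 0 by apply: contraNneq pf => ->; rewrite lead_coef0 dvdz0.
have G0 : G != 0 by apply: contraNneq f0 => G0; rewrite Ef G0 mul0r.
have pG : ~~ (p%:Z %| lead_coef G)%Z.
  by apply: contra pf => h; rewrite Ef lead_coefM dvdz_mulr.
have x4 : x ^+ 4 %| phi G ^+ 3 * phi E ^+ N.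
  rewrite -!rmorphXn -rmorphM /= EGE rmorphM dvdp_mulr //=.
  move: X4; rewrite {1}[f]zpolyEprim map_polyZ /= dvdpZr // (intr_Fp_eq0 pp).
  apply: contra pf => h; rewrite [f]zpolyEprim lead_coefZ dvdz_mulr //.
have Et : ~~ root (phi E) t%:~R by rewrite rootE horner_map /= (intr_Fp_eq0 pp).
have x43 : x ^+ 4 %| phi G ^+ 3.
  move: x4; rewrite Gauss_dvdpl // coprimep_expl // coprimep_expr //.
  by rewrite coprimep_sym coprimep_XsubC.
have rG : root (phi G) t%:~R.
  rewrite -dvdp_XsubCl; have : x %| phi G ^+ 3.
    by apply: dvdp_trans x43; rewrite -{1}[x]expr1 dvdp_exp2l.
  by rewrite !dvdp_XsubCl !rootE horner_exp expf_eq0.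
have rG' : root (phi G^`()) t%:~R.
  move: (rG); rewrite -dvdp_XsubCl => /dvdpP[g Eg].
  rewrite -deriv_map Eg derivM derivXsubC mulr1 rootE hornerD hornerM !hornerE subrr mulr0 add0r -rootE.
  move: x43; rewrite Eg exprMn -/x mulrC (exprSr x 3) dvdp_mul2l ?expf_neq0 ?polyXsubC_eq0 //.
  by rewrite dvdp_XsubCl !rootE horner_exp expf_eq0.
(* [resultant_in_ideal] excludes constants. A constant G has no root modulo p; a constant G' makes G
   linear, with G' equal to its leading coefficient, a unit modulo p. *)
have [G1|G1] := leqP (size G) 1.
  move: rG; rewrite (size1_polyC G1) map_polyC rootE hornerC /= (intr_Fp_eq0 pp).
  by move=> h; rewrite (size1_polyC G1) lead_coefC h in pG.
have [G'1|G'1] := leqP (size G^`()) 1; last first.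
  have [[u v] /= _ Euv] := resultant_in_ideal G1 G'1.
  rewrite -(intr_Fp_eq0 pp); have := congr1 (fun P => (phi P).[t%:~R]) Euv.
  rewrite map_polyC hornerC rmorphD !rmorphM /= hornerD !hornerM.
  by rewrite (rootP rG) (rootP rG') !mulr0 addr0 => ->.
have lG k : (0 < k)%N -> G^`()`_k = 0 by move=> k0; rewrite nth_default // (leq_trans G'1).
have G2 : size G = 2.
  apply/eqP; rewrite eqn_leq G1 andbT leqNgt; apply/negP => G3.
  have e : (size G).-2.+1 = (size G).-1 by move: G3; case: (size G) => [|[]].
  have k0 : (0 < (size G).-2)%N by move: G3; case: (size G) => [|[|[]]].
  have := lG _ k0; rewrite coef_deriv e -lead_coefE => /eqP.
  by rewrite mulrn_eq0 lead_coef_eq0 (negPf G0) orbF; move: G3; case: (size G) => [|[]].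
move: rG'; rewrite (size1_polyC G'1) map_polyC rootE hornerC /= coef_deriv mulr1n.
by rewrite (intr_Fp_eq0 pp) => h; rewrite lead_coefE G2 h in pG.
Qed.

End FourfoldRoot.

Lemma leq_expn a b k : (a <= b)%N -> (a ^ k <= b ^ k)%N.
Proof. by move=> ab; elim: k => // k IH; rewrite !expnS leq_mul. Qed.

Lemma Sylvester_le (R : realDomainType) (g h : {poly R}) (b : R) : 0 <= b ->
  (forall i, `|g`_i| <= b) -> (forall i, `|h`_i| <= b) ->
  forall i j, `|Sylvester_mx g h i j| <= b.
Proof.
move=> b0 gb hb i j; rewrite Sylvester_mxE; case: fintype.split => k; case: (_ <= _)%N;
  by rewrite ?mulr1n ?mulr0n ?normr0.
Qed.

(** D is the resultant of G and G' for f = det (A + X B), so it depends neither on p nor on t. As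
    det (A + t B) is nonzero, E(t) is a nonzero integer; it is O(H^2), so a prime p > K H^2 cannot
    divide it. *)
Lemma critical_primes n (B : 'M[int]_n) : (n < 12)%N -> \det B != 0 ->
  exists K : nat, forall (A : 'M[int]_n) (H : nat), (0 < H)%N ->
  (forall i j, `|A i j| <= H%:Z) ->
  exists D : int, [/\ D != 0, (absz D <= K * H ^ K)%N &
    forall (p : nat) (t : int), prime p -> `|t| <= H%:Z -> (K * H ^ 2 < p)%N ->
      corank4 p (A + t *: B) -> \det (A + t *: B) != 0 -> (p%:Z %| D)%Z].
Proof.
move=> n12 B0; have [K1 hK1] := detp_root_le B0.
pose b := absz (\det B); pose m := (2 * n)%N.
have b0 : (0 < b)%N by rewrite absz_gt0.
pose beta := (n.+1 * (b * (1 + K1) ^ n))%N.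
have beta0 : (0 < beta)%N by rewrite !muln_gt0 b0 expn_gt0.
(* The summands control, in this order, |E(t)| / H^2, the constant in the expansion of the Sylvester
   determinant of order at most m, and the power of H there. *)
pose K := (b * (1 + K1) ^ 2 + m`! * beta ^ m + n * m)%N.
exists K => A H H0 AH; set f := detp A B.
have f0 : f != 0 by apply: detp_int_neq0.
have lf : lead_coef f = \det B by apply: lead_coef_detp_int.
have sf : size f = n.+1 by apply: size_detp_int.
have [|G [E [res [r1 Gr] [r2 Er] sE [r EGE]]]] := @int_radical_split n f f0.
  by rewrite sf.
have G0 : G != 0 by apply: contraNneq f0 => G0; rewrite Gr G0 mul0r.
have r10 : r1 != 0 by apply: contraNneq f0 => r10; rewrite Gr r10 mulr0.
have rho0 : 0 <= (K1 * H)%:R :> algC by rewrite ler0n.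
have sG : ((size G).-1 <= n)%N.
  have : (size f = (size G + size r1).-1)%N by rewrite Gr size_mul.
  have : (0 < size r1)%N by rewrite size_poly_gt0.
  have : (0 < size G)%N by rewrite size_poly_gt0.
  by rewrite sf; lia.
have Gi i : `|G`_i| <= (b * ((1 + K1) * H) ^ n)%N%:Z.
  have := factor_coef_le f0 rho0 Gr (hK1 _ _ AH) i; rewrite lf.
  have -> : `|\det B|%:~R * (1 + (K1 * H)%:R) ^+ (size G).-1 =
    ((b * (1 + K1 * H) ^ (size G).-1)%N%:Z)%:~R :> algC.
    by rewrite -abszE -!pmulrn [in RHS]natrM natrX [in RHS]natrD.
  rewrite ler_int => /le_trans; apply; rewrite lez_nat leq_mul2l; apply/orP; right.
  apply: (@leq_trans (((1 + K1) * H) ^ (size G).-1)); first by apply: leq_expn; nia.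
  by rewrite leq_pexp2l // muln_gt0.
have Gb i : `|G`_i| <= (beta * H ^ n)%N%:Z.
  apply: le_trans (Gi i) _; rewrite lez_nat /beta expnMn -!mulnA.
  by rewrite leq_pmull.
have G'b i : `|G^`()`_i| <= (beta * H ^ n)%N%:Z.
  rewrite coef_deriv; have [ni|ni] := leqP (size G) i.+1.
    by rewrite nth_default // mul0rn normr0.
  rewrite normrMn -mulr_natl; apply: (@le_trans _ _ (n.+1%:R * (b * ((1 + K1) * H) ^ n)%N%:Z)).
    by apply: ler_pM => //; rewrite ler_nat; lia.
  by rewrite natz -PoszM lez_nat /beta expnMn !mulnA.
exists (resultant G G^`()); split=> //.
  have := @ler_norm_det _ _ (Sylvester_mx G G^`()) (beta * H ^ n)%N%:Z.
  set dS := ((size G^`()).-1 + (size G).-1)%N => h0.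
  have {}h := h0 (Sylvester_le (b := (beta * H ^ n)%N%:Z) isT Gb G'b).
  have dSm : (dS <= m)%N.
    have := lt_size_deriv G0; rewrite /dS /m; lia.
  rewrite -lez_nat abszE; apply: le_trans h _.
  rewrite -[(beta * _)%N%:Z]natz -natrX -natrM natz lez_nat.
  apply: (@leq_trans (m`! * (beta * H ^ n) ^ m)).
    apply: leq_mul; first by apply: leq_fact.
    by rewrite leq_pexp2l // muln_gt0 beta0 expn_gt0 H0.
  rewrite expnMn mulnA -expnM; apply: leq_mul; first by rewrite /K; lia.
  by rewrite leq_pexp2l // /K; lia.
move=> p t pp tH pK c4 det0.
have bp : (b < p)%N.
  apply: leq_ltn_trans pK; rewrite -[X in (X <= _)%N]muln1; apply: leq_mul; last by rewrite expn_gt0 H0.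
  rewrite /K -!addnA; apply: leq_trans (leq_addr _ _); rewrite leq_pmulr // expn_gt0; lia.
have pf : ~~ (p%:Z %| lead_coef f)%Z.
  by rewrite lf dvdzE /=; apply/negP => /(dvdn_leq b0); rewrite leqNgt bp.
apply: (fourfold_resultant pp pf Gr EGE (corank4_root pp c4)).
apply/negP => pE.
have E0 : E.[t] != 0.
  apply: contraNneq det0 => E0; rewrite -horner_detp -/f Er hornerM E0 mul0r //.
have := factor_horner_le f0 Er (hK1 _ _ AH) t; rewrite lf.
have -> : `|\det B|%:~R * (`|t|%:~R + (K1 * H)%:R) ^+ (size E).-1 =
    ((b * (absz t + K1 * H) ^ (size E).-1)%N%:Z)%:~R :> algC.
  by rewrite -!abszE -!pmulrn [in RHS]natrM natrX [in RHS]natrD.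
rewrite ler_int -abszE lez_nat => Eb.
have : (p <= absz E.[t])%N by apply: dvdn_leq; rewrite ?absz_gt0.
rewrite leqNgt => /negP; apply; apply: leq_ltn_trans Eb (leq_ltn_trans _ pK).
apply: (@leq_trans (b * ((1 + K1) * H) ^ 2)).
  rewrite leq_mul2l; apply/orP; right.
  apply: (@leq_trans (((1 + K1) * H) ^ (size E).-1)); first by apply: leq_expn; lia.
  apply: leq_pexp2l; first by rewrite muln_gt0 H0.
  (* Here n < 12 enters: 4 deg E <= n gives deg E <= 2. *)
  by rewrite -ltnS -(ltn_pmul2l (isT : 0 < 4)%N); apply: leq_ltn_trans sE _; rewrite sf.
by rewrite expnMn mulnA leq_mul2r /K -!addnA leq_addr orbT.
Qed.

Lemma prod_primes_dvd (s : seq nat) d : uniq s ->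
  {in s, forall p, prime p /\ (p %| d)%N} -> (\prod_(p <- s) p %| d)%N.
Proof.
elim: s => [|p s IH] /=; first by rewrite big_nil dvd1n.
move=> /andP[ps us] h; rewrite big_cons Gauss_dvd.
  have [_ ->] := h p (mem_head _ _); apply: IH => // q qs.
  by apply: h; rewrite inE qs orbT.
have [pp _] := h p (mem_head _ _).
rewrite big_seq; apply: (big_ind (fun m => coprime p m)) => [|a b|q qs].
- exact: coprimen1.
- by rewrite coprimeMr => ->.
- have [pq _] := h q (mem_behead (s := p :: s) qs).
  by rewrite prime_coprime // dvdn_prime2 //; apply: contraNneq ps => ->.
Qed.

Lemma card_primes_dvd N Q (P : {set 'I_N}) d : (0 < d)%N ->
  (forall p : 'I_N, p \in P -> [/\ prime p, (Q <= p)%N & (p %| d)%N]) -> (Q ^ #|P| <= d)%N.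
Proof.
move=> d0 h; apply: (@leq_trans (\prod_(p in P) (p : nat))).
  by rewrite -prod_nat_const; apply: leq_prod => p /h[].
rewrite -big_enum /= -(big_map val xpredT id); apply: dvdn_leq => //.
apply: prod_primes_dvd; first by rewrite map_inj_uniq ?enum_uniq //; apply: val_inj.
by move=> _ /mapP[p + ->]; rewrite mem_enum => /h[].
Qed.

(** * Counting pairs (h, p) with a large drop of rank *)

Section CriticalPairs.
Variables (n : nat) (c : 'I_n -> 'I_n -> 'I_n -> int).

Definition intM (h : 'I_n -> int) : 'M[int]_n := \matrix_(j, k) \sum_i c i j k * h i.

Definition bvec (H : nat) (y : {ffun 'I_n -> 'I_(2 * H + 1)}) : 'I_n -> int :=
  fun i => (y i : nat)%:Z - H%:Z.

Lemma bvec_le H y i : `|bvec (H := H) y i| <= H%:Z.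
Proof. by rewrite /bvec; have := ltn_ord (y i); rewrite ler_norml; lia. Qed.

Lemma bvec_surj H (h : 'I_n -> int) : (forall i, `|h i| <= H%:Z) ->
  exists y : {ffun 'I_n -> 'I_(2 * H + 1)}, bvec y =1 h.
Proof.
move=> hH; have lt i : (absz (h i + H%:Z)%R < 2 * H + 1)%N.
  by have := hH i; rewrite ler_norml; lia.
exists [ffun i => Ordinal (lt i)] => i; rewrite /bvec ffunE /=.
by have := hH i; rewrite ler_norml; lia.
Qed.

Definition coef_bound : nat := \sum_i \sum_j \sum_k absz (c i j k).

Lemma intM_le (h : 'I_n -> int) (H : nat) : (forall i, `|h i| <= H%:Z) ->
  forall j k, `|intM h j k| <= (coef_bound * H)%N%:Z.
Proof.
move=> hH j k; rewrite mxE; apply: le_trans (ler_norm_sum _ _ _) _.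
apply: (@le_trans _ _ (\sum_i `|c i j k| * H%:Z)).
  by apply: ler_sum => i _; rewrite normrM ler_wpM2l.
rewrite -mulr_suml PoszM ler_wpM2r // /coef_bound.
rewrite (_ : \sum_i `|c i j k| = (\sum_i absz (c i j k))%N%:Z); last first.
  by rewrite -natz natr_sum; apply: eq_bigr => i _; rewrite natz abszE.
rewrite lez_nat; apply: leq_sum => i _.
by rewrite (bigD1 j) //= (bigD1 k) //= -addnA leq_addr.
Qed.

Lemma intMD h h' (t : int) : intM (fun i => h i + t * h' i) = intM h + t *: intM h'.
Proof.
apply/matrixP => j k; rewrite !mxE mulr_sumr -big_split; apply: eq_bigr => i _ /=.
by ring.
Qed.

Lemma eq_intM h h' : h =1 h' -> intM h = intM h'.
Proof. by move=> e; apply/matrixP => j k; rewrite !mxE; apply: eq_bigr => i _; rewrite e. Qed.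

Definition critical (p : nat) (h : 'I_n -> int) :=
  \det (intM h) != 0 /\ corank4 p (intM h).

Definition critical_pairs (H Q : nat) : {set 'I_(2 * Q) * {ffun 'I_n -> 'I_(2 * H + 1)}} :=
  [set x : 'I_(2 * Q) * {ffun 'I_n -> 'I_(2 * H + 1)} | [&& prime x.1, (Q <= x.1)%N & `[< critical x.1 (bvec x.2) >]]].

(** Such t are roots modulo p of det (A + X B), whose degree stays n because p does not divide det
    B; H < p keeps them distinct modulo p. *)
Lemma card_roots_mod (p H : nat) (A B : 'M[int]_n) : prime p -> (H < p)%N ->
  ~~ (p%:Z %| \det B)%Z ->
  (#|[set t : 'I_H.+1 | `[< corank4 p (A + (t : nat)%:Z *: B) >]]| <= n)%N.
Proof.
move=> pp Hp pB; set T := [set t | _].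
pose f := detp (map_mx (intr : int -> 'F_p) A) (map_mx intr B).
have uB : map_mx (intr : int -> 'F_p) B \in unitmx.
  by rewrite unitmxE det_map_mx unitfE intr_Fp_eq0.
have sf : size f = n.+1 by apply: size_detp.
have f0 : f != 0 by rewrite -size_poly_gt0 sf.
pose s := map (fun t : 'I_H.+1 => ((t : nat)%:Z)%:~R : 'F_p) (enum T).
have : (size s < size f)%N.
  apply: max_poly_roots => //.
    apply/allP => _ /mapP[t + ->]; rewrite mem_enum inE => /asboolP /(corank4_root pp).
    by rewrite map_detp -dvdp_XsubCl; apply: dvdp_trans; rewrite -{1}['X - _]expr1 dvdp_exp2l.
  rewrite map_inj_uniq ?enum_uniq // => t t' /eqP.
  rewrite -subr_eq0 -rmorphB intr_Fp_eq0 // -eqz_mod_dvd => /eqP; rewrite !modz_nat => -[].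
  have [lt lt'] : (t < p /\ t' < p)%N by split; apply: leq_trans (ltn_ord _) _.
  by rewrite !modn_small // => /val_inj.
by rewrite sf size_map -cardE.
Qed.

(** Each critical pair (p, h) is counted H + 1 times, through h = x + t h0 with 0 <= t <= H. For
    fixed x the integer D has O(1) prime factors p >= Q, each allowing at most n values of t; thus
    O(H^n) triples (x, p, t), and O(H^(n-1)) critical pairs. *)
Lemma critical_pairs_le (h0 : 'I_n -> int) : (0 < n < 12)%N -> \det (intM h0) != 0 ->
  exists K : nat, forall H Q : nat, (0 < H)%N -> (K * H ^ 2 < Q)%N ->
  (#|critical_pairs H Q| * H.+1 <= K * H.+1 ^ n)%N.
Proof.
move=> /andP[n0 n12] B0; have [K0 hK0] := critical_primes n12 B0.
pose beta := (1 + \sum_i absz (h0 i))%N.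
have hb i : `|h0 i| <= beta%:Z.
  by rewrite -abszE lez_nat /beta (bigD1 i) //=; lia.
pose C := (1 + coef_bound)%N.
pose d0 := absz (\det (intM h0)).
pose K := (K0 * (C * (1 + beta)) ^ 2 + C * (1 + beta) + d0 + K0 + (2 * (1 + beta)) ^ n * (n * K0.+1))%N.
exists K => H Q H0 KQ.
(* The box of half-width [H1] contains every h - t h0, and [H2] bounds the entries of M(x) for x in
   it. *)
pose H1 := ((1 + beta) * H)%N; pose H2 := (C * H1)%N.
have HH2 : (H <= H2)%N by rewrite /H2 /H1 /C; nia.
have H22 : (K0 * H2 ^ 2 < Q)%N.
  apply: leq_ltn_trans KQ; rewrite /H2 /H1 mulnA expnMn mulnA leq_mul2r /K -!addnA leq_addr orbT //.
have KQ1 : (K < Q)%N by apply: leq_ltn_trans KQ; rewrite leq_pmulr // expn_gt0 H0.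
have H2Q : (H2 <= Q)%N.
  apply: ltnW; apply: leq_ltn_trans KQ; rewrite /H2 /H1 mulnA; apply: leq_mul; first by rewrite /K; lia.
  by rewrite -{1}(expn1 H) leq_pexp2l.
pose good (x : {ffun 'I_n -> 'I_(2 * H1 + 1)}) : {set 'I_(2 * Q) * 'I_H.+1} :=
  [set u : 'I_(2 * Q) * 'I_H.+1 | [&& prime u.1, (Q <= u.1)%N & `[< critical u.1 (fun i => bvec x i + (u.2 : nat)%:Z * h0 i) >]]].
have goodle x : (#|good x| <= n * K0.+1)%N.
  have [||D [D0 Dle hD]] := hK0 (intM (bvec x)) H2.
  - by rewrite (leq_trans H0).
  - move=> i j; apply: le_trans (intM_le (bvec_le x) i j) _.
    by rewrite lez_nat leq_mul2r /C leq_addl orbT.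
  pose P : {set 'I_(2 * Q)} := [set p : 'I_(2 * Q) | [&& prime p, (Q <= p)%N & (p %| absz D)%N]].
  have Ple : (#|P| <= K0.+1)%N.
    have D1 : (0 < absz D)%N by rewrite absz_gt0.
    have : (Q ^ #|P| <= Q ^ K0.+1)%N.
      apply: leq_trans (card_primes_dvd D1 _) (leq_trans Dle _).
        by move=> q; rewrite inE => /and3P[].
      rewrite expnS; apply: leq_mul; first by apply: leq_trans (ltnW KQ1); rewrite /K; lia.
      exact: leq_expn.
    by rewrite leq_exp2l //; apply: leq_ltn_trans KQ1; rewrite /K /C; lia.
  apply: (@leq_trans (\sum_(p in P) n)); last first.
    by rewrite sum_nat_const mulnC leq_mul2l Ple orbT.
  pose T (p : 'I_(2 * Q)) := [set t : 'I_H.+1 | `[< corank4 p (intM (bvec x) + (t : nat)%:Z *: intM h0) >]].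
  apply: (@leq_trans (\sum_(p in P) #|T p|)); last first.
    apply: leq_sum => p; rewrite inE => /and3P[pp Qp _]; apply: card_roots_mod => //.
      by apply: leq_trans Qp; apply: leq_ltn_trans KQ; rewrite -{1}(mul1n H) leq_mul //;
        [rewrite /K /C; lia | rewrite -{1}(expn1 H) leq_pexp2l].
    rewrite dvdzE; apply/negP => /dvdn_leq; rewrite absz_gt0 B0 => /(_ isT).
    by rewrite leqNgt (leq_trans _ Qp) // (leq_ltn_trans _ KQ1) // -/d0 /K; lia.
  have -> : \sum_(p in P) #|T p| = #|[set u : 'I_(2 * Q) * 'I_H.+1 | (u.1 \in P) && (u.2 \in T u.1)]|.
    under eq_bigr do rewrite -sum1_card.
    by rewrite pair_big_dep -sum1_card; apply: eq_bigl => u; rewrite inE.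
  apply: subset_leq_card; apply/fintype.subsetP => -[p t]; rewrite !inE /= => /and3P[pp Qp /asboolP[d1 c4]].
  rewrite intMD in d1 c4; rewrite pp Qp /=; apply/andP; split; last exact/asboolP.
  have tH : (t <= H2)%N by apply: leq_trans HH2; rewrite -ltnS.
  have := hD p t pp _ (leq_trans H22 Qp) c4 d1; rewrite dvdzE; apply.
  by rewrite -abszE lez_nat.
have key (v : {ffun 'I_n -> 'I_(2 * H + 1)} * 'I_H.+1) : exists x : {ffun 'I_n -> 'I_(2 * H1 + 1)},
    bvec x =1 (fun i => bvec v.1 i - (v.2 : nat)%:Z * h0 i).
  apply: bvec_surj => i; apply: le_trans (ler_normB _ _) _.
  rewrite /H1 mulnDl mul1n PoszD; apply: lerD; first exact: bvec_le.
  rewrite normrM (mulnC beta) PoszM; apply: ler_pM => //.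
  by rewrite -abszE lez_nat /= -ltnS ltn_ord.
have [x hx] := fin_all_exists key.
pose f (v : 'I_(2 * Q) * {ffun 'I_n -> 'I_(2 * H + 1)} * 'I_H.+1) := (x (v.1.2, v.2), (v.1.1, v.2)).
have inj : injective f.
  move=> [[p y] t] [[p' y'] t'] [E1 -> E3]; subst t'; congr (_, _, _); apply/ffunP => i.
  have := hx (y, t) i; rewrite E1 hx /bvec /= => /eqP.
  rewrite (inj_eq (addIr _)) (inj_eq (addIr _)) => /eqP -[] /esym; exact: val_inj.
have : (#|finset.setX (critical_pairs H Q) [set: 'I_H.+1]| <=
        #|[set z : {ffun 'I_n -> 'I_(2 * H1 + 1)} * ('I_(2 * Q) * 'I_H.+1) | z.2 \in good z.1]|)%N.
  rewrite -(card_imset _ inj); apply: subset_leq_card; apply/fintype.subsetP => _ /imsetP[[[p y] t] + ->].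
  rewrite !inE /= andbT => /and3P[-> -> /asboolP[d1 c4]] /=; apply/asboolP.
  have e : intM (fun i => bvec (x (y, t)) i + (t : nat)%:Z * h0 i) = intM (bvec y).
    by apply: eq_intM => i; rewrite hx /=; ring.
  by rewrite /critical e.
rewrite cardsX cardsT card_ord => /leq_trans; apply.
have -> : #|[set z : {ffun 'I_n -> 'I_(2 * H1 + 1)} * ('I_(2 * Q) * 'I_H.+1) | z.2 \in good z.1]| =
   (\sum_x' #|good x'|)%N.
  under eq_bigr do rewrite -sum1_card.
  by rewrite pair_big_dep -sum1_card; apply: eq_bigl => u; rewrite inE.
apply: (@leq_trans (\sum_(x' : {ffun 'I_n -> 'I_(2 * H1 + 1)}) (n * K0.+1))); first by apply: leq_sum.
rewrite sum_nat_const card_ffun !card_ord.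
apply: (@leq_trans (((2 * (1 + beta)) * H.+1) ^ n * (n * K0.+1))).
  by rewrite leq_mul2r; apply/orP; right; apply: leq_expn; rewrite /H1; lia.
by rewrite expnMn mulnAC leq_mul2r /K leq_addl orbT.
Qed.

End CriticalPairs.

(** * Weyl differencing *)

Section Character.
Variable R : realType.
Local Notation cabs := (@Normc.normc R).

Lemma cabsE (z : R[i]) : (cabs z)%:C%C = `|z|.
Proof. by case: z. Qed.

Lemma cabs_ge0 (z : R[i]) : 0 <= cabs z.
Proof. by case: z => a b; exact: sqrtr_ge0.
Qed.

Lemma cabsM (y z : R[i]) : cabs (y * z) = cabs y * cabs z.
Proof. exact: Normc.normcM. Qed.

Lemma cabs_sum (I : Type) (r : seq I) (P : pred I) (F : I -> R[i]) :
  cabs (\sum_(i <- r | P i) F i) <= \sum_(i <- r | P i) cabs (F i).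
Proof.
rewrite -lecR rmorph_sum cabsE; under [leRHS]eq_bigr do rewrite /= cabsE.
exact: ler_norm_sum.
Qed.

Lemma cabs_sqr (z : R[i]) : ((cabs z) ^+ 2)%:C%C = z * z^*%C.
Proof. by rewrite rmorphXn /= cabsE sqr_normc. Qed.

Lemma eeD (x y : R) : ee (x + y) = ee x * ee y.
Proof.
rewrite /ee mulrDr cosD sinD; apply/eqP; rewrite eq_complex /=; apply/andP; split=> //.
by apply/eqP; ring.
Qed.

Lemma ee0 : ee (0 : R) = 1.
Proof. by rewrite /ee mulr0 cos0 sin0. Qed.

Lemma ee1 : ee (1 : R) = 1.
Proof. by rewrite /ee mulr1 mulr_natl cos2pi sin2pi. Qed.

Lemma eeN (x : R) : ee (- x) = (ee x)^*%C.
Proof. by rewrite /ee mulrN cosN sinN. Qed.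

Lemma cabs_ee (x : R) : cabs (ee x) = 1.
Proof. by rewrite /ee /= cos2Dsin2 sqrtr1. Qed.

Lemma eeMn (x : R) k : ee (x *+ k) = ee x ^+ k.
Proof. by elim: k => [|k IH]; rewrite ?mulr0n ?ee0 // mulrS exprS eeD IH. Qed.

Lemma ee_int (m : int) : ee (m%:~R : R) = 1.
Proof.
case: m => m; first by rewrite -pmulrn eeMn ee1 expr1n.
by rewrite NegzE rmorphN /= -pmulrn eeN eeMn ee1 expr1n conjc1.
Qed.

Definition psi (q : nat) (m : int) : R[i] := ee (m%:~R / q%:R : R).

Lemma psiD q m k : psi q (m + k) = psi q m * psi q k.
Proof. by rewrite /psi intrD mulrDl eeD. Qed.

Lemma psiN q m : psi q (- m) = (psi q m)^*%C.
Proof. by rewrite /psi intrN mulNr eeN. Qed.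

Lemma psi0 q : psi q 0 = 1.
Proof. by rewrite /psi mul0r ee0. Qed.

Lemma cabs_psi q m : cabs (psi q m) = 1.
Proof. exact: cabs_ee. Qed.

Lemma psi_dvd q m : (0 < q)%N -> (q%:Z %| m)%Z -> psi q m = 1.
Proof.
move=> q0 /dvdzP[k ->]; rewrite /psi intrM -pmulrn mulfK ?ee_int //.
by rewrite pnatr_eq0 -lt0n.
Qed.

Lemma psi_congr q m k : (0 < q)%N -> (q%:Z %| m - k)%Z -> psi q m = psi q k.
Proof. by move=> q0 h; rewrite -(subrK k m) psiD psi_dvd // mul1r. Qed.

Lemma psi_neq1 q m : (0 < q)%N -> ~~ (q%:Z %| m)%Z -> psi q m != 1.
Proof.
move=> q0 nd; rewrite (psi_congr (k := (m %% q)%Z)) //; last first.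
  by rewrite {1}(divz_eq m q) addrK dvdz_mull.
have : (0 < (m %% q)%Z < q%:Z)%R.
  have m0 : (m %% q)%Z <> 0 by move=> /dvdz_mod0P; apply/negP.
  have : (0 <= m %% q)%Z by rewrite modz_ge0; lia.
  by have := @ltz_pmod m q%:Z _; lia.
case: (m %% q)%Z => // k /andP[k0 kq]; rewrite /psi -pmulrn.
have q0' : 0 < q%:R :> R by rewrite ltr0n.
set x : R := k%:R / q%:R.
have x0 : 0 < x by rewrite divr_gt0 ?ltr0n.
have x1 : x < 1 by rewrite ltr_pdivrMr // mul1r ltr_nat.
apply/eqP => /(congr1 (@complex.Re R)) /= E.
have s0 : 0 < sin (pi * x) :> R.
  by apply: sin_gt0_pi; rewrite mulr_gt0 ?pi_gt0 //= gtr_pMr ?pi_gt0.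
have := cos_mulr2n (pi * x).
have -> : (pi * x) *+ 2 = 2 * pi * x by ring.
rewrite E => h; have : cos (pi * x) ^+ 2 = 1 by lra.
have := cos2Dsin2 (pi * x); have := exprn_gt0 2 s0; lra.
Qed.

End Character.

Lemma cauchy_sum (R : realDomainType) (I : finType) (f : I -> R) :
  (\sum_i f i) ^+ 2 <= #|I|%:R * \sum_i f i ^+ 2.
Proof.
have : 0 <= \sum_i \sum_j (f i - f j) ^+ 2 by do 2!(apply: sumr_ge0 => ? _); rewrite sqr_ge0.
under eq_bigr do under eq_bigr do rewrite sqrrB.
have -> : \sum_i \sum_j (f i ^+ 2 - f i * f j *+ 2 + f j ^+ 2) =
    (#|I|%:R * \sum_i f i ^+ 2 - (\sum_i f i) ^+ 2) *+ 2.
  have -> : \sum_i \sum_j (f i ^+ 2 - f i * f j *+ 2 + f j ^+ 2) =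
     \sum_i (f i ^+ 2 *+ #|I| - (f i * \sum_j f j) *+ 2 + \sum_j f j ^+ 2).
    apply: eq_bigr => i _; rewrite big_split sumrB /= sumr_const mulr_sumr.
    by rewrite sumrMnl.
  rewrite big_split sumrB /= sumr_const sumrMnl sumrMnl -mulr_suml mulr_natl expr2.
  by ring.
by rewrite pmulrn_lge0 // subr_ge0.
Qed.

Section Sums.
Variables (R : realType) (n : nat).
Local Notation cabs := (@Normc.normc R).

Section Periodic.
Variables (q : nat) (q0 : (0 < q)%N).

Definition periodic (T : Type) (F : ('I_n -> int) -> T) :=
  forall x y, (forall i, (q%:Z %| x i - y i)%Z) -> F x = F y.

Lemma sum_shift (T : nmodType) (F : ('I_n -> int) -> T) h : periodic F ->
  \sum_(y : {ffun 'I_n -> 'I_q}) F (fun i => vres y i + h i) =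
  \sum_(y : {ffun 'I_n -> 'I_q}) F (vres y).
Proof.
move=> perF; pose s (y : {ffun 'I_n -> 'I_q}) := vmod q0 (fun i => vres y i + h i).
have inj : injective s.
  move=> y y' E; apply/ffunP => i; apply: val_inj.
  have := vresK q0 (fun i => vres y i + h i) i; rewrite -/(s y) E => e1.
  have e2 := vresK q0 (fun i => vres y' i + h i) i; rewrite -/(s y') in e2.
  apply: (dvdz_sub_small (ltn_ord (y i)) (ltn_ord (y' i))).
  by have := rpredB e2 e1; congr (_ %| _)%Z; rewrite /vres /=; ring.
rewrite [RHS](reindex_inj inj); apply: eq_bigr => y _; apply: perF => i.
by rewrite -opprB rpredN /s; exact: (vresK q0 (fun i => vres y i + h i)).
Qed.

End Periodic.

Variable c : 'I_n -> 'I_n -> 'I_n -> int.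
Hypothesis symc : forall i j k, c i j k = c j i k /\ c i j k = c i k j.
Variables (q : nat) (q0 : (0 < q)%N) (a : int).
Hypothesis aq : coprimez a q.
Local Notation psi := (@psi R q).
Local Notation C x := (tri c x x x).

Definition nsol (h : 'I_n -> int) := nker (intM c h) q 6.

Let T (h : 'I_n -> int) := \sum_(y : {ffun 'I_n -> 'I_q}) psi (a * (C (vadd (vres y) h) - C (vres y))).

Lemma periodic_tri m b e : periodic q (fun x => psi (m * (C (vadd x b) - C (vadd x e)))).
Proof.
move=> x y h; apply: psi_congr => //; rewrite -mulrBr dvdz_mull //.
have h' d i : (q%:Z %| vadd x d i - vadd y d i)%Z.
  by have := h i; congr (_ %| _)%Z; rewrite /vadd; ring.
have -> : C (vadd x b) - C (vadd x e) - (C (vadd y b) - C (vadd y e)) =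
  (C (vadd x b) - C (vadd y b)) - (C (vadd x e) - C (vadd y e)) by ring.
by rewrite rpredB // dvd_tri_congr.
Qed.

Lemma cabs_sum_conj (I : finType) (f : I -> R[i]) :
  (cabs (\sum_i f i) ^+ 2)%:C%C = \sum_i \sum_j f i * (f j)^*%C.
Proof.
rewrite cabs_sqr rmorph_sum /= mulr_suml; apply: eq_bigr => i _.
by rewrite mulr_sumr.
Qed.

Lemma tri_intM y z h : tri c y z h = \sum_j y j * \sum_k intM c h j k * z k.
Proof.
rewrite triC23 // triC12 // /tri exchange_big /=; apply: eq_bigr => j _.
rewrite mulr_sumr exchange_big; apply: eq_bigr => k _ /=.
rewrite mxE mulr_suml mulr_sumr; apply: eq_bigr => i _.
by ring.
Qed.

(** Shifting y by the j-th unit vector multiplies the sum by psi (a l), where l is the j-th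
    coordinate of 6 M(h) z. If q does not divide l, this factor is not 1, because a is prime to q,
    and the sum vanishes. *)
Lemma cabs_linear_sum h (z : {ffun 'I_n -> 'I_q}) :
  cabs (\sum_(y : {ffun 'I_n -> 'I_q}) psi (a * (6 * tri c (vres y) (vres z) h))) <=
  (q ^ n)%:R * ([forall j, (q%:Z %| 6 * \sum_k intM c h j k * (z k : nat)%:Z)%Z])%:R.
Proof.
case: (boolP [forall j, _]) => [_|/forallPn[j nj]].
  rewrite mulr1; apply: le_trans (cabs_sum _ _ _) _.
  under eq_bigr do rewrite cabs_psi.
  by rewrite sumr_const card_ffun !card_ord.
rewrite mulr0; set S := \sum_(y : _) _.
pose e : 'I_n -> int := fun i => (i == j)%:R.
pose F x := psi (a * (6 * tri c x (vres z) h)).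
have perF : periodic q F.
  move=> x y hxy; apply: psi_congr => //; rewrite -mulrBr dvdz_mull // -mulrBr dvdz_mull //.
  rewrite !tri_intM -sumrB rpred_sum // => i _.
  by rewrite -mulrBl dvdz_mulr.
pose l := 6 * \sum_k intM c h j k * (z k : nat)%:Z.
have ES : psi (a * l) * S = S.
  rewrite /S -[RHS](sum_shift q0 e perF) mulr_sumr; apply: eq_bigr => y _.
  rewrite /F -psiD; congr (psi _).
  have -> : tri c (fun i => vres y i + e i) (vres z) h = tri c (vres y) (vres z) h + tri c e (vres z) h.
    by rewrite -triDl.
  have -> : 6 * (tri c (vres y) (vres z) h + tri c e (vres z) h) =
     6 * tri c (vres y) (vres z) h + 6 * tri c e (vres z) h by ring.
  have -> : 6 * tri c e (vres z) h = l.
    rewrite tri_intM (bigD1 j) //= /e eqxx mul1r [X in _ + X]big1 ?addr0 // => i /negPf ->.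
    by rewrite mul0r.
  by ring.
have nl : ~~ (q%:Z %| a * l)%Z.
  by rewrite mulrC Gauss_dvdzl // coprimez_sym.
have : (psi (a * l) - 1) * S = 0 by rewrite mulrBl ES mul1r subrr.
move/eqP; rewrite mulf_eq0 subr_eq0 (negPf (psi_neq1 R q0 nl)) /= => /eqP ->.
by rewrite Normc.normc0.
Qed.

(** In the expansion of |T(h)|^2 replace one variable by y + z. The second difference of C that
    appears is 6 tri y z h plus terms free of y, so the sum over y detects whether z lies in the
    kernel. *)
Lemma diff_norm_le h : cabs (T h) ^+ 2 <= (q ^ n * nsol h)%:R.
Proof.
have E : (cabs (T h) ^+ 2)%:C%C = \sum_(z : {ffun 'I_n -> 'I_q})
    psi (a * (3 * tri c (vres z) (vres z) h + 3 * tri c h h (vres z))) *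
    \sum_(y : {ffun 'I_n -> 'I_q}) psi (a * (6 * tri c (vres y) (vres z) h)).
  rewrite /T cabs_sum_conj exchange_big /=.
  transitivity (\sum_(y : {ffun 'I_n -> 'I_q}) \sum_(z : {ffun 'I_n -> 'I_q})
    psi (a * (C (vadd (vadd (vres z) (vres y)) h) - C (vadd (vres z) (vres y)))) *
    (psi (a * (C (vadd (vres y) h) - C (vres y))))^*%C).
    apply: eq_bigr => y _; rewrite -!mulr_suml; congr (_ * _).
    pose F x := psi (a * (C (vadd x h) - C x)).
    have perF : periodic q F.
      move=> x x' hx; rewrite /F.
      have e0 w : C w = C (vadd w (fun=> 0)) by apply: eq_tri => i; rewrite /vadd addr0.
      by rewrite (e0 x) (e0 x'); apply: periodic_tri.
    by rewrite -(sum_shift q0 (vres y) perF).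
  rewrite exchange_big; apply: eq_bigr => z _; rewrite mulr_sumr; apply: eq_bigr => y _.
  rewrite -psiN -!psiD; congr (psi _).
  rewrite -mulrN -!mulrDr; congr (_ * _).
  rewrite (tri_cubeD symc (vadd (vres z) (vres y)) h) (tri_cubeD symc (vres y) h).
  rewrite (tri_sqD symc (vres z) (vres y) h) (triDr symc _ _ h h) (triC12 symc (vres y) (vres z) h); ring.
have : cabs (T h) ^+ 2 = cabs ((cabs (T h) ^+ 2)%:C%C).
  by rewrite /= expr0n /= addr0 sqrtr_sqr ger0_norm // sqr_ge0.
move=> ->; rewrite E; apply: le_trans (cabs_sum _ _ _) _.
rewrite /nsol /nker -sum1_card natrM natr_sum [in leRHS]big_mkcond mulr_sumr /=.
apply: ler_sum => z _; rewrite cabsM cabs_psi mul1r inE.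
apply: le_trans (cabs_linear_sum h z) _.
by case: [forall j, _]; rewrite ?mulr1 // mulr0.
Qed.

(** S is averaged over shifts k in [0, H]^n; Cauchy's inequality in y leaves the sums T(k - l). For
    fixed l the differences k - l are distinct vectors of the box of half-width H, so the double sum
    is at most (H + 1)^n times a sum over that box. *)
Theorem weyl_differencing H :
  cabs (\sum_(y : {ffun 'I_n -> 'I_q}) psi (a * C (vres y))) ^+ 2 * (H.+1 ^ n)%:R <=
  (q ^ n)%:R * \sum_(h : {ffun 'I_n -> 'I_(2 * H + 1)}) Num.sqrt ((q ^ n * nsol (bvec h))%:R).
Proof.
set S := \sum_(y : _) _.
pose W := {ffun 'I_n -> 'I_H.+1}.
have cW : #|{: W}| = (H.+1 ^ n)%N by rewrite card_ffun !card_ord.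
pose F x := psi (a * C x).
have perF : periodic q F.
  by move=> x y h; apply: psi_congr => //; rewrite -mulrBr dvdz_mull // dvd_tri_congr.
have ES : S * (H.+1 ^ n)%:R = \sum_(y : {ffun 'I_n -> 'I_q}) \sum_(k : W) F (vadd (vres y) (vres k)).
  rewrite exchange_big /= -cW mulr_natr -sumr_const; apply: eq_bigr => k _.
  exact: (esym (sum_shift q0 (vres k) perF)).
have pos : 0 < (H.+1 ^ n)%:R :> R by rewrite ltr0n expn_gt0.
rewrite -(ler_pM2r pos).
have -> : cabs S ^+ 2 * (H.+1 ^ n)%:R * (H.+1 ^ n)%:R = cabs (S * (H.+1 ^ n)%:R) ^+ 2.
  rewrite cabsM (_ : cabs (_%:R) = (H.+1 ^ n)%:R) ?expr2; first by ring.
  by rewrite -[X in cabs X](rmorph_nat (real_complex R)) /= expr0n /= addr0 sqrtr_sqr ger0_norm.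
apply: (@le_trans _ _ ((\sum_(y : {ffun 'I_n -> 'I_q}) cabs (\sum_(k : W) F (vadd (vres y) (vres k)))) ^+ 2)).
  by rewrite lerXn2r ?nnegrE ?cabs_ge0 ?sumr_ge0 // => [y _|]; rewrite ?cabs_ge0 // ES cabs_sum.
apply: le_trans (cauchy_sum _) _.
rewrite card_ffun !card_ord -mulrA ler_wpM2l //.
have E : (\sum_(y : {ffun 'I_n -> 'I_q}) cabs (\sum_(k : W) F (vadd (vres y) (vres k))) ^+ 2)%:C%C =
  \sum_(k : W) \sum_(l : W) T (fun i => vres k i - vres l i).
  rewrite rmorph_sum /=.
  under eq_bigr do rewrite cabs_sum_conj.
  rewrite exchange_big; apply: eq_bigr => k _; rewrite exchange_big; apply: eq_bigr => l _.
  have perG : periodic q (fun x => psi (a * (C (vadd x (fun i => vres k i - vres l i)) - C x))).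
    move=> x x' hx.
    have e0 w : C w = C (vadd w (fun=> 0)) by apply: eq_tri => i; rewrite /vadd addr0.
    by rewrite (e0 x) (e0 x'); apply: periodic_tri.
  rewrite /T -(sum_shift q0 (vres l) perG); apply: eq_bigr => y _.
  rewrite /F -psiN -psiD -mulrN -mulrDr; congr (psi (_ * (_ - _))).
  by apply: eq_tri => i; rewrite /vadd; ring.
have Tge : \sum_(y : {ffun 'I_n -> 'I_q}) cabs (\sum_(k : W) F (vadd (vres y) (vres k))) ^+ 2 <=
   \sum_(k : W) \sum_(l : W) cabs (T (fun i => vres k i - vres l i)).
  set X := \sum_(y : _) _ in E *.
  have -> : X = cabs X%:C%C.
    rewrite /= expr0n /= addr0 sqrtr_sqr ger0_norm // sumr_ge0 // => y _.
    by rewrite sqr_ge0.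
  rewrite E; apply: le_trans (cabs_sum _ _ _) _; apply: ler_sum => k _.
  exact: cabs_sum.
apply: le_trans Tge _; rewrite exchange_big /= -cW mulr_natr -sumr_const.
apply: ler_sum => l _.
have key (k : W) : exists h : {ffun 'I_n -> 'I_(2 * H + 1)}, bvec h =1 (fun i => vres k i - vres l i).
  apply: bvec_surj => i; rewrite /vres ler_norml.
  by have := ltn_ord (k i); have := ltn_ord (l i); lia.
have [g hg] := fin_all_exists key.
have injg : injective g.
  move=> k k' e; apply/ffunP => i; apply: val_inj => /=.
  by have := hg k i; rewrite e hg /vres => /eqP; rewrite (inj_eq (addIr _)) => /eqP -[].
apply: (@le_trans _ _ (\sum_(k : W) Num.sqrt ((q ^ n * nsol (bvec (g k)))%:R))).
  apply: ler_sum => k _; rewrite -[leLHS]ger0_norm ?cabs_ge0 // -sqrtr_sqr ler_wsqrtr //.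
  apply: le_trans (diff_norm_le _) _.
  by rewrite /nsol (eq_intM c (hg k)).
apply: (@le_trans _ _ (\sum_(h in [set g k | k in [set: W]]) Num.sqrt ((q ^ n * nsol (bvec h))%:R))).
  rewrite big_imset /=; last by move=> k k' _ _; apply: injg.
  by rewrite le_eqVlt; apply/orP; left; apply/eqP; apply: eq_bigl => k; rewrite inE.
rewrite [leRHS](bigID (mem [set g k | k in [set: W]])) /= lerDl; apply: sumr_ge0 => h _.
exact: sqrtr_ge0.
Qed.

End Sums.

Lemma prime_ndvd6 p : prime p -> (3 < p)%N -> ~~ (p %| 6)%N.
Proof.
move=> pp p3; rewrite (_ : 6 = 2 * 3)%N // Euclid_dvdM //.
by apply/negP => /orP[] /dvdn_leq; lia.
Qed.

Section KernelBound.
Variables (n : nat) (A : 'M[int]_n).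
Local Notation r := (\rank (map_mx (intr : int -> rat) A)).

(** m is the product of the nonzero d_i. For these, gcd(q, 6 d_i) is at most 6 |d_i|, and it is 1 at
    a prime p > 3 not dividing m. Counting the zero d_i as well, it equals p for at most three
    indices unless A has corank at least 4 modulo p. *)
Lemma nker_bounds (B : nat) : (forall i j, `|A i j| <= B%:Z) ->
  exists m : nat, [/\ (0 < m)%N, (m <= r`! * B ^ r)%N,
    forall q, (0 < q)%N -> (nker A q 6 <= q ^ (n - r) * (6 ^ r * m))%N,
    forall p, prime p -> (3 < p)%N -> ~~ (p %| m)%N -> (nker A p 6 <= p ^ (n - r))%N
  & forall p, prime p -> (3 < p)%N -> corank4 p A \/ (nker A p 6 <= p ^ 3)%N].
Proof.
move=> AB; have [L [U [d [uL uU AE]]]] := smith_diag A.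
have rk := smith_rank uL uU AE; pose I := [set i | d i != 0].
have rn : (r <= n)%N by rewrite rank_leq_row.
have split q : (0 < q)%N -> (nker A q 6 <= q ^ (n - r) * \prod_(i in I) gcdn q (absz (6 * d i)%R))%N.
  move=> q0; apply: leq_trans (nker_le uL uU AE 6 q0) _.
  rewrite (bigID (mem I)) /= mulnC leq_mul2r; apply/orP; right.
  rewrite (eq_bigr (fun=> q)) => [|i]; last first.
    by rewrite inE negbK => /eqP ->; rewrite mulr0 gcdn0.
  rewrite (eq_bigl (mem (~: I))) => [|i]; last by rewrite !inE.
  by rewrite prod_nat_const cardsCs finset.setCK card_ord rk.
exists (\prod_(i in I) absz (d i)); split.
- by apply/prodn_cond_gt0 => i; rewrite inE absz_gt0.
- have := smith_prod_le uL uU AE AB.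
  rewrite -[B%:Z]natz -natrX -natrM natz -abszE lez_nat.
  by rewrite (big_morph absz abszM absz1).
- move=> q q0; apply: leq_trans (split q q0) _; rewrite leq_mul2l; apply/orP; right.
  rewrite rk -prod_nat_const -big_split /=; apply: leq_prod => i; rewrite inE => di.
  by rewrite abszM dvdn_leq ?dvdn_gcdr // muln_gt0 /= absz_gt0.
- move=> p pp p3 pm; apply: leq_trans (split p (prime_gt0 pp)) _.
  rewrite -[leqRHS]muln1 leq_mul2l; apply/orP; right.
  apply: (@leq_trans (\prod_(i in I) 1)); last by rewrite big1.
  apply: leq_prod => i iI; suff /eqP -> : coprime p (absz (6 * d i)%R) by [].
  rewrite prime_coprime // abszM Euclid_dvdM // negb_or; apply/andP; split.
    exact: prime_ndvd6.
  apply: contra pm => pd; rewrite (bigD1 i) //= dvdn_mulr //.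
- move=> p pp p3; pose J := [set i | (p%:Z %| d i)%Z].
  have [J4|J4] := ltnP 3 #|J|; [left | right].
    by exists L, U, d.
  apply: leq_trans (nker_le uL uU AE 6 (prime_gt0 pp)) _.
  apply: (@leq_trans (\prod_(i in J) p)); last by rewrite prod_nat_const leq_pexp2l ?prime_gt0.
  rewrite (bigID (mem J)) /= -[leqRHS]muln1; apply: leq_mul.
    by apply: leq_prod => i _; rewrite dvdn_leq ?prime_gt0 // dvdn_gcdl.
  rewrite big1 // => i; rewrite inE dvdzE /= => pd.
  apply/eqP; rewrite -/(coprime _ _) prime_coprime // abszM Euclid_dvdM // negb_or pd andbT.
  exact: prime_ndvd6.
Qed.

End KernelBound.

(** * Bounds for the terms of the singular series *)

Section Bounds.
Variables (R : realType) (n : nat) (c : 'I_n -> 'I_n -> 'I_n -> int).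
Hypothesis symc : symmetric_coeffs c.
Hypothesis dgc : davenport_geometric R c.
Local Notation cabs := (@Normc.normc R).
Local Notation u := (ss_abs_term R c).

Lemma rkE h : rk c h = \rank (map_mx (intr : int -> rat) (intM c h)).
Proof. by congr (\rank _); apply/matrixP => j k; rewrite !mxE. Qed.

Lemma rk_le h : (rk c h <= n)%N.
Proof. exact: rank_leq_row. Qed.

Lemma box_sum_rank (eps : R) : 0 < eps -> exists2 K : R, 0 <= K &
  forall (P : R) (f : ('I_n -> int) -> R) (g : nat -> R), 1 <= P ->
  (forall r, 0 <= g r) ->
  (forall y : {ffun 'I_n -> 'I_(2 * Num.truncn P + 1)}, f (bvec y) <= g (rk c (bvec y))) ->
  \sum_(y : {ffun 'I_n -> 'I_(2 * Num.truncn P + 1)}) f (bvec y) <=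
  \sum_(r < n.+1) K * P `^ (r%:R + eps) * g r.
Proof.
move=> e0.
have /fin_all_exists[k hk] : forall r : 'I_n.+1, exists k : R, forall P : R, 1 <= P ->
    (count_rank c P r)%:R <= k * P `^ (r%:R + eps).
  by move=> r; apply: dgc => //; rewrite -ltnS.
exists (\sum_r `|k r|); first by rewrite sumr_ge0.
move=> P f g P1 g0 fg; apply: le_trans (ler_sum _ (fun y _ => fg y)) _.
rewrite (partition_big (fun y : {ffun 'I_n -> 'I_(2 * Num.truncn P + 1)} => inord (rk c (bvec y)) : 'I_n.+1) xpredT) //=.
apply: ler_sum => r _.
apply: (@le_trans _ _ ((count_rank c P r)%:R * g r)).
  rewrite (eq_bigr (fun=> g r)) => [|y /eqP <-]; last by rewrite inordK // ltnS rk_le.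
  rewrite sumr_const [leRHS]mulr_natl le_eqVlt; apply/orP; left; apply/eqP; congr (_ *+ _).
  apply: eq_card => y; rewrite [RHS]inE /in_mem /=.
  by rewrite asboolb -[eqn _ _]/(_ == _ :> nat) inordK // ltnS rk_le.
apply: ler_wpM2r => //; apply: le_trans (hk r P P1) _; apply: ler_wpM2r; first exact: powR_ge0.
by rewrite (bigD1 r) //= (le_trans (ler_norm _)) // lerDl sumr_ge0.
Qed.

Lemma gauss_sumE q a : gauss_sum R c q a = \sum_(y : {ffun 'I_n -> 'I_q}) psi R q (a * tri c (vres y) (vres y) (vres y)).
Proof. by []. Qed.

Lemma ss_abs_term_ge0 q : 0 <= u q.
Proof. by apply: sumr_ge0 => a _; rewrite divr_ge0 ?cabs_ge0 ?exprn_ge0. Qed.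

(** Weyl differencing bounds |S(q,a)|^2 by q^(3n/2) times the last factor; at most q values of a and
    the division by q^n give the exponent 2 + 3n/2 - 2n. *)
Lemma ss_abs_term_sqr_le q H : (0 < q)%N -> u q ^+ 2 <=
  q%:R `^ (2 - n%:R / 2) *
  ((\sum_(y : {ffun 'I_n -> 'I_(2 * H + 1)}) Num.sqrt ((nsol c q (bvec y))%:R)) / H.+1%:R ^+ n).
Proof.
move=> q0; set A := \sum_(y : _) _.
have q0' : 0 < q%:R :> R by rewrite ltr0n.
have H0 : 0 < H.+1%:R ^+ n :> R by rewrite exprn_gt0.
pose B : R := Num.sqrt (q%:R ^+ n * (Num.sqrt (q%:R ^+ n) * A) / H.+1%:R ^+ n).
have SB (a : 'I_q) : coprime a q -> cabs (gauss_sum R c q a%:Z) <= B.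
  move=> aq; rewrite -[leLHS]ger0_norm ?cabs_ge0 // -sqrtr_sqr ler_wsqrtr //.
  rewrite ler_pdivlMr //.
  have := weyl_differencing R symc q0 (a := a%:Z) _ H; rewrite -gauss_sumE natrX.
  move=> /(_ _)/le_trans -> //; rewrite natrX ler_wpM2l ?exprn_ge0 //.
  rewrite /A mulr_sumr; apply: ler_sum => y _.
  by rewrite natrM natrX sqrtrM // exprn_ge0.
have uB : u q <= q%:R * (B / q%:R ^+ n).
  apply: (@le_trans _ _ (\sum_(a < q) B / q%:R ^+ n)); last first.
    by rewrite sumr_const card_ord mulr_natl.
  rewrite /u [leRHS](bigID (fun a : 'I_q => coprime a q)) /= ler_wpDr //.
    by apply: sumr_ge0 => a _; rewrite divr_ge0 ?sqrtr_ge0 ?exprn_ge0.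
  by apply: ler_sum => a aq; rewrite ler_wpM2r ?invr_ge0 ?exprn_ge0 ?SB.
have A0 : 0 <= A by apply: sumr_ge0 => y _; apply: sqrtr_ge0.
apply: (@le_trans _ _ ((q%:R * (B / q%:R ^+ n)) ^+ 2)).
  by rewrite lerXn2r ?nnegrE ?ss_abs_term_ge0 // !(mulr_ge0, invr_ge0, sqrtr_ge0, exprn_ge0, ltW q0').
rewrite !exprMn sqr_sqrtr; last first.
  by rewrite !(mulr_ge0, invr_ge0, sqrtr_ge0, exprn_ge0, ltW q0', A0) // ltW.
have s0 : 0 < Num.sqrt (q%:R ^+ n) :> R by rewrite sqrtr_gt0 exprn_gt0.
have -> : q%:R `^ (2 - n%:R / 2) = q%:R ^+ 2 / Num.sqrt (q%:R ^+ n) :> R.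
  apply: (mulIf (lt0r_neq0 s0)); rewrite divfK ?lt0r_neq0 //.
  rewrite -(powR12_sqrt (exprn_ge0 n (ltW q0'))) -[q%:R ^+ n]powR_mulrn ?ltW //.
  rewrite -powRrM -powRD ?lt0r_neq0 ?implybT // -[RHS]powR_mulrn ?ltW //.
  by congr (_ `^ _); ring.
have sq : Num.sqrt (q%:R ^+ n) ^+ 2 = q%:R ^+ n :> R by rewrite sqr_sqrtr // exprn_ge0 // ltW.
rewrite le_eqVlt; apply/orP; left; apply/eqP.
set s := Num.sqrt _ in s0 sq *; rewrite -sq.
have h0 := lt0r_neq0 s0; have h1 := lt0r_neq0 H0.
by move: (H.+1%:R ^+ n) h1 => w h1; field; apply/andP.
Qed.

Lemma sqrt_natX_powR (x : R) k : 0 <= x -> Num.sqrt (x ^+ k) = x `^ (k%:R / 2).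
Proof.
move=> x0; rewrite -(powR12_sqrt (exprn_ge0 k x0)) -powR_mulrn //.
by rewrite -powRrM.
Qed.

Lemma nsol_bounds : exists2 K : nat, (0 < K)%N & forall (P : R) (y : {ffun 'I_n -> 'I_(2 * Num.truncn P + 1)}),
  1 <= P -> exists m : nat, let r := rk c (bvec y) in
  [/\ (0 < m)%N, (m <= K * Num.truncn P ^ n)%N,
   forall q, (0 < q)%N -> Num.sqrt ((nsol c q (bvec y))%:R) <=
       q%:R `^ ((n - r)%:R / 2) * (K%:R * P `^ (r%:R / 2)) :> R,
   forall p, prime p -> (3 < p)%N -> ~~ (p %| m)%N ->
      Num.sqrt ((nsol c p (bvec y))%:R) <= p%:R `^ ((n - r)%:R / 2) :> R
  & forall p, prime p -> (3 < p)%N -> corank4 p (intM c (bvec y)) \/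
      Num.sqrt ((nsol c p (bvec y))%:R) <= p%:R `^ (3 / 2) :> R].
Proof.
pose K0 := (n`! * (1 + coef_bound c) ^ n)%N.
have K00 : (0 < K0)%N by rewrite muln_gt0 fact_gt0 expn_gt0.
exists (6 ^ n * K0)%N; first by rewrite muln_gt0 expn_gt0.
move=> P y P1; set H := Num.truncn P; have P0 : 0 <= P by apply: le_trans P1.
have H0 : (0 < H)%N by rewrite truncn_gt0.
have HP : H%:R <= P by rewrite truncn_le.
have Mle := intM_le c (bvec_le y).
have [m [m0 mle h1 h2 h3]] := nker_bounds Mle; rewrite -rkE in mle h1 h2.
set r := rk _ _ in mle h1 h2 *; have rn : (r <= n)%N := rk_le _.
have mle' : (m <= K0 * H ^ r)%N.
  apply: leq_trans mle _; rewrite expnMn mulnA leq_mul2r; apply/orP; right.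
  apply: leq_mul; first exact: leq_fact.
  by apply: (@leq_trans ((1 + coef_bound c) ^ r)); [apply: leq_expn; rewrite leq_addl | rewrite leq_pexp2l].
exists m; split=> //.
- apply: leq_trans mle' _; apply: leq_mul; last by rewrite leq_pexp2l.
  by rewrite leq_pmull // expn_gt0.
- move=> q q0; rewrite -(sqrt_natX_powR _ (ler0n _ _)) -natrX.
  apply: (@le_trans _ _ (Num.sqrt ((q ^ (n - r))%:R * ((6 ^ n * K0)%:R ^+ 2 * P ^+ r)))).
    rewrite ler_wsqrtr // (le_trans (_ : _ <= (q ^ (n - r) * (6 ^ r * m))%:R)) ?ler_nat ?h1 //.
    rewrite natrM ler_wpM2l //; apply: (@le_trans _ _ ((6 ^ n * K0) * H ^ r)%:R).
      rewrite ler_nat -mulnA; apply: leq_mul => //; exact: leq_pexp2l.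
    rewrite natrM natrX; apply: ler_pM; rewrite ?exprn_ge0 //.
      by rewrite expr2 -natrM ler_nat leq_pmulr // muln_gt0 expn_gt0.
    by rewrite lerXn2r ?nnegrE.
  rewrite sqrtrM // sqrtrM ?exprn_ge0 // sqrtr_sqr ger0_norm //.
  by rewrite (sqrt_natX_powR _ P0).
- move=> p pp p3 pm; rewrite -(sqrt_natX_powR _ (ler0n _ _)) -natrX ler_wsqrtr // ler_nat.
  exact: h2.
- move=> p pp p3; have [|h] := h3 p pp p3; [by left|right].
  by rewrite -(sqrt_natX_powR _ (ler0n _ _)) -natrX ler_wsqrtr // ler_nat.
Qed.

Lemma powRDm (x : R) a b : 0 < x -> x `^ a * x `^ b = x `^ (a + b).
Proof. by move=> x0; rewrite powRD // lt0r_neq0 // implybT. Qed.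

Hypothesis n10 : (10 <= n)%N.

Lemma ss_abs_term_le_powR : exists2 K : R, 0 <= K & forall q, (0 < q)%N -> u q <= K * q%:R `^ (- (3 / 5)).
Proof.
have e0 : (0 : R) < 1 / 10 by lra.
have [Kb Kb0 hb] := box_sum_rank e0.
have [Kd Kd0 hd] := nsol_bounds.
pose C : R := n.+1%:R * (Kb * Kd%:R).
have C0 : 0 <= C by rewrite !mulr_ge0.
exists (Num.sqrt C); first exact: sqrtr_ge0.
move=> q q0; have q1 : 1 <= q%:R :> R by rewrite ler1n.
have q00 : 0 < q%:R :> R by apply: lt_le_trans q1.
(* Rank r contributes P^r q^((n-r)/2) P^(r/2) = q^(n/2), whatever r. The exponent 1/30 below is eps
   / 3, and 2 + 1/30 - n/3 <= -13/10 for n >= 10. *)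
pose P : R := q%:R `^ (1 / 3).
have P1 : 1 <= P by rewrite -[1](powRr0 q%:R) ler_powR //; lra.
have P0 : 0 < P by apply: lt_le_trans P1.
pose g r : R := q%:R `^ ((n - r)%:R / 2) * (Kd%:R * P `^ (r%:R / 2)).
have g0 r : 0 <= g r by rewrite !mulr_ge0 // powR_ge0.
set H := Num.truncn P.
have HP : P ^+ n <= H.+1%:R ^+ n.
  by rewrite lerXn2r ?nnegrE ?(ltW P0) // ltW // truncnS_gt.
have := hb P (fun h => Num.sqrt ((nsol c q h)%:R)) g P1 g0.
have fg (y : {ffun 'I_n -> 'I_(2 * Num.truncn P + 1)}) :
    Num.sqrt ((nsol c q (bvec y))%:R) <= g (rk c (bvec y)).
  by have [m [_ _ h _ _]] := hd P y P1; apply: h.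
move=> /(_ fg); rewrite -/H => sumle.
have {sumle} sumle : \sum_(y : {ffun 'I_n -> 'I_(2 * H + 1)}) Num.sqrt ((nsol c q (bvec y))%:R) <=
    C * q%:R `^ (n%:R / 2 + 1 / 30).
  apply: le_trans sumle _; rewrite /C -mulrA -[n.+1 in leRHS]card_ord mulr_natl -sumr_const.
  apply: ler_sum => r _; have rn : (r <= n)%N by rewrite -ltnS.
  rewrite /g /P -!powRrM.
  rewrite [leLHS](_ : _ = Kb * Kd%:R * (q%:R `^ (1 / 3 * (r%:R + 1 / 10)) * q%:R `^ ((n - r)%:R / 2) * q%:R `^ (1 / 3 * (r%:R / 2)))); last by ring.
  rewrite !powRDm // natrB // ler_wpM2l ?mulr_ge0 // ler_powR //; lra.
have u2 : u q ^+ 2 <= C * q%:R `^ (- (6 / 5)).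
  apply: le_trans (ss_abs_term_sqr_le H q0) _.
  apply: (@le_trans _ _ (q%:R `^ (2 - n%:R / 2) * (C * q%:R `^ (n%:R / 2 + 1 / 30) / P ^+ n))).
    rewrite ler_wpM2l ?powR_ge0 //; apply: ler_pM => //.
    - by apply: sumr_ge0 => y _; apply: sqrtr_ge0.
    - by rewrite lef_pV2 // posrE exprn_gt0.
  have -> : (P ^+ n)^-1 = q%:R `^ (- (n%:R / 3)).
    rewrite powRN -powR_mulrn ?(ltW P0) // /P -powRrM; congr (_ `^ _)^-1; lra.
  rewrite [leLHS](_ : _ = C * (q%:R `^ (2 - n%:R / 2) * q%:R `^ (n%:R / 2 + 1 / 30) * q%:R `^ (- (n%:R / 3)))); last by ring.
  rewrite !powRDm // ler_wpM2l // ler_powR //.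
  have : 10 <= n%:R :> R by rewrite (ler_nat R 10).
  lra.
rewrite -[leLHS]ger0_norm ?ss_abs_term_ge0 // -sqrtr_sqr.
apply: le_trans (ler_wsqrtr u2) _; rewrite sqrtrM // ler_wpM2l ?sqrtr_ge0 //.
rewrite -powR12_sqrt ?powR_ge0 // -powRrM le_eqVlt; apply/orP; left; apply/eqP; congr (_ `^ _); lra.
Qed.

End Bounds.

(** * Averages over the primes of a dyadic block *)

Section PrimeBlock.
Variables (R : realType) (n : nat) (c : 'I_n -> 'I_n -> 'I_n -> int).
Hypothesis symc : symmetric_coeffs c.
Hypothesis dgc : davenport_geometric R c.
Hypothesis n10 : (10 <= n)%N.
Local Notation u := (ss_abs_term R c).

(** Otherwise every vector of the box has rank below n, and the Geometric Condition with eps = 1/2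
    allows only O(P^(n-1/2)) of those. *)
Lemma exists_nonsingular_intM : exists h0, \det (intM c h0) != 0.
Proof.
have e0 : (0 : R) < 1 / 2 by lra.
have [K K0 hK] := box_sum_rank dgc e0.
apply: contrapT => no.
pose g (r : nat) : R := (r < n)%N%:R.
(* P^(1/2) = n K + 1 beats the constant n K coming from the n ranks below n. *)
pose P : R := (n%:R * K + 1) ^+ 2.
have P1 : 1 <= P by rewrite /P exprn_ege1 // lerDr mulr_ge0.
have P0 : 0 < P by apply: lt_le_trans P1.
have := hK P (fun=> 1) g P1 (fun r => ler0n _ _).
have fg (y : {ffun 'I_n -> 'I_(2 * Num.truncn P + 1)}) : 1 <= g (rk c (bvec y)).
  rewrite /g; have [//|h] := ltnP (rk c (bvec y)) n.
  exfalso; apply: no; exists (bvec y); move: h; rewrite rkE => h.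
  have : row_free (map_mx (intr : int -> rat) (intM c (bvec y))).
    by rewrite /row_free eqn_leq rank_leq_row.
  by rewrite row_free_unit unitmxE det_map_mx unitfE intr_eq0.
move=> /(_ fg); rewrite sumr_const card_ffun !card_ord => le.
have : P ^+ n <= \sum_(r < n.+1) K * P `^ (r%:R + 1 / 2) * g r.
  apply: le_trans le; rewrite natrX lerXn2r ?nnegrE ?(ltW P0) //.
  by apply: le_trans (ltW (truncnS_gt P)) _; rewrite ler_nat addn1 ltnS leq_pmull.
rewrite big_ord_recr /= /g ltnn mulr0 addr0 => {}le.
have : P ^+ n <= n%:R * (K * P `^ (n%:R - 1 / 2)).
  apply: le_trans le _; rewrite [leRHS]mulr_natl -[X in _ <= _ *+ X]card_ord -[leRHS]sumr_const.
  apply: ler_sum => r _; rewrite ltn_ord mulr1 ler_wpM2l // ler_powR //.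
  have : (r.+1)%:R <= n%:R :> R by rewrite ler_nat ltn_ord.
  by rewrite -natr1; lra.
have -> : P ^+ n = P `^ (n%:R - 1 / 2) * (n%:R * K + 1).
  rewrite -(powRr1 (_ : 0 <= n%:R * K + 1)) ?addr_ge0 ?mulr_ge0 //.
  have -> : (n%:R * K + 1) `^ 1 = P `^ (1 / 2).
    rewrite /P -powR_mulrn ?addr_ge0 ?mulr_ge0 // -powRrM; congr (_ `^ _); lra.
  rewrite powRDm // -powR_mulrn ?ltW //; congr (_ `^ _); lra.
have := powR_gt0 (n%:R - 1 / 2) P0; set w := _ `^ _ => w0.
by nra.
Qed.

Section FixedBlock.
Variables (Q : nat) (Kd Kc : nat).
(* Any exponent [eta * n] slightly larger than 4 would do. *)
Let eta : R := 41 / (10 * n%:R).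
Let P : R := Q%:R `^ eta.
Let H := Num.truncn P.
Let PS : pred 'I_(2 * Q) := fun p => prime p && (Q <= p)%N.
Local Notation box := {ffun 'I_n -> 'I_(2 * H + 1)}.
Hypotheses (Q3 : (3 < Q)%N) (KdQ : (Kd <= Q)%N) (Kd0 : (0 < Kd)%N).

Let n10R : 10 <= n%:R :> R. Proof. by rewrite (ler_nat R 10). Qed.
Let eta0 : 0 < eta. Proof. by rewrite divr_gt0 // mulr_gt0 // ltr0n; lia. Qed.
Let etan : eta * n%:R = 41 / 10.
Proof. by rewrite /eta; field; rewrite pnatr_eq0; lia. Qed.
Let eta1 : eta <= 41 / 100. Proof. by have h := n10R; rewrite /eta ler_pdivrMr; lra. Qed.
Let Q1 : 1 <= Q%:R :> R. Proof. by rewrite ler1n; lia. Qed.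
Let Q0 : 0 < Q%:R :> R. Proof. exact: lt_le_trans Q1. Qed.
Let P1 : 1 <= P. Proof. by rewrite -[1](powRr0 Q%:R) ler_powR // ltW. Qed.
Let P0 : 0 < P. Proof. exact: lt_le_trans P1. Qed.
Let HQ : (H <= Q)%N.
Proof.
have HP : H%:R <= P by rewrite truncn_le ltW.
rewrite -(ler_nat R) (le_trans HP) //.
by rewrite -[leRHS](powRr1 (ltW Q0)) ler_powR //; have := eta1; lra.
Qed.
Let PE x : P `^ x = Q%:R `^ (eta * x). Proof. by rewrite /P -powRrM. Qed.

Let G (h : 'I_n -> int) : R := \sum_(p | PS p) Num.sqrt ((nsol c p h)%:R).
Let X (h : 'I_n -> int) : nat := #|[pred p | PS p && `[< critical c p h >]]|.

(** The first summand accounts for at most 2 Q primes not dividing m; the second for the at most n +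
    1 primes dividing m, each with the extra factor Kd P^(r/2). *)
Let gA (r : nat) : R := (2 * Q)%:R `^ ((n - r)%:R / 2) * ((2 * Q)%:R + n.+1%:R * (Kd%:R * P `^ (r%:R / 2))).
(* For [n = 10], vectors of full rank need this sharper bound, which leaves out the critical
   primes. *)
Let gB : R := (2 * Q)%:R + n.+1%:R * (2 * Q)%:R `^ (3 / 2).

Lemma card_PS : (#|PS| <= 2 * Q)%N.
Proof. by apply: leq_trans (max_card _) _; rewrite card_ord. Qed.

Section FixedVector.
Variable y : box.
Variable m : nat.
Hypotheses (m0 : (0 < m)%N) (mle : (m <= Kd * H ^ n)%N).
Local Notation r := (rk c (bvec y)).
Hypothesis nsol1 : forall q, (0 < q)%N -> Num.sqrt ((nsol c q (bvec y))%:R) <=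
       q%:R `^ ((n - r)%:R / 2) * (Kd%:R * P `^ (r%:R / 2)) :> R.
Hypothesis nsol2 : forall p, prime p -> (3 < p)%N -> ~~ (p %| m)%N ->
      Num.sqrt ((nsol c p (bvec y))%:R) <= p%:R `^ ((n - r)%:R / 2) :> R.
Hypothesis nsol3 : forall p, prime p -> (3 < p)%N -> corank4 p (intM c (bvec y)) \/
      Num.sqrt ((nsol c p (bvec y))%:R) <= p%:R `^ (3 / 2) :> R.

(** m <= Kd H^n <= Q^(n+1), since Kd and H are at most Q. *)
Lemma card_bad_primes : (#|[pred p | PS p && (p %| m)%N]| <= n.+1)%N.
Proof.
rewrite -(@leq_exp2l Q); last by lia.
have -> : #|[pred p | PS p && (p %| m)%N]| = #|[set p : 'I_(2 * Q) | PS p && (p %| m)%N]%SET|.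
  by apply: eq_card => p; rewrite !inE.
apply: leq_trans (card_primes_dvd m0 _) _.
  by move=> p; rewrite inE => /andP[/andP[]].
apply: leq_trans mle _; rewrite expnS leq_mul //; exact: leq_expn.
Qed.

Let powR_le2Q (p : 'I_(2 * Q)) (x : R) : 0 <= x -> p%:R `^ x <= (2 * Q)%:R `^ x.
Proof. by move=> x0; apply: ge0_ler_powR; rewrite ?nnegrE // ler_nat ltnW. Qed.

Lemma block_le_general : G (bvec y) <= gA r.
Proof.
have hr : 0 <= (n - r)%:R / 2 :> R by [].
have w0 : 0 <= Kd%:R * P `^ (r%:R / 2) by rewrite mulr_ge0 // powR_ge0.
rewrite /G (bigID (fun p : 'I_(2 * Q) => (p %| m)%N)) /= addrC /gA mulrDr; apply: lerD.
  apply: (@le_trans _ _ (\sum_(p | PS p && ~~ (p %| m)%N) (2 * Q)%:R `^ ((n - r)%:R / 2))).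
    apply: ler_sum => p /andP[/andP[pp Qp] pm]; apply: le_trans (nsol2 pp _ pm) (powR_le2Q _ hr).
    exact: leq_trans Qp.
  rewrite sumr_const -[leLHS]mulr_natr ler_wpM2l ?powR_ge0 // ler_nat.
  by apply: leq_trans card_PS; apply: subset_leq_card; apply/fintype.subsetP => p; case/andP.
apply: (@le_trans _ _ (\sum_(p | PS p && (p %| m)%N) (2 * Q)%:R `^ ((n - r)%:R / 2) * (Kd%:R * P `^ (r%:R / 2)))).
  apply: ler_sum => p /andP[/andP[pp Qp] pm]; apply: le_trans (nsol1 (prime_gt0 pp)) _.
  by rewrite ler_wpM2r // powR_le2Q.
rewrite sumr_const -[leLHS]mulr_natl [leRHS]mulrCA; apply: ler_wpM2r; last by rewrite ler_nat card_bad_primes.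
by rewrite mulr_ge0 // powR_ge0.
Qed.

(** At full rank a prime not dividing m contributes at most 1, a noncritical prime dividing m at
    most p^(3/2), and only critical primes are charged Kd P^(n/2). *)
Lemma block_le_full : r = n ->
  G (bvec y) <= gB + Kd%:R * P `^ (n%:R / 2) * (X (bvec y))%:R.
Proof.
move=> rn; have det0 : \det (intM c (bvec y)) != 0.
  have : row_free (map_mx (intr : int -> rat) (intM c (bvec y))) by rewrite /row_free -rkE rn.
  by rewrite row_free_unit unitmxE det_map_mx unitfE intr_eq0.
have w0 : 0 <= Kd%:R * P `^ (n%:R / 2) by rewrite mulr_ge0 // powR_ge0.
have big (p : 'I_(2 * Q)) : PS p -> Num.sqrt ((nsol c p (bvec y))%:R) <=
   (~~ (p %| m)%N)%:R + (p %| m)%N%:R * (2 * Q)%:R `^ (3 / 2) +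
     `[< critical c p (bvec y) >]%:R * (Kd%:R * P `^ (n%:R / 2)).
  move=> /andP[pp Qp]; have p3 : (3 < p)%N by apply: leq_trans Qp.
  have [pm|pm] := boolP (p %| m)%N; last first.
    have := nsol2 pp p3 pm; rewrite rn subnn mul0r powRr0 => /le_trans; apply.
    by rewrite mul0r addr0 lerDl mulr_ge0.
  rewrite mul1r add0r; case: (nsol3 pp p3) => [c4|h].
    have -> : `[< critical c p (bvec y) >] by apply/asboolP.
    rewrite mul1r; have := nsol1 (prime_gt0 pp); rewrite rn subnn mul0r powRr0 mul1r => /le_trans; apply.
    by rewrite lerDr powR_ge0.
  apply: le_trans h _; apply: le_trans (powR_le2Q p (_ : 0 <= 3 / 2)) _; first by lra.
  by rewrite lerDl mulr_ge0.
apply: le_trans (ler_sum _ big) _; rewrite !big_split /= /gB; apply: lerD; first apply: lerD.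
- rewrite -natr_sum ler_nat; apply: leq_trans card_PS; rewrite -sum1_card.
  by apply: leq_sum => p _; case: (_ %| _)%N.
- rewrite -mulr_suml ler_wpM2r ?powR_ge0 // -natr_sum ler_nat.
  apply: leq_trans card_bad_primes; rewrite -sum1_card [leqRHS]big_mkcondr /=.
  by apply: leq_sum => p _; case: (_ %| _)%N.
- rewrite -mulr_suml mulrC ler_wpM2l // -natr_sum ler_nat /X -sum1_card [leqRHS]big_mkcondr /=.
  by apply: leq_sum => p _; case: `[< _ >].
Qed.

End FixedVector.

(** Relative to P^n, rank 0 forces an exponent of at least n/2 + 1 - 41/10 = n/2 - 62/20, and
    convergence requires less than n/2 - 60/20; this is the midpoint. *)
Let theta : R := n%:R / 2 - 61 / 20.

Let powR_2Q (x : R) : 0 <= x -> x <= n%:R -> (2 * Q)%:R `^ x <= 2 ^+ n * Q%:R `^ x.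
Proof.
move=> x0 xn; rewrite natrM powRM // ler_wpM2r ?powR_ge0 //.
by rewrite -powR_mulrn // ler_powR // ler1n.
Qed.

(** Up to eps the exponents of the two summands are n/2 + 1 + (eta - 1/2) s, largest at s = 0, and
    n/2 + (3 eta / 2 - 1/2) s. For n = 10 the second is 6.035 at s = 9, within the target 6.05, but
    6.15 at s = 10. *)
Lemma gA_le (s : nat) : (s <= n)%N -> ~~ ((n == 10) && (s == n)) ->
  P `^ (s%:R + 1 / 50) * gA s <=
  2 ^+ n * (2 + n.+1%:R * Kd%:R) * (P ^+ n * Q%:R `^ theta).
Proof.
move=> sn nc; have sn' : s%:R <= n%:R :> R by rewrite ler_nat.
have s0 : 0 <= s%:R :> R by [].
have h1 : (2 * Q)%:R `^ ((n - s)%:R / 2) <= 2 ^+ n * Q%:R `^ ((n - s)%:R / 2) :> R.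
  apply: powR_2Q => //; rewrite natrB //; lra.
have Qx (a b : R) : a <= b -> Q%:R `^ a <= Q%:R `^ b by move=> ab; apply: ler_powR.
have PnE : P ^+ n = Q%:R `^ (41 / 10) by rewrite -powR_mulrn ?(ltW P0) // PE etan.
rewrite PnE powRDm //.
apply: (@le_trans _ _ (P `^ (s%:R + 1 / 50) * ((2 ^+ n * Q%:R `^ ((n - s)%:R / 2)) *
   (2 * Q%:R `^ 1 + n.+1%:R * (Kd%:R * P `^ (s%:R / 2)))))).
  rewrite ler_wpM2l ?powR_ge0 // /gA powRr1 ?(ltW Q0) // -natrM ler_wpM2r //.
  by rewrite addr_ge0 // !mulr_ge0 // powR_ge0.
rewrite !PE natrB //.
rewrite [leLHS](_ : _ = 2 ^+ n * (2 * (Q%:R `^ (eta * (s%:R + 1 / 50)) * Q%:R `^ ((n%:R - s%:R) / 2) * Q%:R `^ 1) +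
  n.+1%:R * Kd%:R * (Q%:R `^ (eta * (s%:R + 1 / 50)) * Q%:R `^ ((n%:R - s%:R) / 2) * Q%:R `^ (eta * (s%:R / 2))))); last by ring.
rewrite !powRDm // -[leRHS]mulrA ler_wpM2l ?exprn_ge0 // [leRHS]mulrDl.
have e50 : eta / 50 <= 41 / 5000 by have := eta1; lra.
have es : eta * s%:R <= 41 / 100 * s%:R by rewrite ler_wpM2r // eta1.
have es1 : eta * s%:R <= 41 / 10 by rewrite -etan ler_wpM2l // ltW.
apply: lerD.
  rewrite ler_wpM2l //; apply: Qx; rewrite /theta mulrDr; lra.
rewrite ler_wpM2l ?mulr_ge0 //; apply: Qx; rewrite /theta mulrDr.
have [n10'|n11] := eqVneq n 10%N.
  have : (s.+1)%:R <= n%:R :> R.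
    rewrite ler_nat ltn_neqAle sn andbT; apply: contra nc => ->; rewrite n10' //.
  have nE : n%:R = 10 :> R by rewrite n10'.
  rewrite -natr1; lra.
have n11' : 11 <= n%:R :> R by rewrite (ler_nat R 11) ltn_neqAle eq_sym n11.
(* The exponent is affine in s; the sign of its slope decides between the endpoints s = 0 and s =
   n. *)
have [x0|x0] := lerP (3 / 2 * eta - 1 / 2) 0.
  have : (3 / 2 * eta - 1 / 2) * s%:R <= 0 by rewrite mulr_le0_ge0.
  lra.
have : (3 / 2 * eta - 1 / 2) * s%:R <= (3 / 2 * eta - 1 / 2) * n%:R.
  by rewrite ler_wpM2l // ltW.
have := etan; lra.
Qed.

Lemma gB_le : n = 10%N -> P `^ (n%:R + 1 / 50) * gB <=
  (2 + n.+1%:R * 4) * (P ^+ n * Q%:R `^ theta).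
Proof.
move=> nE; have nE' : n%:R = 10 :> R by rewrite nE.
have PnE : P ^+ n = Q%:R `^ (41 / 10) by rewrite -powR_mulrn ?(ltW P0) // PE etan.
have e50 : eta / 50 <= 41 / 5000 by have := eta1; lra.
have gB2 : gB <= (2 + n.+1%:R * 4) * Q%:R `^ (3 / 2).
  rewrite /gB [leRHS]mulrDl; apply: lerD.
    rewrite natrM ler_wpM2l // -[leLHS](powRr1 (ltW Q0)) ler_powR //; lra.
  rewrite -mulrA ler_wpM2l // natrM powRM // ler_wpM2r ?powR_ge0 //.
  apply: (@le_trans _ _ (2 `^ 2%:R)); first by rewrite ler_powR //; lra.
  by rewrite powR_mulrn // expr2; lra.
apply: le_trans (ler_wpM2l (powR_ge0 _ _) gB2) _.
rewrite PnE powRDm // mulrCA; apply: ler_wpM2l; first by rewrite addr_ge0 // mulr_ge0.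
rewrite PE powRDm // ler_powR // /theta mulrDr etan nE'; lra.
Qed.

Variable Kb : R.
Hypothesis Kb0 : 0 <= Kb.
Hypothesis hb : forall (P : R) (f : ('I_n -> int) -> R) (g : nat -> R), 1 <= P ->
  (forall r, 0 <= g r) ->
  (forall y : {ffun 'I_n -> 'I_(2 * Num.truncn P + 1)}, f (bvec y) <= g (rk c (bvec y))) ->
  \sum_(y : {ffun 'I_n -> 'I_(2 * Num.truncn P + 1)}) f (bvec y) <=
  \sum_(r < n.+1) Kb * P `^ (r%:R + 1 / 50) * g r.
Hypothesis hd : forall (P : R) (y : {ffun 'I_n -> 'I_(2 * Num.truncn P + 1)}),
  1 <= P -> exists m : nat, let r := rk c (bvec y) in
  [/\ (0 < m)%N, (m <= Kd * Num.truncn P ^ n)%N,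
   forall q, (0 < q)%N -> Num.sqrt ((nsol c q (bvec y))%:R) <=
       q%:R `^ ((n - r)%:R / 2) * (Kd%:R * P `^ (r%:R / 2)) :> R,
   forall p, prime p -> (3 < p)%N -> ~~ (p %| m)%N ->
      Num.sqrt ((nsol c p (bvec y))%:R) <= p%:R `^ ((n - r)%:R / 2) :> R
  & forall p, prime p -> (3 < p)%N -> corank4 p (intM c (bvec y)) \/
      Num.sqrt ((nsol c p (bvec y))%:R) <= p%:R `^ (3 / 2) :> R].
Hypothesis hc : n = 10%N -> (#|critical_pairs c H Q| * H.+1 <= Kc * H.+1 ^ n)%N.

Definition block_const : R :=
  n.+1%:R * Kb * (2 ^+ n * (2 + n.+1%:R * Kd%:R) + (2 + n.+1%:R * 4)) + Kd%:R * Kc%:R * 2 ^+ n.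

Lemma sum_X : (\sum_(y : box) X (bvec y) = #|critical_pairs c H Q|)%N.
Proof.
rewrite /X; under eq_bigr do rewrite -sum1_card.
rewrite (pair_big_dep xpredT (fun (y : box) p => PS p && `[< critical c p (bvec y) >])) /=.
rewrite -[RHS]sum1_card (reindex (fun z : 'I_(2 * Q) * box => (z.2, z.1))) /=.
  by apply: eq_bigl => z; rewrite inE /PS andbA.
by exists (fun z => (z.2, z.1)) => -[].
Qed.

Lemma block_sum_le : \sum_(y : box) G (bvec y) <= block_const * (P ^+ n * Q%:R `^ theta).
Proof.
set e := (n == 10)%N.
(* The critical contribution is not controlled by the rank of h alone. So w X(h) is subtracted
   before sorting by rank and added back through the count of critical pairs; w vanishes unless n =
   10. *)
pose w : R := e%:R * (Kd%:R * P `^ (n%:R / 2)).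
have w0 : 0 <= w by rewrite !mulr_ge0 // powR_ge0.
pose f h : R := G h - w * (X h)%:R.
pose g (s : nat) : R := if e && (s == n) then gB else gA s.
have gA0 s : 0 <= gA s by rewrite mulr_ge0 ?powR_ge0 // addr_ge0 // !mulr_ge0 // powR_ge0.
have gB0 : 0 <= gB by rewrite addr_ge0 // mulr_ge0 // powR_ge0.
have g0 s : 0 <= g s by rewrite /g; case: ifP.
have fg (y : box) : f (bvec y) <= g (rk c (bvec y)).
  have [m [m0 mle h1 h2 h3]] := hd y P1.
  rewrite /f /g; case: ifP => [/andP[e1 /eqP rn]|_].
    rewrite lerBlDr /w e1 mul1r; exact: (block_le_full m0 mle h1 h2 h3 rn).
  rewrite lerBlDr (le_trans (block_le_general m0 mle h1 h2)) // lerDl mulr_ge0 //.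
have := hb P1 g0 fg; rewrite -/H sumrB -mulr_sumr -natr_sum sum_X lerBlDr => le.
apply: le_trans le _; rewrite /block_const mulrDl.
set W := P ^+ n * _; have W0 : 0 <= W by rewrite mulr_ge0 ?exprn_ge0 ?powR_ge0 // ltW.
have c0 : 0 <= 2 ^+ n * (2 + n.+1%:R * Kd%:R) :> R by rewrite mulr_ge0 // addr_ge0 // mulr_ge0.
have c1 : 0 <= 2 + n.+1%:R * 4 :> R by rewrite addr_ge0 // mulr_ge0.
apply: lerD.
  rewrite -2![leRHS]mulrA [leRHS]mulr_natl -[X in _ <= _ *+ X]card_ord -[leRHS]sumr_const.
  apply: ler_sum => s _; rewrite -mulrA ler_wpM2l //.
  have sn : (s <= n)%N by rewrite -ltnS.
  rewrite /g; case: ifPn => [/andP[/eqP nE /eqP ->]|nc].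
    by apply: le_trans (gB_le nE) _; rewrite ler_wpM2r // lerDr.
  by apply: le_trans (gA_le sn nc) _; rewrite ler_wpM2r // lerDl.
rewrite /w /e; case: eqP => [nE|_]; last first.
  by rewrite !mul0r; apply: mulr_ge0 => //; rewrite !mulr_ge0 ?exprn_ge0.
rewrite mul1r -!mulrA ler_wpM2l //.
have cp : (#|critical_pairs c H Q|)%:R <= Kc%:R * (2 * P) ^+ (n.-1) :> R.
  have h : (#|critical_pairs c H Q| <= Kc * H.+1 ^ n.-1)%N.
    by rewrite -(@leq_pmul2r H.+1) // (leq_trans (hc nE)) // -mulnA -expnSr prednK // (leq_trans _ n10).
  apply: (@le_trans _ _ (Kc * H.+1 ^ n.-1)%:R); first by rewrite ler_nat.
  rewrite natrM natrX ler_wpM2l // lerXn2r ?nnegrE ?mulr_ge0 ?(ltW P0) //.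
  have HP : H%:R <= P by rewrite truncn_le ltW.
  have := P1; rewrite -natr1; lra.
apply: le_trans (ler_wpM2l (powR_ge0 _ _) cp) _.
rewrite mulrCA ler_wpM2l // exprMn mulrCA; apply: ler_pM; rewrite ?mulr_ge0 ?exprn_ge0 ?powR_ge0 ?(ltW P0) //.
  by rewrite nE /=; rewrite ler_eXn2l // ?ltr1n.
have nE' : n%:R = 10 :> R by rewrite nE.
(* With eta = 41/100 the critical pairs give Q^(14 eta) = Q^5.74, against P^n Q^theta = Q^6.05. *)
rewrite /W -!powR_mulrn ?(ltW P0) // powRDm // !PE powRDm // ler_powR // /theta nE' nE /= mulrDr.
rewrite (_ : eta = 41 / 100); first by lra.
by have := etan; rewrite nE'; lra.
Qed.

End FixedBlock.
End PrimeBlock.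

Section PrimeBlockSum.
Variables (R : realType) (n : nat) (c : 'I_n -> 'I_n -> 'I_n -> int).
Hypothesis symc : symmetric_coeffs c.
Hypothesis dgc : davenport_geometric R c.
Hypothesis n10 : (10 <= n)%N.
Local Notation u := (ss_abs_term R c).

(** From u(p)^2 <= t (D A(p)) follows u(p) <= t + D A(p). With t = Q^(-41/40) the first part sums to
    O(Q^(-1/40)), and the second has exponent 2 - 61/20 + 41/40 = -1/40: t halves the margin 1/20
    left by the block bound. *)
Lemma sum_prime_block_le : exists (K : R) (j0 : nat), 0 <= K /\ forall j, (j0 <= j)%N ->
  \sum_(p < 2 * 2 ^ j | prime p && (2 ^ j <= p)%N) u p <= K * ((2 ^ j)%:R `^ (- (1 / 40))).
Proof.
have e0 : (0 : R) < 1 / 50 by lra.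
have [Kb Kb0 hb] := box_sum_rank dgc e0.
have [Kd Kd0 hd] := nsol_bounds R c.
have [Kc hc] : exists Kc : nat, n = 10%N -> forall H Q : nat, (0 < H)%N -> (Kc * H ^ 2 < Q)%N ->
    (#|critical_pairs c H Q| * H.+1 <= Kc * H.+1 ^ n)%N.
  have [h0 det0] := exists_nonsingular_intM dgc.
  have [nE|nN] := eqVneq n 10%N; last by exists 0%N => nE; rewrite nE eqxx in nN.
  have [|Kc h] := critical_pairs_le (c := c) (h0 := h0) _ det0; first by rewrite nE.
  by exists Kc => _.
pose BC := block_const n Kd Kc Kb.
have BC0 : 0 <= BC.
  by rewrite /BC /block_const !(addr_ge0, mulr_ge0, exprn_ge0).
(* Q > (Kc + 1)^6 gives Kc < Q^(1/6) <= Q^(9/50), hence Kc H^2 < Q because H^2 <= Q^(41/50). The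
   other summands ensure Kd <= Q and 3 < Q. *)
exists (2 + BC), ((Kc + 1) ^ 6 + Kd + 4)%N; split; first by rewrite addr_ge0.
move=> j jj; set Q := (2 ^ j)%N.
have jQ : (j < Q)%N by rewrite ltn_expl.
have Q3 : (3 < Q)%N by lia.
have KdQ : (Kd <= Q)%N by lia.
have n10R : 10 <= n%:R :> R by rewrite (ler_nat R 10).
pose eta : R := 41 / (10 * n%:R).
pose P : R := Q%:R `^ eta.
have eta0 : 0 < eta by rewrite divr_gt0 // mulr_gt0 // ltr0n; lia.
have eta1 : eta <= 41 / 100 by rewrite /eta ler_pdivrMr; lra.
have Q1 : 1 <= Q%:R :> R by rewrite ler1n; lia.
have Q0 : 0 < Q%:R :> R by apply: lt_le_trans Q1.
have P1 : 1 <= P by rewrite -[1](powRr0 Q%:R) ler_powR // ltW.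
have P0 : 0 < P by apply: lt_le_trans P1.
set H := Num.truncn P.
have HP : H%:R <= P by rewrite truncn_le ltW.
have H0 : (0 < H)%N by rewrite truncn_gt0.
have hcH : n = 10%N -> (#|critical_pairs c H Q| * H.+1 <= Kc * H.+1 ^ n)%N.
  move=> nE; apply: hc => //; rewrite -(ltr_nat R) natrM natrX.
  apply: (@le_lt_trans _ _ (Kc%:R * Q%:R `^ (41 / 50))).
    rewrite ler_wpM2l //; apply: (@le_trans _ _ (P ^+ 2)).
      by rewrite lerXn2r ?nnegrE ?(ltW P0).
    rewrite -powR_mulrn ?(ltW P0) // /P -powRrM ler_powR //; lra.
  rewrite -[ltRHS](powRr1 (ltW Q0)).
  have -> : Q%:R `^ 1 = Q%:R `^ (9 / 50) * Q%:R `^ (41 / 50) :> R.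
    by rewrite powRDm //; congr (_ `^ _); lra.
  rewrite ltr_pM2r ?powR_gt0 //.
  apply: (@lt_le_trans _ _ ((Kc + 1)%:R)); first by rewrite ltr_nat addn1.
  apply: (@le_trans _ _ (((Kc + 1) ^ 6)%:R `^ (1 / 6))).
    rewrite natrX -powR_mulrn // -powRrM (_ : 6%:R * (1 / 6) = 1) ?powRr1 //; lra.
  apply: (@le_trans _ _ (Q%:R `^ (1 / 6))); last by rewrite ler_powR //; lra.
  apply: ge0_ler_powR; rewrite ?nnegrE ?ler_nat //.
  by apply: leq_trans (ltnW jQ); apply: leq_trans jj; rewrite -addnA leq_addr.
have bs := block_sum_le n10 Q3 KdQ Kd0 Kb0 hb hd hcH; rewrite -/BC -/eta -/P -/H in bs.
pose A (p : nat) : R := \sum_(y : {ffun 'I_n -> 'I_(2 * H + 1)}) Num.sqrt ((nsol c p (bvec y))%:R).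
have SA : \sum_(p < 2 * Q | prime p && (Q <= p)%N) A p <= BC * (P ^+ n * Q%:R `^ (n%:R / 2 - 61 / 20)).
  by rewrite exchange_big.
have A0 p : 0 <= A p by apply: sumr_ge0 => y _; apply: sqrtr_ge0.
pose t : R := Q%:R `^ (- (41 / 40)).
have t0 : 0 < t by apply: powR_gt0.
pose D : R := Q%:R `^ (2 - n%:R / 2) / P ^+ n / t.
have D0 : 0 <= D by rewrite !(mulr_ge0, invr_ge0, powR_ge0, exprn_ge0) // ?(ltW P0) ?(ltW t0).
have ule (p : 'I_(2 * Q)) : prime p && (Q <= p)%N -> u p <= t + D * A p.
  move=> /andP[pp Qp].
  have u2 := @ss_abs_term_sqr_le R n c symc p H (prime_gt0 pp).
  have {}u2 : u p ^+ 2 <= t * (D * A p).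
    apply: le_trans u2 _; rewrite -/(A p).
    have -> : t * (D * A p) = Q%:R `^ (2 - n%:R / 2) * (A p / P ^+ n).
      rewrite /D; field.
      by rewrite !lt0r_neq0 ?exprn_gt0.
    apply: ler_pM; rewrite ?powR_ge0 ?mulr_ge0 ?invr_ge0 ?exprn_ge0 //.
      have p0 : 0 < p%:R :> R by rewrite ltr0n prime_gt0.
      rewrite (_ : 2 - n%:R / 2 = - (n%:R / 2 - 2)); last by ring.
      rewrite !powRN lef_pV2 ?posrE ?powR_gt0 //; apply: ge0_ler_powR; rewrite ?nnegrE ?ler_nat //.
      lra.
    rewrite ler_wpM2l // lef_pV2 ?posrE ?exprn_gt0 // lerXn2r ?nnegrE ?(ltW P0) //.
    by rewrite ltW // truncnS_gt.
  have := mulr_ge0 D0 (A0 p); have := ss_abs_term_ge0 R c p.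
  by move: (D * A p) (u p) u2 => x v; nra.
apply: le_trans (ler_sum _ ule) _; rewrite big_split /= -mulr_sumr mulrDl; apply: lerD.
  rewrite sumr_const; apply: (@le_trans _ _ ((2 * Q)%:R * t)).
    rewrite -[leLHS]mulr_natl ler_wpM2r ?(ltW t0) // ler_nat.
    by apply: leq_trans (max_card _) _; rewrite card_ord.
  rewrite natrM -mulrA ler_wpM2l // -[Q%:R in leLHS](powRr1 (ltW Q0)) powRDm // ler_powR //; lra.
apply: le_trans (ler_wpM2l D0 SA) _.
have -> : D * (BC * (P ^+ n * Q%:R `^ (n%:R / 2 - 61 / 20))) =
  BC * (Q%:R `^ (2 - n%:R / 2) * Q%:R `^ (n%:R / 2 - 61 / 20) * Q%:R `^ (41 / 40)).
  rewrite /D /t powRN; field.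
  by rewrite !lt0r_neq0 ?exprn_gt0 ?powR_gt0.
rewrite !powRDm // ler_wpM2l // ler_powR //; lra.
Qed.

End PrimeBlockSum.

(** * Summation over all prime powers *)

Lemma geometric_le (R : realFieldType) (x : R) N : 0 <= x < 1 -> \sum_(k < N) x ^+ k <= (1 - x)^-1.
Proof.
move=> /andP[x0 x1]; have x1' : 0 < 1 - x by rewrite subr_gt0.
rewrite -[leRHS]mul1r ler_pdivlMr // mulrC.
rewrite -[1 - x]opprB mulNr -subrX1 opprB.
by rewrite gerBl exprn_ge0.
Qed.

Lemma dyadic_split (R : nmodType) (P : pred nat) (f : nat -> R) j :
  \sum_(0 <= p < 2 ^ j.+1 | P p) f p =
  \sum_(0 <= p < 2 ^ j | P p) f p + \sum_(p < 2 * 2 ^ j | P p && (2 ^ j <= p)%N) f p.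
Proof.
have le : (2 ^ j <= 2 ^ j.+1)%N by rewrite leq_exp2l.
rewrite (big_cat_nat (n := 2 ^ j)) //=; congr (_ + _).
rewrite -(big_mkord (fun p => P p && (2 ^ j <= p)%N) f) -expnS [RHS](big_cat_nat (n := 2 ^ j)) //=.
have -> : \sum_(0 <= p < 2 ^ j | P p && (2 ^ j <= p)%N) f p = 0.
  by rewrite big_nat_cond big_pred0 // => i; lia.
by rewrite add0r; apply: congr_big_nat => // i /andP[-> _]; rewrite andbT.
Qed.

Section PrimePowers.
Variables (R : realType) (n : nat) (c : 'I_n -> 'I_n -> 'I_n -> int).
Hypothesis symc : symmetric_coeffs c.
Hypothesis dgc : davenport_geometric R c.
Hypothesis n10 : (10 <= n)%N.
Local Notation u := (ss_abs_term R c).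

Lemma powR2_lt1 (s : R) : s < 0 -> 0 <= (2 `^ s : R) < 1.
Proof.
move=> s0; rewrite powR_ge0 lt_neqAle powR_eq1 /=; apply/andP; split.
  by rewrite !negb_or; apply/and3P; split; [lra | rewrite -leNgt; lra | lra].
rewrite -[leRHS](powRr0 2); apply: ler_powR; [lra | exact: ltW].
Qed.

Lemma natX_powR (p k : nat) (s : R) : (p ^ k)%:R `^ s = (p%:R `^ s) ^+ k.
Proof. by rewrite natrX -(powR_mulrn _ (ler0n _ _)) powRAC powR_mulrn // powR_ge0. Qed.

(** For each p the terms with k >= 2 add up to O(p^(-6/5)), which is summable over p, while k = 1 is
    handled only in dyadic blocks, with decay 2^(-j/40). Primes below 2^j0 are bounded one at a
    time. *)
Lemma sum_prime_powers_le : exists B : R, forall N K,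
  \sum_(0 <= p < N | prime p) \sum_(1 <= k < K) u (p ^ k) <= B.
Proof.
have [U U0 hU] := ss_abs_term_le_powR symc dgc n10.
have [K0 [j0 [K00 hK0]]] := sum_prime_block_le symc dgc n10.
pose rho0 : R := 2 `^ (- (3 / 5)).
have r0 : 0 <= rho0 < 1 by apply: powR2_lt1; lra.
have [r00 r01] := andP r0.
pose g0 := (1 - rho0)^-1.
have g00 : 0 <= g0 by rewrite invr_ge0 subr_ge0 ltW.
have pk p k : (1 < p)%N -> u (p ^ k) <= U * (p%:R `^ (- (3 / 5))) ^+ k.
  move=> p1; have p0 : (0 < p)%N by apply: ltn_trans p1.
  apply: le_trans (hU _ _) _; first by rewrite expn_gt0 p0.
  by rewrite natX_powR.
have xle p : (1 < p)%N -> p%:R `^ (- (3 / 5)) <= rho0.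
  move=> p1; rewrite /rho0 !powRN lef_pV2 ?posrE ?powR_gt0 ?ltr0n //; last by apply: ltn_trans p1.
  by apply: ge0_ler_powR; rewrite ?nnegrE ?(ler_nat R 2) //; lra.
have geo p K : (1 < p)%N -> \sum_(k < K) (p%:R `^ (- (3 / 5))) ^+ k <= g0.
  move=> p1; apply: (@le_trans _ _ (\sum_(k < K) rho0 ^+ k)).
    by apply: ler_sum => k _; rewrite lerXn2r ?nnegrE ?powR_ge0 // xle.
  exact: geometric_le.
have v1 p K : (1 < p)%N -> \sum_(1 <= k < K) u (p ^ k) <= U * g0.
  move=> p1; apply: (@le_trans _ _ (\sum_(k < K) u (p ^ k))).
    rewrite -(big_mkord xpredT (fun k => u (p ^ k))).
    case: K => [|K]; first by rewrite !big_geq.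
    by rewrite [leRHS]big_ltn // lerDr ss_abs_term_ge0.
  apply: (@le_trans _ _ (\sum_(k < K) U * (p%:R `^ (- (3 / 5))) ^+ k)).
    by apply: ler_sum => k _; apply: pk.
  by rewrite -mulr_sumr ler_wpM2l // geo.
have v2 p K : (1 < p)%N -> \sum_(1 <= k < K) u (p ^ k) <= u p + U * g0 * p%:R `^ (- (6 / 5)).
  move=> p1; have w0 : 0 <= U * g0 * p%:R `^ (- (6 / 5)) by rewrite !mulr_ge0 // powR_ge0.
  case: K => [|[|K]]; try by rewrite big_geq // addr_ge0 // ss_abs_term_ge0.
  rewrite big_ltn // expn1 lerD2l.
  rewrite 2!big_add1 /= big_mkord.
  apply: (@le_trans _ _ (\sum_(k < K) U * (p%:R `^ (- (6 / 5)) * (p%:R `^ (- (3 / 5))) ^+ k))).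
    apply: ler_sum => k _; apply: le_trans (pk _ _ p1) _; rewrite ler_wpM2l // -[k.+2]addn2 exprD mulrC.
    rewrite ler_wpM2r ?exprn_ge0 ?powR_ge0 // -powR_mulrn ?powR_ge0 // -powRrM ler_powR ?ler1n ?(ltnW p1) //; lra.
  rewrite -mulr_sumr -mulrA ler_wpM2l // -mulr_sumr mulrC ler_wpM2r ?powR_ge0 //.
  exact: geo.
pose rho : R := 2 `^ (- (1 / 40)).
have rr : 0 <= rho < 1 by apply: powR2_lt1; lra.
have [rr0 rr1] := andP rr.
pose C := K0 + 2 * (U * g0).
have C0 : 0 <= C by rewrite addr_ge0 ?mulr_ge0.
pose S J K := \sum_(0 <= p < 2 ^ J | prime p) \sum_(1 <= k < K) u (p ^ k).
have v0 p K : 0 <= \sum_(1 <= k < K) u (p ^ k) by apply: sumr_ge0 => k _; apply: ss_abs_term_ge0.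
pose A0 : R := (2 ^ j0)%:R * (U * g0).
have Sj0 K : S j0 K <= A0.
  apply: (@le_trans _ _ (\sum_(0 <= p < 2 ^ j0 | prime p) U * g0)).
    by apply: ler_sum => p pp; apply: v1; apply: prime_gt1.
  apply: (@le_trans _ _ (\sum_(0 <= p < 2 ^ j0) U * g0)).
    rewrite [leRHS](bigID prime) /= lerDl sumr_ge0 // => p _; exact: mulr_ge0.
  by rewrite sumr_const_nat subn0 /A0 mulr_natl.
have block j K : (j0 <= j)%N ->
    \sum_(p < 2 * 2 ^ j | prime p && (2 ^ j <= p)%N) \sum_(1 <= k < K) u (p ^ k) <= C * rho ^+ j.
  move=> jj; have t0 : 0 < (2 ^ j)%:R :> R by rewrite ltr0n expn_gt0.
  have t1 : 1 <= (2 ^ j)%:R :> R by rewrite ler1n expn_gt0.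
  have rhoj : (2 ^ j)%:R `^ (- (1 / 40)) = rho ^+ j.
    exact: natX_powR.
  apply: (@le_trans _ _ (\sum_(p < 2 * 2 ^ j | prime p && (2 ^ j <= p)%N)
     (u p + U * g0 * (2 ^ j)%:R `^ (- (6 / 5))))).
    apply: ler_sum => p /andP[pp jp]; apply: le_trans (v2 _ _ (prime_gt1 pp)) _.
    have p0 : 0 < p%:R :> R by rewrite ltr0n prime_gt0.
    rewrite lerD2l ler_wpM2l ?mulr_ge0 // !powRN lef_pV2 ?posrE ?powR_gt0 //.
    apply: ge0_ler_powR; rewrite ?nnegrE ?ler_nat //; lra.
  rewrite big_split /= /C [leRHS]mulrDl; apply: lerD; first by rewrite -rhoj hK0.
  rewrite sumr_const; apply: (@le_trans _ _ ((2 * 2 ^ j)%:R * (U * g0 * (2 ^ j)%:R `^ (- (6 / 5))))).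
    rewrite -[leLHS]mulr_natl ler_wpM2r ?mulr_ge0 ?powR_ge0 // ler_nat.
    by apply: leq_trans (max_card _) _; rewrite card_ord.
  rewrite natrM -!mulrA ler_wpM2l // mulrCA ler_wpM2l // mulrCA ler_wpM2l // -rhoj.
  rewrite -[X in X * _](powRr1 (ltW t0)) powRDm // ler_powR //; lra.
have SB K J : S (j0 + J)%N K <= A0 + C * \sum_(j < J) rho ^+ j.
  elim: J => [|J IH]; first by rewrite addn0 big_ord0 mulr0 addr0.
  rewrite addnS /S dyadic_split big_ord_recr /= mulrDr addrA; apply: lerD => //.
  apply: le_trans (block _ _ (leq_addr _ _)) _; rewrite ler_wpM2l // exprD.
  by rewrite ler_piMl ?exprn_ge0 // exprn_ile1 // ltW.
exists (A0 + C * (1 - rho)^-1) => N K.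
apply: (@le_trans _ _ (S (j0 + N)%N K)).
  have le : (N <= 2 ^ (j0 + N))%N by apply: leq_trans (ltnW (ltn_expl _ (isT : 1 < 2)%N)) _; rewrite leq_exp2l // leq_addl.
  by rewrite /S [leRHS](big_cat_nat (n := N)) //= lerDl sumr_ge0.
apply: le_trans (SB K N) _; rewrite lerD2l ler_wpM2l //; exact: geometric_le.
Qed.

End PrimePowers.

(** * Multiplicativity *)

Definition zred (q : nat) (q0 : (0 < q)%N) (m : int) : 'I_q :=
  Ordinal (ltn_pmod (absz (m %% q%:Z)%Z) q0).

Lemma zredP (q : nat) (q0 : (0 < q)%N) m : (q%:Z %| (zred q0 m : nat)%:Z - m)%Z.
Proof. by have := @vresK 1 q q0 (fun=> m) ord0; rewrite /vres ffunE. Qed.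

Lemma coprime_congr (q a : nat) (m : int) : (q%:Z %| a%:Z - m)%Z -> coprime a q = coprimez m q%:Z.
Proof.
move=> /dvdzP[k E]; have -> : m = (- k) * q%:Z + a%:Z by rewrite mulNr -E; ring.
rewrite -[coprime a q]/(coprimez a%:Z q%:Z) /coprimez gcdzC [in RHS]gcdzC.
by rewrite gcdzMDl.
Qed.

Section GaussCRT.
Variables (R : realType) (n : nat) (c : 'I_n -> 'I_n -> 'I_n -> int).
Hypothesis symc : symmetric_coeffs c.
Local Notation C x := (tri c x x x).
Local Notation S := (gauss_sum R c).

Lemma gauss_sum_congr q a b : (0 < q)%N -> (q%:Z %| a - b)%Z -> S q a = S q b.
Proof.
move=> q0 h; rewrite !gauss_sumE; apply: eq_bigr => y _; apply: psi_congr => //.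
by rewrite -mulrBl dvdz_mulr.
Qed.

Variables (q1 q2 : nat).
Hypotheses (q10 : (0 < q1)%N) (q20 : (0 < q2)%N) (q12 : coprime q1 q2).
Let q0 : (0 < q1 * q2)%N. Proof. by rewrite muln_gt0 q10. Qed.

Lemma psi_mulr (m : int) : psi R (q1 * q2) (q2%:Z * m) = psi R q1 m.
Proof.
rewrite /psi; congr ee; rewrite intrM -pmulrn natrM.
by field; rewrite !pnatr_eq0 -!lt0n q10 q20.
Qed.

Lemma psi_mull (m : int) : psi R (q1 * q2) (q1%:Z * m) = psi R q2 m.
Proof.
rewrite /psi; congr ee; rewrite intrM -pmulrn natrM.
by field; rewrite !pnatr_eq0 -!lt0n q10 q20.
Qed.

Lemma crt_inj (x1 y1 : 'I_q1) (x2 y2 : 'I_q2) :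
  ((q1 * q2)%N%:Z %| (q2%:Z * (x1 : nat)%:Z + q1%:Z * (x2 : nat)%:Z) -
                     (q2%:Z * (y1 : nat)%:Z + q1%:Z * (y2 : nat)%:Z))%Z ->
  x1 = y1 /\ x2 = y2.
Proof.
have -> : (q2%:Z * (x1 : nat)%:Z + q1%:Z * (x2 : nat)%:Z) -
  (q2%:Z * (y1 : nat)%:Z + q1%:Z * (y2 : nat)%:Z) =
  q2%:Z * ((x1 : nat)%:Z - (y1 : nat)%:Z) + q1%:Z * ((x2 : nat)%:Z - (y2 : nat)%:Z) by ring.
rewrite PoszM => h; split; apply: val_inj => /=.
  have : (q1%:Z %| q2%:Z * ((x1 : nat)%:Z - (y1 : nat)%:Z))%Z.
    have := dvdz_trans (dvdz_mulr q2%:Z (dvdzz q1%:Z)) h.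
    by rewrite rpredDr // dvdz_mulr.
  by rewrite Gauss_dvdzr ?coprimezE //= => /dvdz_sub_small; apply.
have : (q2%:Z %| q1%:Z * ((x2 : nat)%:Z - (y2 : nat)%:Z))%Z.
  have := dvdz_trans (dvdz_mull q1%:Z (dvdzz q2%:Z)) h.
  by rewrite rpredDl // dvdz_mulr.
by rewrite Gauss_dvdzr ?coprimezE //= 1?coprime_sym // => /dvdz_sub_small; apply.
Qed.

Let crt_vec (x : {ffun 'I_n -> 'I_q1} * {ffun 'I_n -> 'I_q2}) : 'I_n -> int :=
  vadd (vscale q2%:Z (vres x.1)) (vscale q1%:Z (vres x.2)).

Lemma crt_vec_bij : bijective (fun x => vmod q0 (crt_vec x)).
Proof.
apply: inj_card_bij; last first.
  by rewrite card_prod !card_ffun !card_ord expnMn.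
move=> [x1 x2] [y1 y2] E.
have h i : x1 i = y1 i /\ x2 i = y2 i.
  apply: crt_inj.
  have e1 := vresK q0 (crt_vec (x1, x2)) i.
  have e2 := vresK q0 (crt_vec (y1, y2)) i.
  rewrite E in e1; have := rpredB e2 e1.
  by congr (_ %| _)%Z; rewrite /crt_vec /vadd /vscale /vres /=; ring.
by congr (_, _); apply/ffunP => i; have [] := h i.
Qed.

(** For x = q2 x1 + q1 x2 the cross terms of C(x) are divisible by q1 q2, which leaves q2^3 C(x1) +
    q1^3 C(x2). The twists by cubes of units disappear in the sum over a, by [unit_twist]. *)
Lemma gauss_sum_mul (a1 a2 : int) :
  S (q1 * q2) (q2%:Z * a1 + q1%:Z * a2) = S q1 (q2%:Z ^+ 3 * a1) * S q2 (q1%:Z ^+ 3 * a2).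
Proof.
rewrite !gauss_sumE (reindex _ (onW_bij _ crt_vec_bij)) /=.
rewrite mulr_suml; under [RHS]eq_bigr do rewrite mulr_sumr.
rewrite pair_big /=; apply: eq_bigr => -[x1 x2] _ /=.
rewrite -psi_mulr -psi_mull -psiD; apply: psi_congr => //.
set A := q2%:Z; set B := q1%:Z.
have d1 := dvd_tri_congr symc (vresK q0 (crt_vec (x1, x2))).
have E : C (crt_vec (x1, x2)) = A ^+ 3 * C (vres x1) + B ^+ 3 * C (vres x2) +
   B * A * (3 * A * tri c (vres x1) (vres x1) (vres x2) + 3 * B * tri c (vres x2) (vres x2) (vres x1)).
  by rewrite /crt_vec tri_cubeD // !triE //=; ring.
rewrite PoszM -/A -/B in d1 *.
have -> : (A * a1 + B * a2) * C (vres (vmod q0 (crt_vec (x1, x2)))) -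
  (A * (A ^+ 3 * a1 * C (vres x1)) + B * (B ^+ 3 * a2 * C (vres x2))) =
  (A * a1 + B * a2) * (C (vres (vmod q0 (crt_vec (x1, x2)))) - C (crt_vec (x1, x2))) +
  B * A * ((A * a1 + B * a2) * (3 * A * tri c (vres x1) (vres x1) (vres x2) + 3 * B * tri c (vres x2) (vres x2) (vres x1))
   + a1 * B ^+ 2 * C (vres x2) + a2 * A ^+ 2 * C (vres x1)).
  by rewrite E; ring.
by apply: rpredD; [exact: dvdz_mull | exact: dvdz_mulr].
Qed.

Lemma coprimez_crt (a1 a2 : int) :
  coprimez (q2%:Z * a1 + q1%:Z * a2) (q1 * q2)%N%:Z = coprimez a1 q1%:Z && coprimez a2 q2%:Z.
Proof.
have c12 : coprimez q2%:Z q1%:Z by rewrite coprimezE /= coprime_sym.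
have c21 : coprimez q1%:Z q2%:Z by rewrite coprimezE /=.
rewrite PoszM coprimezMr; congr (_ && _).
  by rewrite /coprimez gcdzC addrC mulrC gcdzMDl gcdzC -/(coprimez _ _) coprimezMl c12.
by rewrite /coprimez gcdzC mulrC gcdzMDl gcdzC -/(coprimez _ _) coprimezMl c21.
Qed.

Lemma crt_bij : bijective (fun a : 'I_q1 * 'I_q2 =>
  zred q0 (q2%:Z * (a.1 : nat)%:Z + q1%:Z * (a.2 : nat)%:Z)).
Proof.
apply: inj_card_bij; last by rewrite card_prod !card_ord.
move=> [a1 a2] [b1 b2] /= E; have [|-> ->//] := @crt_inj a1 b1 a2 b2.
have := rpredB (zredP q0 (q2%:Z * (b1 : nat)%:Z + q1%:Z * (b2 : nat)%:Z))
  (zredP q0 (q2%:Z * (a1 : nat)%:Z + q1%:Z * (a2 : nat)%:Z)).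
by rewrite E; congr (_ %| _)%Z; ring.
Qed.

End GaussCRT.

Section SeriesMultiplicative.
Variables (R : realType) (n : nat) (c : 'I_n -> 'I_n -> 'I_n -> int).
Hypothesis symc : symmetric_coeffs c.
Local Notation S := (gauss_sum R c).

Lemma unit_twist (T : nmodType) (theta : R[i] -> T) q (b : int) : (0 < q)%N -> coprimez b q%:Z ->
  \sum_(a < q | coprime a q) theta (S q (b * a%:Z)) = \sum_(a < q | coprime a q) theta (S q a%:Z).
Proof.
move=> q0 cb; pose f (a : 'I_q) := zred q0 (b * (a : nat)%:Z).
have inj : injective f.
  move=> a a' E; apply: val_inj; apply: dvdz_sub_small (ltn_ord a) (ltn_ord a') _.
  have : (q%:Z %| b * ((a : nat)%:Z - (a' : nat)%:Z))%Z.
    have := rpredB (zredP q0 (b * (a' : nat)%:Z)) (zredP q0 (b * (a : nat)%:Z)).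
    by rewrite -!/(f _) E; congr (_ %| _)%Z; ring.
  by rewrite Gauss_dvdzr // coprimez_sym.
rewrite [RHS](reindex_inj inj); apply: eq_big => [a|a _].
  by rewrite (coprime_congr (zredP q0 _)) coprimezMl cb.
congr theta; apply: gauss_sum_congr => //.
by rewrite -opprB rpredN zredP.
Qed.

(** The parameter theta covers the series itself (the identity) and its absolute version (the
    modulus) at once. *)
Lemma complete_sum_mul (T : comPzRingType) (theta : R[i] -> T) q1 q2 :
  (forall x y, theta (x * y) = theta x * theta y) ->
  (0 < q1)%N -> (0 < q2)%N -> coprime q1 q2 ->
  \sum_(a < q1 * q2 | coprime a (q1 * q2)) theta (S (q1 * q2) a%:Z) =
  (\sum_(a < q1 | coprime a q1) theta (S q1 a%:Z)) *
  (\sum_(a < q2 | coprime a q2) theta (S q2 a%:Z)).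
Proof.
move=> thM q10 q20 q12.
have q0 : (0 < q1 * q2)%N by rewrite muln_gt0 q10.
rewrite (reindex _ (onW_bij _ (crt_bij q10 q20 q12))) /=.
transitivity (\sum_(a1 < q1 | coprime a1 q1) \sum_(a2 < q2 | coprime a2 q2)
   theta (S q1 (q2%:Z ^+ 3 * a1%:Z)) * theta (S q2 (q1%:Z ^+ 3 * a2%:Z))).
  rewrite pair_big /=; apply: eq_big => [a|a _].
    rewrite (coprime_congr (zredP q0 _)).
    exact: coprimez_crt.
  rewrite -thM -gauss_sum_mul //; congr theta; apply: gauss_sum_congr => //.
  exact: zredP.
have c1 : coprimez (q2%:Z ^+ 3) q1%:Z by rewrite coprimezXl // coprimezE /= coprime_sym.
have c2 : coprimez (q1%:Z ^+ 3) q2%:Z by rewrite coprimezXl // coprimezE.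
rewrite -(unit_twist theta q10 c1) -(unit_twist theta q20 c2) mulr_suml.
by apply: eq_bigr => a1 _; rewrite mulr_sumr.
Qed.

Lemma ss_term_mul q1 q2 : (0 < q1)%N -> (0 < q2)%N -> coprime q1 q2 ->
  ss_term R c (q1 * q2) = ss_term R c q1 * ss_term R c q2.
Proof.
move=> q10 q20 q12; rewrite /ss_term -!mulr_suml (complete_sum_mul (theta := id)) //.
by rewrite natrM exprMn invfM; ring.
Qed.

Lemma ss_abs_term_mul q1 q2 : (0 < q1)%N -> (0 < q2)%N -> coprime q1 q2 ->
  ss_abs_term R c (q1 * q2) = ss_abs_term R c q1 * ss_abs_term R c q2.
Proof.
move=> q10 q20 q12; rewrite /ss_abs_term -!mulr_suml.
rewrite (complete_sum_mul (theta := @Normc.normc R)) //; last exact: Normc.normcM.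
by rewrite natrM exprMn invfM; ring.
Qed.

Lemma ss_term_le q : Normc.normc (ss_term R c q) <= ss_abs_term R c q.
Proof.
apply: le_trans (cabs_sum _ _ _) _; apply: ler_sum => a _; rewrite cabsM.
rewrite Normc.normcV -natrX -[X in (Normc.normc X)^-1](rmorph_nat (real_complex R)) /= expr0n /= addr0.
by rewrite sqrtr_sqr ger0_norm // natrX.
Qed.

Lemma ss_term1 : ss_term R c 1 = 1.
Proof.
rewrite /ss_term (big_pred1 ord0) => [|a]; last by rewrite (ord1 a) coprimen1.
rewrite expr1n invr1 mulr1 gauss_sumE.
rewrite (eq_bigr (fun=> 1)) => [|y _]; last by rewrite mul0r psi0.
by rewrite sumr_const card_ffun !card_ord exp1n.
Qed.

Lemma ss_abs_term1 : ss_abs_term R c 1 = 1.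
Proof.
rewrite /ss_abs_term (big_pred1 ord0) => [|a]; last by rewrite (ord1 a) coprimen1.
rewrite expr1n invr1 mulr1 gauss_sumE.
rewrite (eq_bigr (fun=> 1)) => [|y _]; last by rewrite mul0r psi0.
by rewrite sumr_const card_ffun !card_ord exp1n Normc.normc1.
Qed.

End SeriesMultiplicative.

(** * Euler products *)

(** The integers with all prime factors below N and all exponents below K, listed recursively so
    that a multiplicative sum over them becomes a truncated Euler product. *)
Fixpoint smooth_seq (K N : nat) : seq nat :=
  if N is p.+1 then
    if prime p then [seq (q * p ^ k)%N | q <- smooth_seq K p, k <- iota 0 K]
    else smooth_seq K p
  else [:: 1%N].

Lemma smooth_seqP K N q : q \in smooth_seq K N ->
  (0 < q)%N /\ forall p, prime p -> (p %| q)%N -> (p < N)%N.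
Proof.
elim: N q => [|N IH] q /=.
  by rewrite inE => /eqP->; split=> // p pp; rewrite dvdn1 => /eqP E; move: pp; rewrite E.
case: ifP => [pN|_] /=.
  move=> /allpairsP[[r k] /= [/IH[r0 hr] _ ->]]; split.
    by rewrite muln_gt0 r0 expn_gt0 prime_gt0.
  move=> p pp; rewrite Euclid_dvdM // => /orP[/(hr _ pp)/ltnW //|].
  by rewrite Euclid_dvdX // => /andP[]; rewrite dvdn_prime2 // => /eqP->.
by move=> /IH[q0 hq]; split=> // p pp /(hq _ pp) /ltnW.
Qed.

Lemma smooth_seq_coprime K N q : prime N -> q \in smooth_seq K N -> coprime N q.
Proof.
move=> pN /smooth_seqP[q0 hq]; rewrite prime_coprime //; apply/negP => /(hq _ pN).
by rewrite ltnn.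
Qed.

Lemma mem_smooth_seq K N q : (0 < K)%N -> (0 < q)%N ->
  (forall p, prime p -> (p %| q)%N -> (p < N)%N) ->
  (forall p, (logn p q < K)%N) -> q \in smooth_seq K N.
Proof.
move=> K0; elim: N q => [|N IH] q q0 hq hl /=.
  rewrite inE; apply/negPn/negP => q1.
  have q2 : (1 < q)%N by rewrite ltn_neqAle eq_sym q1.
  by have := hq _ (pdiv_prime q2) (pdiv_dvd q).
case: ifP => [pN|npN].
  have [m cm E] := pfactor_coprime pN q0.
  have m0 : (0 < m)%N by move: q0; rewrite E muln_gt0 => /andP[].
  rewrite E; apply: (allpairs_f (fun q k => q * N ^ k)%N); last first.
    by rewrite mem_iota /= add0n hl.
  apply: IH => //.
    move=> p pp pm; have := hq p pp; rewrite E dvdn_mulr // ltnS => /(_ isT).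
    rewrite leq_eqVlt => /orP[/eqP pE|//].
    by move: cm; rewrite -pE prime_coprime // pm.
  move=> p; apply: leq_ltn_trans (hl p).
  by apply: dvdn_leq_log => //; rewrite E dvdn_mulr.
apply: IH => // p pp pq; have := hq p pp pq; rewrite ltnS leq_eqVlt => /orP[/eqP E|//].
by rewrite E npN in pp.
Qed.

Lemma uniq_smooth_seq K N : uniq (smooth_seq K N).
Proof.
elim: N => [//|N IH] /=; case: ifP => // pN.
apply: allpairs_uniq => //; first exact: iota_uniq.
move=> [q k] [r l] /allpairsP[[q1 k1] /= [Hq _ [-> ->]]] /allpairsP[[r1 l1] /= [Hr _ [-> ->]]] E.
have [q0 _] := smooth_seqP Hq; have [r0 _] := smooth_seqP Hr.
have L : forall s j, s \in smooth_seq K N -> logn N (s * N ^ j) = j.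
  move=> s j hs; have [s0 _] := smooth_seqP hs.
  rewrite lognM ?expn_gt0 ?(prime_gt0 pN) // pfactorK // logn_coprime //.
  exact: smooth_seq_coprime hs.
have Ek : k1 = l1 by rewrite -(L _ k1 Hq) E L.
move: E; rewrite -Ek => /eqP; rewrite eqn_pmul2r ?expn_gt0 ?(prime_gt0 pN) // => /eqP->.
by [].
Qed.

Lemma smooth_seq_sum (T : comPzRingType) (F : nat -> T) K N :
  F 1%N = 1 ->
  (forall q r, (0 < q)%N -> (0 < r)%N -> coprime q r -> F (q * r)%N = F q * F r) ->
  \sum_(q <- smooth_seq K N) F q = \prod_(0 <= p < N | prime p) \sum_(0 <= k < K) F (p ^ k)%N.
Proof.
move=> F1 FM; elim: N => [|N IH] /=; first by rewrite big_geq // big_seq1.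
rewrite [RHS]big_mkcond big_nat_recr //= -big_mkcond -IH /=.
case: ifP => pN; last by rewrite mulr1.
rewrite big_allpairs_dep /= mulr_suml big_seq [RHS]big_seq; apply: eq_bigr => q hq.
rewrite mulr_sumr /index_iota subn0; apply: eq_bigr => k _.
have [q0 _] := smooth_seqP hq.
rewrite FM // ?expn_gt0 ?(prime_gt0 pN) //.
by rewrite coprimeXr // coprime_sym (smooth_seq_coprime pN hq).
Qed.

(** Every q with 1 <= q < N occurs in the list: its prime factors are at most q and its exponents
    are below q, hence below K. *)
Lemma smooth_seq_split (V : nmodType) (F : nat -> V) K N : (0 < N)%N -> (N <= K)%N ->
  \sum_(q <- smooth_seq K N) F q =
  \sum_(1 <= q < N) F q + \sum_(q <- smooth_seq K N | (N <= q)%N) F q.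
Proof.
move=> N0 NK; rewrite (bigID (fun q => q < N)%N) /=; congr (_ + _); last first.
  by apply: eq_bigl => q; rewrite -leqNgt.
rewrite -big_filter; apply: perm_big; apply: uniq_perm.
- by rewrite filter_uniq // uniq_smooth_seq.
- exact: iota_uniq.
move=> q; rewrite mem_filter mem_index_iota; apply/andP/andP => [[qN /smooth_seqP[]]//|[q0 qN]].
split=> //; apply: mem_smooth_seq => //; first exact: leq_trans NK.
  by move=> p pp /dvdn_leq -/(_ q0) pq; apply: leq_ltn_trans qN.
move=> p; apply: leq_trans NK; apply: leq_ltn_trans qN.
have [pp|] := boolP (prime p); last by rewrite lognE => /negPf->.
apply: leq_trans (ltnW (ltn_expl _ (prime_gt1 pp))) _.
by apply: dvdn_leq => //; apply: pfactor_dvdnn.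
Qed.

Lemma sum_seq_le (R : numDomainType) (F : nat -> R) (s : seq nat) :
  (forall q, 0 <= F q) -> uniq s -> all (leq 1) s ->
  exists M, \sum_(q <- s) F q <= \sum_(1 <= q < M) F q.
Proof.
move=> F0 us s0; exists (\max_(q <- s) q)%N.+1.
rewrite [leRHS](bigID (fun q => q \in s)) /=.
have -> : \sum_(1 <= q < (\max_(q <- s) q)%N.+1 | q \in s) F q = \sum_(q <- s) F q.
  rewrite -[LHS]big_filter; apply: perm_big; apply: uniq_perm => //.
    by rewrite filter_uniq // iota_uniq.
  move=> q; rewrite mem_filter mem_index_iota; case: (boolP (q \in s)) => //= qs.
  by rewrite [(0 < q)%N](allP s0 _ qs) ltnS (leq_bigmax_seq (F := fun q => q)).
by rewrite lerDl sumr_ge0.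
Qed.

(** * Convergence of real and complex sequences *)

Section Limits.
Local Open Scope classical_set_scope.
Local Open Scope ring_scope.
Variable R : realType.
Local Notation cabs := (@Normc.normc R).
Local Notation Re := (@complex.Re R).
Local Notation Im := (@complex.Im R).

(* In [ccvg_to], [Re] and [Im] are [Num.Re] and [Num.Im], with values in [R[i]]; here they are
   real-valued. *)
Definition ccvg (u : nat -> R[i]) (l : R[i]) : Prop :=
  (fun N => Re (u N)) @ \oo --> Re l /\ (fun N => Im (u N)) @ \oo --> Im l.

(** A positive element of R[i] is real, so both notions of convergence quantify over the same
    radii. *)
Lemma cvg_real_complex (x : nat -> R) (a : R) :
  x @ \oo --> a -> (fun N => (x N)%:C%C : Num.ClosedField.sort R[i]) @ \oo --> (a%:C%C : Num.ClosedField.sort R[i]).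
Proof.
move=> /cvgrPdist_lt H; apply/(@cvgrPdist_lt R[i] (Num.ClosedField.sort R[i] : pseudoMetricNormedZmodType R[i])).
move=> -[e e'] /=; rewrite ltcE /= => /andP[/eqP-> e0].
near=> N; rewrite -rmorphB /= normc_def /= expr0n addr0 sqrtr_sqr ltcE /= eqxx /=.
by near: N; apply: H.
Unshelve. all: by end_near. Qed.

Lemma ccvg_ccvg_to (u : nat -> R[i]) (l : R[i]) : ccvg u l -> ccvg_to u l.
Proof.
move=> [hr hi]; split.
  rewrite -complexRe; under eq_fun do rewrite -complexRe.
  exact: cvg_real_complex.
rewrite -complexIm; under eq_fun do rewrite -complexIm.
exact: cvg_real_complex.
Qed.

Lemma Re_le_cabs (z : R[i]) : `|Re z| <= cabs z.
Proof. by case: z => a b /=; rewrite -sqrtr_sqr ler_wsqrtr // lerDl sqr_ge0. Qed.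

Lemma Im_le_cabs (z : R[i]) : `|Im z| <= cabs z.
Proof. by case: z => a b /=; rewrite -sqrtr_sqr ler_wsqrtr // lerDr sqr_ge0. Qed.

Lemma psum_nondecreasing (v : nat -> R) m : (forall q, 0 <= v q) ->
  nondecreasing_seq (fun N => \sum_(m <= q < N) v q).
Proof.
move=> v0; apply/nondecreasing_seqP => N; have [mN|Nm] := leqP m N.
  by rewrite big_nat_recr //= lerDl.
by rewrite !big_geq // ltnW.
Qed.

Lemma psum_cvg (v : nat -> R) m B : (forall q, 0 <= v q) ->
  (forall N, \sum_(m <= q < N) v q <= B) ->
  cvgn (fun N => \sum_(m <= q < N) v q).
Proof.
move=> v0 hB; apply: nondecreasing_is_cvgn; first exact: psum_nondecreasing.
by exists B => _ [N _ <-].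
Qed.

Lemma abs_psum_cvg (h v : nat -> R) m B : (forall q, `|h q| <= v q) ->
  (forall N, \sum_(m <= q < N) v q <= B) ->
  cvgn (fun N => \sum_(m <= q < N) h q).
Proof.
move=> hv hB; have v0 q : 0 <= v q by apply: le_trans (hv q).
have c1 : cvgn (fun N => \sum_(m <= q < N) (v q + h q)).
  apply: (@psum_cvg _ _ (B + B)) => [q|N].
    by have := hv q; rewrite ler_norml => /andP[]; lra.
  rewrite big_split /= lerD //; apply: le_trans (hB N); apply: ler_sum => q _.
  exact: le_trans (ler_norm _) (hv q).
have c2 := psum_cvg v0 hB.
have -> : (fun N => \sum_(m <= q < N) h q) =
  (fun N => \sum_(m <= q < N) (v q + h q)) \- (fun N => \sum_(m <= q < N) v q).
  by apply/funext => N /=; rewrite -sumrB; apply: eq_bigr => q _; rewrite [v q + _]addrC addrK.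
exact: is_cvgB.
Qed.

Lemma Re_sum (I : Type) (r : seq I) (P : pred I) (F : I -> R[i]) :
  Re (\sum_(i <- r | P i) F i) = \sum_(i <- r | P i) Re (F i).
Proof. by apply: (big_morph _ (id1 := 0) (op1 := +%R)) => // -[a b] [a' b']. Qed.

Lemma Im_sum (I : Type) (r : seq I) (P : pred I) (F : I -> R[i]) :
  Im (\sum_(i <- r | P i) F i) = \sum_(i <- r | P i) Im (F i).
Proof. by apply: (big_morph _ (id1 := 0) (op1 := +%R)) => // -[a b] [a' b']. Qed.

Lemma abs_ccvg (g : nat -> R[i]) (v : nat -> R) m B : (forall q, cabs (g q) <= v q) ->
  (forall N, \sum_(m <= q < N) v q <= B) ->
  exists l, ccvg (fun N => \sum_(m <= q < N) g q) l.
Proof.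
move=> gv hB.
have /cvg_ex[/= a Ha] : cvgn (fun N => \sum_(m <= q < N) Re (g q)).
  by apply: abs_psum_cvg hB => q; apply: le_trans (gv q); apply: Re_le_cabs.
have /cvg_ex[/= b Hb] : cvgn (fun N => \sum_(m <= q < N) Im (g q)).
  by apply: abs_psum_cvg hB => q; apply: le_trans (gv q); apply: Im_le_cabs.
exists (a +i* b)%C; split=> /=.
  by under eq_fun do rewrite Re_sum.
by under eq_fun do rewrite Im_sum.
Qed.

Lemma ccvg_cst (l : R[i]) : ccvg (fun=> l) l.
Proof. by split; apply: cvg_cst. Qed.

Lemma ccvgM (a b : nat -> R[i]) l m : ccvg a l -> ccvg b m ->
  ccvg (fun N => a N * b N) (l * m).
Proof.
have ReM (x y : R[i]) : Re (x * y) = Re x * Re y - Im x * Im y by case: x y => [??] [??].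
have ImM (x y : R[i]) : Im (x * y) = Re x * Im y + Im x * Re y by case: x y => [??] [??].
move=> [a1 a2] [b1 b2]; split.
  rewrite ReM; under eq_fun do rewrite ReM.
  by apply: cvgB; apply: cvgM.
rewrite ImM; under eq_fun do rewrite ImM.
by apply: cvgD; apply: cvgM.
Qed.

Lemma ccvg_prod (P : pred nat) (a : nat -> nat -> R[i]) (l : nat -> R[i]) N :
  (forall p, P p -> ccvg (a p) (l p)) ->
  ccvg (fun K => \prod_(0 <= p < N | P p) a p K) (\prod_(0 <= p < N | P p) l p).
Proof.
move=> H; elim: N => [|N IH].
  rewrite big_geq //; under eq_fun do rewrite big_geq //.
  exact: ccvg_cst.
rewrite big_mkcond big_nat_recr //= -big_mkcond.
under eq_fun do rewrite big_mkcond big_nat_recr //= -big_mkcond.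
by apply: ccvgM => //; case: ifP => [/H|_] //; apply: ccvg_cst.
Qed.

Lemma ccvg_near (a b : nat -> R[i]) (l : R[i]) (e : nat -> R) :
  ccvg a l -> e @ \oo --> (0 : R) ->
  (forall N, `|Re (b N) - Re (a N)| <= e N) ->
  (forall N, `|Im (b N) - Im (a N)| <= e N) -> ccvg b l.
Proof.
have real_near (x y : nat -> R) (z : R) : x @ \oo --> z -> e @ \oo --> (0 : R) ->
    (forall N, `|y N - x N| <= e N) -> y @ \oo --> z.
  move=> xz e0 H; have -> : y = x \+ (y \- x) by apply/funext => N /=; rewrite addrC subrK.
  rewrite -[z]addr0; apply: cvgD => //; apply/norm_cvg0P.
  apply: (@squeeze_cvgr _ _ _ _ (cst 0) e) => //; last exact: cvg_cst.
  by near=> N; rewrite normr_ge0 H.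
by move=> [a1 a2] e0 h1 h2; split; [apply: real_near a1 _ _ | apply: real_near a2 _ _].
Unshelve. all: by end_near. Qed.

End Limits.

Section EulerProduct.
Local Open Scope classical_set_scope.
Local Open Scope ring_scope.
Variable R : realType.
Local Notation cabs := (@Normc.normc R).
Local Notation Re := (@complex.Re R).
Local Notation Im := (@complex.Im R).

Variables (u : nat -> R) (g : nat -> R[i]) (B : R).
Hypotheses (u1 : u 1%N = 1) (g1 : g 1%N = 1).
Hypothesis uM : forall q r, (0 < q)%N -> (0 < r)%N -> coprime q r -> u (q * r)%N = u q * u r.
Hypothesis gM : forall q r, (0 < q)%N -> (0 < r)%N -> coprime q r -> g (q * r)%N = g q * g r.
Hypothesis gu : forall q, cabs (g q) <= u q.
Hypothesis gpos : forall p, prime p -> exists2 d : R, 0 < d &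
  forall N, exists2 x : R, d <= x & \sum_(0 <= k < N.+1) g (p ^ k)%N = x%:C%C.
Hypothesis hB : forall N K, \sum_(0 <= p < N | prime p) \sum_(1 <= k < K) u (p ^ k)%N <= B.

Let u0 q : 0 <= u q. Proof. exact: le_trans (cabs_ge0 _) (gu q). Qed.

(** All q < N + 1 are among the smooth integers, and each Euler factor 1 + x is at most exp x. *)
Lemma euler_psum_le N : \sum_(1 <= q < N) u q <= expR B.
Proof.
case: N => [|N]; first by rewrite big_geq ?expR_ge0.
apply: (@le_trans _ _ (\sum_(q <- smooth_seq N.+1 N.+1) u q)).
  by rewrite (smooth_seq_split u (ltn0Sn N)) // lerDl sumr_ge0.
rewrite (smooth_seq_sum _ _ u1 uM); apply: (@le_trans _ _
   (\prod_(0 <= p < N.+1 | prime p) expR (\sum_(1 <= k < N.+1) u (p ^ k)%N))).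
  apply: ler_prod => p _; rewrite sumr_ge0 //= (big_ltn (ltn0Sn N)) expn0 u1.
  exact: expR_ge1Dx.
by rewrite -expR_sum ler_expR.
Qed.

Let S := limn (fun N => \sum_(1 <= q < N) u q).

Lemma euler_psum_cvg : (fun N => \sum_(1 <= q < N) u q) @ \oo --> S.
Proof. exact: (psum_cvg u0 euler_psum_le). Qed.

Lemma euler_psum_le_lim N : \sum_(1 <= q < N) u q <= S.
Proof.
apply: (@nondecreasing_cvgn_le _ (fun N => \sum_(1 <= q < N) u q)).
  exact: psum_nondecreasing.
exact: euler_psum_cvg.
Qed.

(** Only smooth q >= N survive the cancellation; they are bounded by the tail of the absolute
    series, uniformly in K. *)
Lemma smooth_tail_le N K : (0 < N)%N -> (N <= K)%N ->
  cabs (\prod_(0 <= p < N | prime p) \sum_(0 <= k < K) g (p ^ k)%N - \sum_(1 <= q < N) g q)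
  <= S - \sum_(1 <= q < N) u q.
Proof.
move=> N0 NK; rewrite -(smooth_seq_sum _ _ g1 gM) (smooth_seq_split g N0 NK) addrC addKr.
apply: le_trans (cabs_sum _ _ _) _.
apply: (@le_trans _ _ (\sum_(q <- smooth_seq K N | (N <= q)%N) u q)).
  by apply: ler_sum => q _.
rewrite lerBrDl -(smooth_seq_split u N0 NK).
have pos : all (leq 1) (smooth_seq K N) by apply/allP => q /smooth_seqP[].
have [M hM] := sum_seq_le u0 (uniq_smooth_seq K N) pos.
exact: le_trans hM (euler_psum_le_lim M).
Qed.

Lemma prime_psum_le p N : prime p -> \sum_(0 <= k < N) u (p ^ k)%N <= S.
Proof.
move=> pp; have us : uniq [seq (p ^ k)%N | k <- index_iota 0 N].
  rewrite map_inj_uniq ?iota_uniq // => a b /eqP.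
  by rewrite eqn_exp2l ?prime_gt1 // => /eqP.
have pos : all (leq 1) [seq (p ^ k)%N | k <- index_iota 0 N].
  by apply/allP => _ /mapP[k _ ->]; rewrite expn_gt0 prime_gt0.
have [M] := sum_seq_le u0 us pos; rewrite big_map => /le_trans; apply; exact: euler_psum_le_lim.
Qed.

Let v p := limn (fun N => \sum_(1 <= k < N) u (p ^ k)%N).

Lemma euler_factor_cvg p : prime p -> (fun N => \sum_(1 <= k < N) u (p ^ k)%N) @ \oo --> v p.
Proof.
move=> pp; apply: (@psum_cvg _ (fun k => u (p ^ k)%N) 1 S) => // N.
apply: le_trans (prime_psum_le N pp); case: N => [|N]; first by rewrite !big_geq.
by rewrite [leRHS]big_ltn // lerDr.
Qed.

(** The sum of v over primes inherits the bound B, so its tails are eventually small; 1/2 keeps the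
    tail of the product away from 0. *)
Lemma euler_factor_tail : exists N0, forall N, \sum_(N0 <= p < N | prime p) v p <= 2^-1.
Proof.
have v0 p : prime p -> 0 <= v p.
  move=> pp; have := euler_factor_cvg pp; move=> /cvgr_to_ge; apply.
  by near=> K; rewrite sumr_ge0.
pose w p := if prime p then v p else 0.
have w0 p : 0 <= w p by rewrite /w; case: ifP => // /v0.
have wB N : \sum_(0 <= p < N) w p <= B.
  rewrite -big_mkcond.
  have H : (fun K => \sum_(0 <= p < N | prime p) \sum_(1 <= k < K) u (p ^ k)%N) @ \oo
     --> \sum_(0 <= p < N | prime p) v p.
    elim: N => [|N IH].
      rewrite big_geq //; under eq_fun do rewrite big_geq //.
      exact: cvg_cst.
    rewrite big_mkcond big_nat_recr //= -big_mkcond.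
    under eq_fun do rewrite big_mkcond big_nat_recr //= -big_mkcond.
    by apply: cvgD => //; case: ifP => [/euler_factor_cvg|_] //; apply: cvg_cst.
  by move/cvgr_to_le: H; apply; near=> K; apply: hB.
have wc := psum_cvg w0 wB.
have /cvgrPdist_le/(_ 2^-1) := wc; rewrite invr_gt0 ltr0n => /(_ isT) [N0 _ hN0].
exists N0 => N; have [NN|NN] := leqP N0 N; last by rewrite big_geq ?invr_ge0 // ltnW.
have := hN0 N0 (leqnn _); move/(le_trans (ler_norm _)); apply: le_trans.
have := nondecreasing_cvgn_le (psum_nondecreasing 0 w0) wc N.
by rewrite (big_cat_nat (n := N0)) //= -[X in _ + X <= _]big_mkcond -lerBrDl.
Unshelve. all: by end_near. Qed.

(** The Weierstrass inequality, that the product of 1 - v_p is at least 1 minus the sum of the v_p;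
    the bound 1/2 keeps the factors nonnegative in the induction. *)
Lemma ge_psum_prod (y : nat -> R) N0 N :
  (forall p, prime p -> 1 - v p <= y p) -> (forall p, prime p -> 0 < y p) ->
  (forall M, \sum_(N0 <= p < M | prime p) v p <= 2^-1) ->
  1 - \sum_(N0 <= p < N | prime p) v p <= \prod_(N0 <= p < N | prime p) y p.
Proof.
move=> hy y0 hv; elim: N => [|N IH]; first by rewrite !big_geq // subr0.
have [NN|NN] := leqP N0 N; last by rewrite !big_geq // subr0.
have := hv N.+1; rewrite !(big_mkcond prime) !(big_nat_recr (op := +%R)) // (big_nat_recr (op := *%R)) //=.
rewrite -!(big_mkcond prime); case: ifP => [pp|_]; last by rewrite !addr0 mulr1.
have s0 : 0 <= \sum_(N0 <= p < N | prime p) v p.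
  apply: sumr_ge0 => p pp'; have := euler_factor_cvg pp'; move=> /cvgr_to_ge; apply.
  by near=> K; rewrite sumr_ge0.
have v0 : 0 <= v N.
  have := euler_factor_cvg pp; move=> /cvgr_to_ge; apply.
  by near=> K; rewrite sumr_ge0.
move: IH (hy N pp) s0 v0.
set s := \sum_(_ <= _ < _ | _) _; set P := \prod_(_ <= _ < _ | _) _ => IH hyN s0 v0 hs.
apply: (@le_trans _ _ ((1 - s) * (1 - v N))); last by apply: ler_pM => //; lra.
by have := mulr_ge0 s0 v0; lra.
Unshelve. all: by end_near. Qed.

(** The product formula follows from [smooth_tail_le] by letting K tend to infinity at fixed N. For
    positivity, every factor is real and positive by [gpos], and the factors beyond N0 have product
    at least 1/2. *)
Theorem euler_product : exists (l : R[i]) (chi : nat -> R[i]),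
  [/\ ccvg (fun N => \sum_(1 <= q < N) g q) l,
      forall p, prime p -> ccvg (fun N => \sum_(0 <= k < N) g (p ^ k)%N) (chi p),
      ccvg (fun N => \prod_(0 <= p < N | prime p) chi p) l & 0 < l].
Proof.
have [l hl] := abs_ccvg gu euler_psum_le.
have hp p : exists x, prime p -> ccvg (fun N => \sum_(0 <= k < N) g (p ^ k)%N) x.
  have [pp|_] := boolP (prime p); last by exists 0.
  have [x hx] := @abs_ccvg _ (fun k => g (p ^ k)%N) (fun k => u (p ^ k)%N) 0 S
    (fun k => gu _) (fun N => prime_psum_le N pp).
  by exists x.
have [chi hchi] := choice hp.
have hprod N := ccvg_prod N hchi.
have tail0 : (fun N => S - \sum_(1 <= q < N) u q) @ \oo --> (0 : R).
  by have := cvgB (cvg_cst S) euler_psum_cvg; rewrite subrr; apply.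
have norm_lim (x : nat -> R) (y z e : R) (N : nat) : x @ \oo --> y ->
    (forall K, (N <= K)%N -> `|x K - z| <= e) -> `|y - z| <= e.
  move=> xy H; have : (fun K => `|x K - z|) @ \oo --> `|y - z|.
    by apply: cvg_norm; apply: cvgB => //; apply: cvg_cst.
  move=> /cvgr_to_le; apply; near=> K; apply: H; near: K; exact: nbhs_infty_ge.
have ReB (x y : R[i]) : Re x - Re y = Re (x - y) by case: x y => [??] [??].
have ReD (x y : R[i]) : Re (x + y) = Re x + Re y by case: x y => [??] [??].
have ImB (x y : R[i]) : Im x - Im y = Im (x - y) by case: x y => [??] [??].
have hP : ccvg (fun N => \prod_(0 <= p < N | prime p) chi p) l.
  (* Needed at N = 0, where the empty product is 1 and the empty sum is 0. *)
  have S1 : 1 <= S by have := euler_psum_le_lim 2; rewrite big_nat1 u1.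
  apply: (ccvg_near hl tail0) => -[|N].
  - by rewrite !big_geq //= !subr0 normr1.
  - have [h _] := hprod N.+1; apply: (norm_lim _ _ _ _ N.+1 h) => K NK.
    by rewrite ReB; apply: le_trans (Re_le_cabs _) (smooth_tail_le _ _).
  - by rewrite !big_geq //= !subr0 normr0 (le_trans ler01).
  - have [_ h] := hprod N.+1; apply: (norm_lim _ _ _ _ N.+1 h) => K NK.
    by rewrite ImB; apply: le_trans (Im_le_cabs _) (smooth_tail_le _ _).
exists l, chi; split=> //.
have chi_real p : prime p -> [/\ Im (chi p) = 0, 0 < Re (chi p) & 1 - v p <= Re (chi p)].
  move=> pp; have [d d0 hd] := gpos pp; have [hr hi] := hchi p pp.
  split.
  - apply/eqP; rewrite eq_le; apply/andP; split.
      move/cvgr_to_le: hi; apply; exists 1%N => // -[//|K] _ /=.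
      by have [x _ ->] := hd K.
    move/cvgr_to_ge: hi; apply; exists 1%N => // -[//|K] _ /=.
    by have [x _ ->] := hd K.
  - apply: (lt_le_trans d0); move/cvgr_to_ge: hr; apply; exists 1%N => // -[//|K] _ /=.
    by have [x dx ->] := hd K.
  - have h : (fun K => Re (\sum_(0 <= k < K) g (p ^ k)%N) + \sum_(1 <= k < K) u (p ^ k)%N) @ \oo
        --> Re (chi p) + v p by apply: cvgD => //; apply: euler_factor_cvg.
    rewrite lerBlDr; move/cvgr_to_ge: h; apply; exists 1%N => // -[//|K] _.
    rewrite big_ltn // expn0 g1 ReD -addrA lerDl.
    set T := \sum_(_ <= _ < _) _; set U := \sum_(_ <= _ < _) _.
    have TU : `|Re T| <= U.
      apply: le_trans (Re_le_cabs _) _; apply: le_trans (cabs_sum _ _ _) _.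
      exact: ler_sum.
    by move: TU; rewrite ler_norml -lerBlDr sub0r => /andP[].
have [N0 hN0] := euler_factor_tail.
pose y p := Re (chi p).
have chiE N : \prod_(0 <= p < N | prime p) chi p = (\prod_(0 <= p < N | prime p) y p)%:C%C.
  rewrite rmorph_prod; apply: eq_bigr => p /chi_real[hi _ _].
  by move: hi; rewrite /y; case: (chi p) => a b /= ->.
have [hr hi] := hP.
have Iml : Im l = 0.
  have h0 : (fun N => Im (\prod_(0 <= p < N | prime p) chi p)) = (fun=> 0).
    by apply/funext => N; rewrite chiE.
  by move: hi; rewrite h0 => /cvg_lim <- //; rewrite lim_cst.
rewrite ltcE /= Iml eqxx /=.
pose d := \prod_(0 <= p < N0 | prime p) y p.
have d0 : 0 < d by apply: prodr_gt0 => p /chi_real[].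
apply: (@lt_le_trans _ _ (d / 2)); first by rewrite divr_gt0.
move/cvgr_to_ge: hr; apply; exists N0 => // N /= NN.
rewrite chiE /= (big_cat_nat (n := N0)) //= ler_pM2l //.
have := @ge_psum_prod y N0 N (fun p pp => let: And3 _ _ h := chi_real p pp in h)
  (fun p pp => let: And3 _ h _ := chi_real p pp in h) hN0.
apply: le_trans; have := hN0 N; lra.
Unshelve. all: by end_near. Qed.

End EulerProduct.

(** * Positivity of the local densities *)

Lemma psi_Mn (R : realType) q m k : psi R q (k%:Z * m) = psi R q m ^+ k.
Proof.
elim: k => [|k IH]; first by rewrite mul0r psi0.
by rewrite exprSr -IH -psiD -{1}addn1 PoszD mulrDl mul1r.
Qed.

Lemma psi_orthogonality (R : realType) q m : (0 < q)%N ->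
  \sum_(0 <= a < q) psi R q (a%:Z * m) = (q * (q%:Z %| m)%Z)%:R.
Proof.
move=> q0; under eq_bigr do rewrite psi_Mn.
have [qm|nqm] := boolP (q%:Z %| m)%Z.
  under eq_bigr do rewrite psi_dvd // expr1n.
  by rewrite sumr_const_nat subn0 muln1.
apply/eqP; rewrite muln0; have := subrX1 (psi R q m) q; rewrite -psi_Mn psi_dvd ?dvdz_mulr // subrr.
by move/esym/eqP; rewrite mulf_eq0 subr_eq0 (negPf (psi_neq1 R q0 nqm)) /= big_mkord.
Qed.

Lemma sum_multiples (V : nmodType) (f : nat -> V) p q : (0 < p)%N ->
  \sum_(0 <= a < p * q | (p %| a)%N) f a = \sum_(0 <= b < q) f (p * b)%N.
Proof.
move=> p0; rewrite -big_filter -[RHS](big_map (muln p) xpredT f).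
apply: perm_big; apply: uniq_perm.
- by rewrite filter_uniq // iota_uniq.
- by rewrite map_inj_uniq ?iota_uniq // => a b /eqP; rewrite eqn_pmul2l // => /eqP.
move=> a; rewrite mem_filter mem_index_iota /=; apply/andP/mapP => [[/dvdnP[b ->]]|[b + ->]].
  by rewrite [(b * p)%N]mulnC ltn_pmul2l // => bq; exists b => //; rewrite mem_index_iota.
by rewrite mem_index_iota /= => bq; rewrite dvdn_mulr // ltn_pmul2l.
Qed.

Lemma sum_lift (T : pzRingType) n d q (F : ('I_n -> int) -> T) : (0 < q)%N -> periodic q F ->
  \sum_(y : {ffun 'I_n -> 'I_(d * q)}) F (vres y) =
  (d ^ n)%:R * \sum_(y : {ffun 'I_n -> 'I_q}) F (vres y).
Proof.
move=> q0 perF.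
have lt (t : 'I_d) (r : 'I_q) : (t * q + r < d * q)%N.
  apply: (@leq_trans (t.+1 * q)); first by rewrite mulSn addnC ltn_add2r.
  by rewrite leq_mul2r ltn_ord orbT.
pose h (x : {ffun 'I_n -> 'I_d} * {ffun 'I_n -> 'I_q}) : {ffun 'I_n -> 'I_(d * q)} :=
  [ffun i => Ordinal (lt (x.1 i) (x.2 i))].
have hbij : bijective h.
  apply: inj_card_bij; last by rewrite card_prod !card_ffun !card_ord expnMn.
  move=> [t r] [t' r'] /ffunP E; congr (_, _); apply/ffunP => i; apply: val_inj;
    have := E i; rewrite !ffunE /= => -[] e.
    have := congr1 (divn^~ q) e; rewrite !divnMDl //.
    by rewrite !(divn_small (ltn_ord _)) !addn0.
  have := congr1 (modn^~ q) e; rewrite !modnMDl.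
  by rewrite !(modn_small (ltn_ord _)).
rewrite (reindex h) /=; last exact: onW_bij.
rewrite -(pair_big xpredT xpredT (fun t r => F (vres (h (t, r))))) /=.
rewrite (eq_bigr (fun=> \sum_(y : {ffun 'I_n -> 'I_q}) F (vres y))) => [|t _].
  by rewrite sumr_const card_ffun !card_ord mulr_natl.
apply: eq_bigr => r _; apply: perF => i; rewrite /vres ffunE /=.
by apply/dvdzP; exists (t i : nat)%:Z; rewrite PoszD PoszM addrK.
Qed.

Section Density.
Variables (R : realType) (n : nat) (c : 'I_n -> 'I_n -> 'I_n -> int).
Hypothesis symc : symmetric_coeffs c.
Local Notation C x := (tri c x x x).
Local Notation S := (gauss_sum R c).

Lemma sum_gauss_sum q : (0 < q)%N -> \sum_(0 <= a < q) S q a%:Z = (q * nzeros c q)%:R.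
Proof.
move=> q0; rewrite exchange_big /=.
rewrite (eq_bigr (fun y : {ffun 'I_n -> 'I_q} => (q * (q%:Z %| C (vres y))%Z)%:R)) => [|y _].
  by rewrite -natr_sum -big_distrr /= /nzeros -sum1dep_card [in RHS]big_mkcond.
exact: psi_orthogonality.
Qed.

Lemma gauss_sum_lift p q a : (0 < p)%N -> (0 < q)%N ->
  S (p * q) (p * a)%N%:Z = (p ^ n)%:R * S q a%:Z.
Proof.
move=> p0 q0; rewrite !gauss_sumE -(@sum_lift _ _ p q (fun x => psi R q (a%:Z * C x))) //.
  by apply: eq_bigr => y _; rewrite PoszM -mulrA psi_mull.
move=> x y h; apply: psi_congr => //.
by rewrite -mulrBr dvdz_mull // dvd_tri_congr.
Qed.

(** The a modulo p^(N+1) that are divisible by p reproduce level N by [gauss_sum_lift]; the others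
    form the new term of the series. *)
Lemma ss_term_psum p N : prime p ->
  \sum_(0 <= k < N.+1) ss_term R c (p ^ k) =
  \sum_(0 <= a < p ^ N) S (p ^ N) a%:Z / (p ^ N)%:R ^+ n.
Proof.
move=> pp; have p0 := prime_gt0 pp; elim: N => [|N IH].
  by rewrite big_nat1 expn0 big_nat1 /ss_term (big_pred1 ord0) // => a; rewrite (ord1 a) coprimen1.
have q0 : (0 < p ^ N)%N by rewrite expn_gt0 p0.
rewrite big_nat_recr //= IH [RHS](bigID (fun a => p %| a)%N) /=; congr (_ + _).
  rewrite expnS sum_multiples //; apply: eq_bigr => a _.
  rewrite gauss_sum_lift // natrM exprMn (natrX _ p n) invfM mulrACA divff ?mul1r //.
  by rewrite -natrX pnatr_eq0 -lt0n expn_gt0 p0.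
rewrite /ss_term -(big_mkord (fun a => coprime a (p ^ N.+1)) (fun a => S (p ^ N.+1) a%:Z / (p ^ N.+1)%:R ^+ n)).
by apply: eq_bigl => a; rewrite coprime_pexpr // coprime_sym prime_coprime.
Qed.

(** Orthogonality in a turns the complete sum into a count of zeros, so the partial sums of chi_p
    are real and bounded below by [nzeros_pos_density]. *)
Lemma ss_term_psum_density p N : prime p ->
  \sum_(0 <= k < N.+1) ss_term R c (p ^ k) =
  ((nzeros c (p ^ N) * p ^ N)%:R / (p ^ (N * n))%:R)%:C%C.
Proof.
move=> pp; rewrite ss_term_psum // -mulr_suml sum_gauss_sum ?expn_gt0 ?prime_gt0 //.
by rewrite -natrX -expnM [RHS](rmorphM (real_complex R)) (fmorphV (real_complex R)) !(rmorph_nat (real_complex R)) mulnC.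
Qed.

End Density.

(** The multiples t x with 0 <= t <= T are T + 1 distinct vectors on which M vanishes. *)
Lemma count_rank0_ge (R : realType) (n : nat) (c : 'I_n -> 'I_n -> 'I_n -> int)
  (x : 'I_n -> int) (H T : nat) i0 :
  (forall j k, \sum_i c i j k * x i = 0) -> x i0 != 0 -> (forall i, `|x i| <= H%:Z) ->
  (T < count_rank c ((T * H)%N%:R : R) 0)%N.
Proof.
move=> x0 xi0 xH; rewrite /count_rank natrK.
have /fin_all_exists[y hy] (t : 'I_T.+1) :
    exists y : {ffun 'I_n -> 'I_(2 * (T * H) + 1)}, bvec y =1 (fun i => (t : nat)%:Z * x i).
  apply: bvec_surj => i; rewrite normrM PoszM ler_pM //.
  by rewrite ger0_norm // lez_nat -ltnS.
have yI : injective y.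
  move=> s t E; apply: val_inj => /=; have := hy s i0; rewrite E hy.
  by move/(mulIf xi0) => -[].
rewrite -[leqLHS]card_ord -(card_imset _ yI); apply/subset_leq_card/fintype.subsetP => z.
case/imsetP => t _ ->; rewrite inE /= rkE.
have -> : intM c (box_vec (y t)) = 0.
  rewrite (eq_intM c (hy t)); apply/matrixP => j k; rewrite !mxE.
  have := congr1 (fun z => (t : nat)%:Z * z) (x0 j k); rewrite mulr0 mulr_sumr => E.
  by apply: etrans E; apply: eq_bigr => i _; ring.
by rewrite map_mx0 mxrank0.
Qed.

Lemma nondegenerate (R : realType) (n : nat) (c : 'I_n -> 'I_n -> 'I_n -> int) :
  davenport_geometric R c ->
  forall x : 'I_n -> int, (forall j k, \sum_i c i j k * x i = 0) -> forall i, x i = 0.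
Proof.
move=> dgc x x0 i0; apply/eqP/negPn/negP => xi0.
have [K hK] := dgc 0%N (leq0n n) 2^-1 ltac:(by rewrite invr_gt0).
pose H := (\sum_i absz (x i))%N.
have H0 : (0 < H)%N by rewrite /H (bigD1 i0) //= addn_gt0 absz_gt0 xi0.
have xH i : `|x i| <= H%:Z by rewrite -abszE lez_nat /H (bigD1 i) //= leq_addr.
pose m := (Num.truncn `|K|).+1.
have mK : K < m%:R by apply: le_lt_trans (ler_norm K) _; apply: truncnS_gt.
(* With T = H m^2 multiples the half-width is P = T H = (H m)^2, and the Geometric Condition for r =
   0, eps = 1/2 would give T < K P^(1/2) < m (H m) = T. *)
have := count_rank0_ge R (H * m ^ 2) x0 xi0 xH.
have P1 : 1 <= ((H * m ^ 2 * H)%N%:R : R) by rewrite ler1n !muln_gt0 H0.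
rewrite -(ltr_nat R) => /lt_le_trans/(_ (hK _ P1)).
rewrite add0r powR12_sqrt //.
have -> : (H * m ^ 2 * H)%N%:R = (H * m)%N%:R ^+ 2 :> R.
  by rewrite -natrX; congr (_%:R); rewrite !expnS expn0; nia.
rewrite sqrtr_sqr ger0_norm // => h.
have : (H * m ^ 2)%N%:R < m%:R * (H * m)%N%:R :> R.
  by apply: lt_trans h _; rewrite ltr_pM2r // ltr0n muln_gt0 H0.
by rewrite -natrM ltr_nat; nia.
Qed.

Theorem theorem1 (R : realType) (n : nat) (c : 'I_n -> 'I_n -> 'I_n -> int) :
  (10 <= n)%N ->
  symmetric_coeffs c ->
  davenport_geometric R c ->
  (* absolute convergence of the singular series *)
  (\sum_(1 <= q <oo) (ss_abs_term R c q)%:E < +oo)%E /\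
  (* the singular series frakS, the p-adic densities chi_p, and
     frakS = prod_p chi_p, frakS > 0 *)
  exists (frakS : R[i]) (chi : nat -> R[i]),
    ccvg_to (fun N => \sum_(1 <= q < N) ss_term R c q) frakS /\
    (forall p : nat, prime p ->
       ccvg_to (fun N => \sum_(0 <= k < N) ss_term R c (p ^ k)) (chi p)) /\
    ccvg_to (fun N => \prod_(p < N | prime p) chi p) frakS /\
    0 < frakS.
Proof.
move=> n10 symc dgc.
have [B hB] := sum_prime_powers_le symc dgc n10.
have abs1 := ss_abs_term1 R c; have one := ss_term1 R c.
have absM := ss_abs_term_mul R symc; have M := ss_term_mul R symc.
have le := @ss_term_le R n c.
split.
  apply: (@le_lt_trans _ _ (expR B)%:E); last exact: ltry.
  apply: lime_le; first by apply: is_cvg_nneseries => q _ _; rewrite lee_fin ss_abs_term_ge0.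
  apply: nearW => N; rewrite sumEFin lee_fin.
  exact: (euler_psum_le abs1 absM le hB).
have pos p : prime p -> exists2 d : R, 0 < d &
    forall N, exists2 x : R, d <= x & \sum_(0 <= k < N.+1) ss_term R c (p ^ k) = x%:C%C.
  move=> pp; have [K K0 hK] := nzeros_pos_density symc (nondegenerate dgc) n10 pp.
  exists K%:R^-1; first by rewrite invr_gt0 ltr0n.
  move=> N; eexists; last exact: (ss_term_psum_density R symc N pp).
  have q0 : 0 < (p ^ (N * n))%:R :> R by rewrite ltr0n expn_gt0 prime_gt0.
  rewrite ler_pdivlMr // mulrC ler_pdivrMr ?ltr0n //.
  by rewrite -natrM ler_nat.
have [l [chi [hl hchi hprod l0]]] := euler_product abs1 one absM M le pos hB.
exists l, chi; split; first exact: ccvg_ccvg_to.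
split; first by move=> p pp; apply: ccvg_ccvg_to; apply: hchi.
split=> //; apply: ccvg_ccvg_to.
by under eq_fun do rewrite -(big_mkord prime chi).
Qed.
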